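(* Let $u\in H^{\frac12}(\mathbb{S}^1,\mathbb{R}^k)$. Let $X$ be a smooth vector field on $\mathbb{S}^1$ and let $\phi_t$ denote its flow. Then $$\langle\mathcal{V}_{\frac12}(u),X\rangle=\frac{d}{dt}\bigg|_{t=0}E_{\frac12}(u\circ\phi_t).$$ In particular, $u$ is a stationary point of $E_{\frac12}$ if and only if $\mathcal{V}_{\frac12}(u)=0$. Moreover, the map $$\mathcal{V}_{\frac12}:H^{\frac12}(\mathbb{S}^1,\mathbb{R}^k)\to\mathscr{D}'(\mathbb{S}^1),\qquad u\mapsto\mathcal{V}_{\frac12}(u)$$ is continuous.
   Context: $\mathbb{S}^1\simeq\mathbb{R}/2\pi\mathbb{Z}$; smooth vector fields on $\mathbb{S}^1$ are identified with smooth functions $X:\mathbb{S}^1\to\mathbb{R}$, and $u'$ denotes the derivative in the angular variable. Maps $u$ take values in a Euclidean space $\mathbb{R}^k$. $\mathscr{D}'(\mathbb{S}^1)$ is the space of distributions on $\mathbb{S}^1$. For a distribution $f$ on $\mathbb{S}^1$, $\widehat f(n)=\frac1{2\pi}\langle f,e^{-inx}\rangle$, and $(-\Delta)^s f$ is defined by $\widehat{(-\Delta)^s f}(n)=|n|^{2s}\widehat f(n)$, $n\in\mathbb{Z}$. The half Dirichlet energy is $E_{\frac12}(u)=\int_{\mathbb{S}^1}|(-\Delta)^{\frac14}u|^2$ for $u\in H^{\frac12}(\mathbb{S}^1,\mathbb{R}^k)$. A map $u\in H^{\frac12}(\mathbb{S}^1,\mathbb{R}^k)$ is a stationary point of $E_{\frac12}$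 if $\frac{d}{dt}\big|_{t=0}E_{\frac12}(u\circ\phi_t)=0$ for every smooth vector field $X$ on $\mathbb{S}^1$ with flow $\phi_t$. For $u\in C^\infty(\mathbb{S}^1,\mathbb{R}^k)$ set $\mathcal{V}_{\frac12}(u)=(-\Delta)^{\frac12}u\cdot u'$. For $u\in H^{\frac12}(\mathbb{S}^1,\mathbb{R}^k)$ the first inner variation of $E_{\frac12}$ at $u$ is the distribution $\mathcal{V}_{\frac12}(u)=\lim_{n\to\infty}(-\Delta)^{\frac12}u_n\cdot u_n'$, the limit being taken in $\mathscr{D}'(\mathbb{S}^1)$, where $(u_n)$ is a sequence of smooth maps converging to $u$ in $H^{\frac12}(\mathbb{S}^1,\mathbb{R}^k)$ (the limit does not depend on the choice of the sequence).
   Formalization: The identity is proved with a factor 2, as d/dt E(u∘φ_t) at t=0 equals 2⟨V(u),X⟩, since with E and V normalised as given the identity without the factor 2 is false (u = cos x + cos 2x, X = sin 3x). *)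

(* Defs.v *)
From HB Require Import structures.
From mathcomp Require Import all_boot all_order all_algebra.
From mathcomp Require Import all_classical all_reals all_analysis.
From mathcomp Require Import measurable_realfun complex ring.

Set Implicit Arguments.
Unset Strict Implicit.
Unset Printing Implicit Defensive.

Import Order.TTheory GRing.Theory Num.Theory.
Import numFieldNormedType.Exports.

Local Open Scope classical_set_scope.
Local Open Scope ring_scope.

(* The circle is R / 2piZ: a map on it is a 2pi-periodic function on the line,
   and an integral over it is an integral over [0, 2pi]. *)
Definition circle {R : realType} : set R := `[0, pi *+ 2].

Definition smooth {R : realType} (f : R -> R) :=
  forall n x, derivable (derive1n n f) x 1.

Section smooth_circle.
Context {R : realType}.
Implicit Types f g : R -> R.

Definition smooth_circle : {pred R -> R} :=
  mem [set f | smooth f /\ periodic f (pi *+ 2)].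

Lemma derive1n_lin n (a : R) f g : smooth f -> smooth g ->
  derive1n n (a *: f + g) = a *: derive1n n f + derive1n n g.
Proof.
move=> sf sg; elim: n => [//|n IH].
rewrite !derive1nS IH; apply/funext => x.
rewrite !fctE !derive1E.
rewrite deriveD ?deriveZ; [by []|exact: sf|exact: derivableZ (sf n x)|exact: sg].
Qed.

Lemma smooth_circle_submod : submod_closed smooth_circle.
Proof.
split=> [|a f g].
  rewrite inE /=; split => // n x.
  suff -> : derive1n n (0 : R -> R) = cst 0 by exact: derivable_cst.
  elim: n => [//|n IH]; rewrite derive1nS IH; apply/funext => y.
  by rewrite derive1E derive_cst.
rewrite !inE /= => -[sf pf] [sg pg]; split=> [n x|x].
  by rewrite derive1n_lin//; apply: derivableD (sg n x); exact: derivableZ (sf n x).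
by rewrite /= !fctE pf pg.
Qed.

HB.instance Definition _ :=
  GRing.isSubmodClosed.Build R (R -> R) smooth_circle smooth_circle_submod.

Lemma trig_smooth (a b m : R) : smooth (fun x => a * cos (m * x) + b * sin (m * x)).
Proof.
have D (c d x : R) : is_derive x 1 (fun y => c * cos (m * y) + d * sin (m * y))
    (m * d * cos (m * x) + - (m * c) * sin (m * x)).
  have dm : is_derive x (1 : R) (fun y => m * y) m.
    have := is_deriveZ m (is_derive_id x (1 : R)).
    by rewrite /GRing.scale /= mulr1.
  have dc := is_derive1_comp (is_derive_cos (m * x)) dm.
  have ds := is_derive1_comp (is_derive_sin (m * x)) dm.
  apply: is_derive_eq (is_deriveD (is_deriveZ c dc) (is_deriveZ d ds)) _.
  by rewrite /GRing.scale /=; ring.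
move=> n; suff [c [d ->]] : exists c d, derive1n n
    (fun x => a * cos (m * x) + b * sin (m * x)) =
    (fun x => c * cos (m * x) + d * sin (m * x)) by move=> x; have [] := D c d x.
elim: n => [|n [c [d IH]]]; first by exists a, b.
exists (m * d), (- (m * c)); rewrite derive1nS IH; apply/funext => x.
by rewrite derive1E; have [] := D c d x.
Qed.

End smooth_circle.

Record test_function (R : realType) := Test {
  test_val :> R -> R ;
  testP : test_val \in smooth_circle }.

HB.instance Definition _ (R : realType) := [isSub of test_function R for @test_val R].
HB.instance Definition _ (R : realType) := [Choice of test_function R by <:].
HB.instance Definition _ (R : realType) := [SubChoice_isSubLmodule of test_function R by <:].


Section trigonometric_tests.
Context {R : realType}.

Lemma periodic_intmul (f : R -> R) (n : int) : periodic f (pi *+ 2) ->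
  periodic (fun x => f (n%:~R * x)) (pi *+ 2).
Proof.
move=> pf x; rewrite mulrDr; case: n => n.
  by rewrite -[_ * (pi *+ 2)]mulrC -[_%:~R]/(n%:R) mulr_natr periodicn.
rewrite NegzE mulrNz -[_%:~R]/(n.+1%:R) !mulNr [n.+1%:R * (_ *+ _)]mulrC mulr_natr.
by rewrite -[LHS](periodicn pf n.+1) subrK.
Qed.

Lemma cosn_smooth_circle (n : int) :
  (fun x : R => cos (n%:~R * x)) \in smooth_circle.
Proof.
rewrite inE; split; last exact/periodic_intmul/cosD2pi.
rewrite (_ : (fun x => _) = (fun x => 1 * cos (n%:~R * x) + 0 * sin (n%:~R * x))).
  exact: trig_smooth.
by apply/funext => x; rewrite mul1r mul0r addr0.
Qed.

Lemma sinn_smooth_circle (n : int) :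
  (fun x : R => sin (n%:~R * x)) \in smooth_circle.
Proof.
rewrite inE; split; last exact/periodic_intmul/sinD2pi.
rewrite (_ : (fun x => _) = (fun x => 0 * cos (n%:~R * x) + 1 * sin (n%:~R * x))).
  exact: trig_smooth.
by apply/funext => x; rewrite mul1r mul0r add0r.
Qed.

Definition cosn (n : int) : test_function R := Test (cosn_smooth_circle n).
Definition sinn (n : int) : test_function R := Test (sinn_smooth_circle n).

End trigonometric_tests.

Definition Cnorm {R : realType} (N : nat) (X : test_function R) : R :=
  \sum_(j < N) sup [set `|derive1n j X x| | x in circle].

(* Elements of D'(S^1): a linear form on the Frechet space C^oo(S^1) is
   continuous iff it is bounded by a multiple of one of the norms Cnorm N. *)
Record circle_distr (R : realType) := Distribution {
  pairing :> test_function R -> R ;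
  pairing_linear : forall a (X Y : test_function R),
    pairing (a *: X + Y) = a * pairing X + pairing Y ;
  pairing_bounded : exists N C, forall X : test_function R,
    `|pairing X| <= C * Cnorm N X }.

Section distributions.
Context {R : realType}.
Implicit Types (X : test_function R) (T : circle_distr R) (f g : R -> R).
Local Notation mu := (@lebesgue_measure R).

Definition circle_integrable f := mu.-integrable circle (EFin \o f).

Lemma test_continuous X : continuous (X : R -> R).
Proof.
move=> x; apply/differentiable_continuous/derivable1_diffP.
by have := testP X; rewrite inE => -[/(_ 0%N x)].
Qed.

Lemma test_bounded X : [bounded (X : R -> R) x | x in circle].
Proof.
have /compact_bounded[M [_ h]] : compact ((X : R -> R) @` circle).
  apply: continuous_compact; last exact: segment_compact.
  exact/continuous_subspaceT/test_continuous.
by exists M; split; rewrite ?num_real // => r Mr x cx; apply: h => //; exists x.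
Qed.

Lemma measurable_circle : @measurable _ (measurableTypeR R) circle.
Proof. exact: measurable_itv. Qed.

Lemma test_measurable X :
  measurable_fun (circle : set (measurableTypeR R)) (X : R -> R).
Proof.
apply: measurable_funTS; apply: continuous_measurable_fun.
exact: test_continuous.
Qed.

Lemma circle_integrableM f X : circle_integrable f ->
  circle_integrable (fun x => f x * X x).
Proof.
move=> fi; have := integrableMl measurable_circle fi (test_measurable X) (test_bounded X).
by apply: eq_integrable => //; exact: measurable_circle.
Qed.

Lemma ler_Cnorm1 X x : circle x -> `|X x| <= Cnorm 1 X.
Proof.
move=> cx; rewrite /Cnorm big_ord_recl big_ord0 addr0.
apply: ub_le_sup; last by exists x.
have [M [_ h]] := test_bounded X.
exists (`|M| + 1) => _ [y cy <-]; apply: h => //.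
by rewrite ltr_pwDr// ler_norm.
Qed.

Lemma fun_distr_linear f : circle_integrable f -> forall a X Y,
  \int[mu]_(x in circle) (f x * (a *: X + Y : test_function R) x) =
  a * (\int[mu]_(x in circle) (f x * X x)) + \int[mu]_(x in circle) (f x * Y x).
Proof.
move=> fi a X Y; have mc := measurable_circle.
rewrite -RintegralZl//; last exact: circle_integrableM.
rewrite -RintegralD//; last 2 first.
- by apply: (integrableZl mc a (circle_integrableM X fi)).
- exact: circle_integrableM.
by apply: eq_Rintegral => x _; rewrite /= mulrDr mulrCA.
Qed.

Lemma fun_distr_bounded f : circle_integrable f -> exists N C, forall X,
  `|\int[mu]_(x in circle) (f x * X x)| <= C * Cnorm N X.
Proof.
move=> fi; have mc := measurable_circle.
exists 1%N, (\int[mu]_(x in circle) `|f x|) => X.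
have fXi := circle_integrableM X fi.
apply: le_trans (le_normr_Rintegral mc fXi) _.
rewrite -RintegralZr//; last exact: integrable_norm.
apply: le_Rintegral => //.
- exact: integrable_norm fXi.
- have := integrableZr mc (Cnorm 1 X) (integrable_norm fi).
  by apply: eq_integrable.
by move=> x cx; rewrite normrM ler_wpM2l// ler_Cnorm1.
Qed.

Lemma dist0_linear : forall a (X Y : test_function R), 0 = a * 0 + 0 :> R.
Proof. by move=> a _ _; rewrite mulr0 addr0. Qed.

Lemma dist0_bounded : exists N C, forall X, `|0 : R| <= C * Cnorm N X.
Proof. by exists 0%N, 0 => X; rewrite normr0 mul0r. Qed.

Definition dist0 : circle_distr R :=
  @Distribution R (fun=> 0) dist0_linear dist0_bounded.

Lemma circle_distr_eq T T' : (forall X, T X = T' X) -> T = T'.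
Proof.
case: T T' => [T lT bT] [S lS bS] /= /funext TS; subst S.
by congr Distribution; exact: Prop_irrelevance.
Qed.

(* The distribution attached to an L^1 function; junk value 0 otherwise. *)
Definition fun_distr f : circle_distr R :=
  match pselect (circle_integrable f) with
  | left fi => Distribution (fun_distr_linear fi) (fun_distr_bounded fi)
  | right _ => dist0
  end.

End distributions.

HB.instance Definition _ (R : realType) := gen_eqMixin (circle_distr R).
HB.instance Definition _ (R : realType) := gen_choiceMixin (circle_distr R).
HB.instance Definition _ (R : realType) := isPointed.Build (circle_distr R) dist0.

(* The topology of D'(S^1) is that of convergence against each test function. *)
HB.instance Definition _ (R : realType) := Topological.copy (circle_distr R)
  (initial_topology (@pairing R : circle_distr R -> {ptws test_function R -> R})).

Section fractional_laplacian.
Context {R : realType}.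
Implicit Types (T : circle_distr R) (f g : R -> R) (n : int) (s : R).
Local Open Scope complex_scope.

(* T is real, so that <T, e^(-inx)> = <T, cos(nx)> - i <T, sin(nx)>. *)
Definition fourier T n : R[i] :=
  ((pi *+ 2)^-1)%:C * (T (cosn n) +i* - T (sinn n)).

Definition is_fracLap s T T' :=
  forall n, fourier T' n = (`|n|%:~R `^ (2 * s))%:C * fourier T n.

Definition circle_L2 f :=
  measurable_fun (circle : set (measurableTypeR R)) f /\
  circle_integrable (fun x => f x ^+ 2).

Definition has_fracLap s f g :=
  circle_L2 g /\ is_fracLap s (fun_distr f) (fun_distr g).

(* (-Delta)^s f as an element of L^2, hence defined up to a.e. equality;
   junk value 0 when (-Delta)^s f is not in L^2. *)
Definition fracLap s f : R -> R := xget (fun=> 0) [set g | has_fracLap s f g].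

End fractional_laplacian.

Section maps.
Context {R : realType} {k : nat}.
Implicit Types (u v : R -> 'rV[R]_k).
Local Notation mu := (@lebesgue_measure R).

Definition coordf u (i : 'I_k) : R -> R := fun x => u x ord0 i.

Definition dotv (a b : 'rV[R]_k) : R := \sum_i a ord0 i * b ord0 i.

Definition fracLapv (s : R) u : R -> 'rV[R]_k :=
  fun x => \row_i fracLap s (coordf u i) x.

Definition derivv u : R -> 'rV[R]_k := fun x => \row_i derive1 (coordf u i) x.

Definition smooth_map u := forall i, coordf u i \in smooth_circle.

Definition in_H12 u := periodic u (pi *+ 2) /\
  forall i, circle_L2 (coordf u i) /\ exists g, has_fracLap 4^-1 (coordf u i) g.

Definition half_energy u : R :=
  \int[mu]_(x in circle) dotv (fracLapv 4^-1 u x) (fracLapv 4^-1 u x).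

Definition normH12 u : R :=
  Num.sqrt (\int[mu]_(x in circle) dotv (u x) (u x) + half_energy u).

Definition inner_variation_smooth u : circle_distr R :=
  fun_distr (fun x => dotv (fracLapv 2^-1 u x) (derivv u x)).

End maps.

Record H12 (R : realType) (k : nat) := MkH12 {
  H12_val :> R -> 'rV[R]_k ;
  H12P : in_H12 H12_val }.

HB.instance Definition _ (R : realType) k := gen_eqMixin (H12 R k).
HB.instance Definition _ (R : realType) k := gen_choiceMixin (H12 R k).

Definition H12_ball {R : realType} {k} (u : H12 R k) (e : R) : set (H12 R k) :=
  [set v | normH12 (fun x => v x - u x) < e].

HB.instance Definition _ (R : realType) k := hasNbhs.Build (H12 R k)
  (fun u => filter_from [set e : R | 0 < e] (H12_ball u)).

Section inner_variation.
Context {R : realType} {k : nat}.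
Implicit Types (u : H12 R k) (T : circle_distr R) (X : test_function R).

Definition smooth_approx u (un : nat -> H12 R k) :=
  (forall n, smooth_map (un n)) /\ un @ \oo --> u.

Definition is_inner_variation u T :=
  (exists un, smooth_approx u un) /\
  forall un, smooth_approx u un ->
    inner_variation_smooth (un n) @[n --> \oo] --> T.

Definition inner_variation u : circle_distr R :=
  xget dist0 [set T | is_inner_variation u T].

(* phi t is the lift to the line of the flow map phi_t of the circle. *)
Definition is_flow X (phi : R -> R -> R) :=
  (forall x, phi 0 x = x) /\
  forall x t : R, is_derive t (1 : R) (phi ^~ x) (X (phi t x)).

Definition stationary u := forall X phi, is_flow X phi ->
  is_derive (0 : R) (1 : R) (fun t => half_energy (u \o phi t)) 0.

End inner_variation.

(* Main.v *)
(* Write |D| for the half-Laplacian and f for a component of u. The product |D|f f'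
   is -1/2 times the imaginary part of the square of an analytic function, so that its
   pairing q_X(f) with X couples the frequencies n and m of f only through the
   frequency n + m of X: q_X is a quadratic form bounded on L^2, whence the existence
   and the continuity of the inner variation.
     For smooth u, convexity of the energy and a Taylor expansion in time give
   E(u o phi_t) - E(u o phi_s) <= 2 (t - s) q_X(u o phi_t) + O((t - s)^2). Summing
   over a subdivision removes the quadratic error, and what is left involves u only
   through E and q_X; it passes to the limit in H^(1/2) by lower semicontinuity and
   gives the derivative of the energy.
     The flows of cos(nx) and sin(nx) are explicit, so that the inner variation of a
   stationary point vanishes on trigonometric polynomials, which determine it. *)
From HB Require Import structures.
From mathcomp Require Import all_boot all_order all_algebra.
From mathcomp Require Import all_classical all_reals all_analysis.
From mathcomp Require Import measurable_realfun complex ring lra.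
Require Import Defs.
Set Implicit Arguments.
Unset Strict Implicit.
Unset Printing Implicit Defensive.
Import Order.TTheory GRing.Theory Num.Theory.
Import numFieldNormedType.Exports.
Local Open Scope classical_set_scope.
Local Open Scope ring_scope.

(** * Square-integrable functions on the circle *)

(** The energy is visible only through Fourier coefficients of L^2 functions, so Parseval and
    Riesz-Fischer are needed at the outset; completeness of the trigonometric system is drawn from
    indicator functions of half-lines, whose Fourier series converge pointwise away from the jump.
    The obstacle is that composition with phi_t is readily bounded on L^2, uniformly for |t| <= 1,
    but not in energy. The constant in O((t - s)^2) depends on a C^2 norm of u, which is not
    controlled along smooth approximations of an H^(1/2) map; it has to disappear before any limit
    is taken, and only L^2 estimates of q_X may be used afterwards. The form q_X enters because X is
    invariant under its own flow: X(phi_t x) = X(x) d_x phi_t(x), so X (u o phi_t)' = (u' X) o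
    phi_t, which is the time derivative of u o phi_t. A flow is only assumed to solve the
    differential equation in t; that it is monotone, Lipschitz and C^1 in x is derived from that
    equation. *)

Section L2.
Context {R : realType}.
Implicit Types (f g h : R -> R) (a : R).
Local Notation mu := (@lebesgue_measure R).
Local Notation L2 := (@circle_L2 R).

Definition ip f g := \int[mu]_(x in circle) (f x * g x).

Lemma ler_sqr_norm (x a : R) : `|x| <= a -> x ^+ 2 <= a ^+ 2.
Proof.
by move=> xa; rewrite -[leLHS]real_normK ?num_real// !expr2; apply: ler_pM.
Qed.

Lemma circle_measure : mu (circle : set R) = (pi *+ 2)%:E.
Proof.
rewrite /circle lebesgue_measure_itv /= lte_fin.
by rewrite pmulrn_rgt0 ?pi_gt0 // oppr0 adde0.
Qed.

Lemma eq_circle_integrable f g : (forall x, circle x -> f x = g x) ->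
  circle_integrable f -> circle_integrable g.
Proof.
move=> fg; apply: eq_integrable => [|x]; first exact: measurable_circle.
by rewrite inE => /fg /= ->.
Qed.

Lemma circle_integrable_le f g :
  measurable_fun (circle : set (measurableTypeR R)) f ->
  (forall x, circle x -> `|f x| <= g x) -> circle_integrable g ->
  circle_integrable f.
Proof.
move=> mf fg; apply: le_integrable; first exact: measurable_circle.
  exact/measurable_EFinP.
move=> x cx /=; rewrite lee_fin (le_trans (fg _ cx))// ler_norm//.
Qed.

Lemma circle_integrable_cst a : circle_integrable (fun=> a).
Proof.
have m := @measurable_circle R; apply/integrableP; split; first exact/measurable_EFinP.
rewrite (eq_integral (cst `|a|%:E)) => [|x _ //].
by rewrite integral_cst//= circle_measure -EFinM ltry.
Qed.

Lemma circle_integrableD f g : circle_integrable f -> circle_integrable g ->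
  circle_integrable (f + g).
Proof. by move=> fi gi; have := integrableD measurable_circle fi gi. Qed.

Lemma circle_integrableZ a f : circle_integrable f -> circle_integrable (a *: f).
Proof. by move=> fi; have := integrableZl measurable_circle a fi. Qed.

Lemma L2_measurable f : L2 f -> measurable_fun (circle : set (measurableTypeR R)) f.
Proof. by case. Qed.

Lemma L2_mul f g : L2 f -> L2 g -> circle_integrable (fun x => f x * g x).
Proof.
move=> [mf fi] [mg gi].
apply: (@circle_integrable_le _ ((fun x => f x ^+ 2) + (fun x => g x ^+ 2))).
- exact: measurable_funM.
- move=> x _; rewrite !fctE normrM -(real_normK (num_real (f x))) -(real_normK (num_real (g x))).
  by have := sqr_ge0 (`|f x| - `|g x|); nra.
- exact: circle_integrableD.
Qed.

Lemma L2D f g : L2 f -> L2 g -> L2 (f + g).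
Proof.
move=> Lf Lg; split; first by apply: measurable_funD; apply: L2_measurable.
have := circle_integrableD (circle_integrableD Lf.2 Lg.2) (circle_integrableZ 2 (L2_mul Lf Lg)).
apply: eq_circle_integrable => x _; rewrite !fctE /GRing.scale /=; ring.
Qed.

Lemma L2Z a f : L2 f -> L2 (a *: f).
Proof.
move=> Lf; split; first by apply: measurable_funM => //; apply: L2_measurable.
have := circle_integrableZ (a ^+ 2) Lf.2.
by apply: eq_circle_integrable => x _; rewrite !fctE /GRing.scale /=; ring.
Qed.

Lemma L2N f : L2 f -> L2 (- f).
Proof. by rewrite -scaleN1r; exact: L2Z. Qed.

Lemma L2B f g : L2 f -> L2 g -> L2 (f - g).
Proof. by move=> Lf Lg; apply/L2D/L2N. Qed.

Lemma L2_bounded f a : measurable_fun (circle : set (measurableTypeR R)) f ->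
  (forall x, circle x -> `|f x| <= a) -> L2 f.
Proof.
move=> mf fa; split=> //.
apply: (@circle_integrable_le _ (fun=> a ^+ 2)); last exact: circle_integrable_cst.
  exact: measurable_funX.
by move=> x /fa; rewrite normrX; have := normr_ge0 (f x); nra.
Qed.

Lemma L2_mulb f g a : L2 f -> measurable_fun (circle : set (measurableTypeR R)) g ->
  (forall x, circle x -> `|g x| <= a) -> L2 (fun x => f x * g x).
Proof.
move=> [mf fi] mg ga; split; first exact: measurable_funM.
apply: (@circle_integrable_le _ (a ^+ 2 *: fun x => f x ^+ 2)); last exact: circle_integrableZ.
  by apply: measurable_funX; exact: measurable_funM.
move=> x /ga /ler_sqr_norm gax; rewrite !fctE /GRing.scale /= normrX normrM exprMn mulrC.
by rewrite !real_normK ?num_real// ler_wpM2r ?sqr_ge0.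
Qed.

Lemma L2_cst a : L2 (fun=> a).
Proof. by apply: (@L2_bounded _ `|a|) => // x _. Qed.

Lemma L2_0 : L2 0. Proof. exact: (@L2_cst 0). Qed.

Lemma L2_sum (I : Type) (r : seq I) (P : pred I) (F : I -> R -> R) :
  (forall i, L2 (F i)) -> L2 (\sum_(i <- r | P i) F i).
Proof. by move=> LF; elim/big_ind : _ => //; [exact: L2_0|exact: L2D]. Qed.

Lemma continuous_L2 f : continuous f -> L2 f.
Proof.
move=> cf.
have /compact_bounded[M [_ h]] : compact (f @` (circle : set R)).
  apply: continuous_compact; last exact: segment_compact.
  exact: continuous_subspaceT.
apply: (@L2_bounded _ (`|M| + 1)).
  by apply: measurable_funTS; exact: continuous_measurable_fun.
by move=> x cx; apply: h; [rewrite ltr_pwDr// ler_norm|exists x].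
Qed.

Lemma L2_integrable f : L2 f -> circle_integrable f.
Proof.
move=> Lf; have := L2_mul Lf (L2_cst 1).
by apply: eq_circle_integrable => x _; rewrite mulr1.
Qed.

Lemma ipC f g : ip f g = ip g f.
Proof. by apply: eq_Rintegral => x _; rewrite mulrC. Qed.

Lemma eq_ip f f' g g' : (forall x, circle x -> f x = f' x) ->
  (forall x, circle x -> g x = g' x) -> ip f g = ip f' g'.
Proof.
by move=> ff' gg'; apply: eq_Rintegral => x; rewrite inE => cx; rewrite ff' ?gg'.
Qed.

Lemma ipDl f g h : L2 f -> L2 g -> L2 h -> ip (f + g) h = ip f h + ip g h.
Proof.
move=> Lf Lg Lh; rewrite /ip -RintegralD; last 3 first.
- exact: measurable_circle.
- exact: L2_mul.
- exact: L2_mul.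
by apply: eq_Rintegral => x _; rewrite !fctE mulrDl.
Qed.

Lemma ipZl a f h : L2 f -> L2 h -> ip (a *: f) h = a * ip f h.
Proof.
move=> Lf Lh; rewrite /ip -RintegralZl; [|exact: measurable_circle|exact: L2_mul].
by apply: eq_Rintegral => x _; rewrite !fctE /GRing.scale /= mulrA.
Qed.

Lemma ipDr f g h : L2 f -> L2 g -> L2 h -> ip h (f + g) = ip h f + ip h g.
Proof. by move=> *; rewrite ipC ipDl// ipC [ip g h]ipC. Qed.

Lemma ipZr a f h : L2 f -> L2 h -> ip h (a *: f) = a * ip h f.
Proof. by move=> *; rewrite ipC ipZl// ipC. Qed.

Lemma ipNl f h : L2 f -> L2 h -> ip (- f) h = - ip f h.
Proof. by move=> *; rewrite -scaleN1r ipZl// mulN1r. Qed.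

Lemma ipBl f g h : L2 f -> L2 g -> L2 h -> ip (f - g) h = ip f h - ip g h.
Proof. by move=> *; rewrite ipDl ?ipNl//; exact: L2N. Qed.

Lemma ipBr f g h : L2 f -> L2 g -> L2 h -> ip h (f - g) = ip h f - ip h g.
Proof. by move=> *; rewrite ipC ipBl// ipC [ip g h]ipC. Qed.

Lemma ip0l f : ip 0 f = 0.
Proof.
by rewrite /ip (@eq_Rintegral _ _ _ _ _ (cst 0)) ?Rintegral_cst ?mul0r//;
  [exact: measurable_circle|move=> x _; rewrite !fctE mul0r].
Qed.

Lemma ip_suml (I : Type) (r : seq I) (P : pred I) (F : I -> R -> R) g :
  (forall i, L2 (F i)) -> L2 g ->
  ip (\sum_(i <- r | P i) F i) g = \sum_(i <- r | P i) ip (F i) g.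
Proof.
move=> LF Lg; elim: r => [|i r IH]; first by rewrite !big_nil ip0l.
rewrite !big_cons; case: ifP => // _; rewrite ipDl ?IH//; exact: L2_sum.
Qed.

Lemma ip_ge0 f : 0 <= ip f f.
Proof. by apply: Rintegral_ge0 => x _; rewrite -expr2 sqr_ge0. Qed.

Lemma ip_sqrD f g : L2 f -> L2 g -> ip (f + g) (f + g) = ip f f + 2 * ip f g + ip g g.
Proof.
move=> Lf Lg; have Lfg := L2D Lf Lg.
by rewrite ipDl// ipDr// ipDr// [ip g f]ipC; ring.
Qed.

Lemma ip_sqrB f g : L2 f -> L2 g -> ip (f - g) (f - g) = ip f f - 2 * ip f g + ip g g.
Proof.
move=> Lf Lg; have LN := L2N Lg.
by rewrite ip_sqrD// ipC ipNl// ipNl// [ip g (- g)]ipC ipNl// [ip g f]ipC; ring.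
Qed.

Definition nrm f := Num.sqrt (ip f f).

Lemma nrm_ge0 f : 0 <= nrm f. Proof. exact: sqrtr_ge0. Qed.

Lemma sqr_nrm f : nrm f ^+ 2 = ip f f.
Proof. by rewrite sqr_sqrtr ?ip_ge0. Qed.

(** Positivity of the square of <g,g> f - <f,g> g. When <g,g> = 0, the squares of f + t g form an
    affine function of t that is bounded below, so its slope vanishes. *)
Lemma ip_sqr_le f g : L2 f -> L2 g -> ip f g ^+ 2 <= ip f f * ip g g.
Proof.
move=> Lf Lg; have [g0|g0] := eqVneq (ip g g) 0.
  have H t : 0 <= ip f f + 2 * t * ip f g.
    have := ip_ge0 (f + t *: g); rewrite ip_sqrD//; last exact: L2Z.
    by rewrite ipZr// ipZl// ?ipZr ?g0//; [lra|exact: L2Z].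
  rewrite g0 mulr0; have [->|fg0] := eqVneq (ip f g) 0; first by rewrite expr0n.
  (* The value of t at which the affine function equals -1. *)
  have := H (- (ip f f + 1) / (2 * ip f g)).
  have -> : ip f f + 2 * (- (ip f f + 1) / (2 * ip f g)) * ip f g = -1 by field.
  by rewrite oppr_ge0 ler10.
have gp : 0 < ip g g by rewrite lt_def g0 ip_ge0.
have := ip_ge0 (ip g g *: f - ip f g *: g).
have L1 := L2Z (ip g g) Lf; have L3 := L2Z (ip f g) Lg.
rewrite ip_sqrB// !ipZl// !ipZr//.
rewrite (_ : _ + _ = ip g g * (ip f f * ip g g - ip f g ^+ 2)); last by ring.
by rewrite pmulr_rge0// subr_ge0.
Qed.

Lemma ip_le f g : L2 f -> L2 g -> `|ip f g| <= nrm f * nrm g.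
Proof.
move=> Lf Lg; rewrite -ler_sqr ?nnegrE ?mulr_ge0 ?nrm_ge0//.
by rewrite exprMn !sqr_nrm real_normK ?num_real// ip_sqr_le.
Qed.

Lemma nrmD f g : L2 f -> L2 g -> nrm (f + g) <= nrm f + nrm g.
Proof.
move=> Lf Lg; rewrite -ler_sqr ?nnegrE ?addr_ge0 ?nrm_ge0//.
rewrite sqr_nrm ip_sqrD// sqrrD !sqr_nrm; have := ip_le Lf Lg; rewrite ler_norml.
by move=> /andP[_]; lra.
Qed.

Lemma nrmZ a f : L2 f -> nrm (a *: f) = `|a| * nrm f.
Proof.
move=> Lf; have LZ := L2Z a Lf.
by rewrite /nrm ipZl// ipZr// mulrA -expr2 sqrtrM ?sqr_ge0// sqrtr_sqr.
Qed.

Lemma nrmN f : L2 f -> nrm (- f) = nrm f.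
Proof. by move=> Lf; rewrite -scaleN1r nrmZ// normrN1 mul1r. Qed.

Lemma nrmB f g : L2 f -> L2 g -> nrm (f - g) <= nrm f + nrm g.
Proof. by move=> Lf Lg; rewrite -(nrmN Lg); apply/nrmD/L2N. Qed.

Lemma ip_le_bound f a : L2 f -> 0 <= a -> (forall x, circle x -> `|f x| <= a) ->
  ip f f <= a ^+ 2 * (pi *+ 2).
Proof.
move=> Lf a0 fa; have -> : a ^+ 2 * (pi *+ 2) = ip (fun=> a) (fun=> a).
  rewrite /ip Rintegral_cst; last exact: measurable_circle.
  by rewrite /= circle_measure.
apply: le_Rintegral; [exact: measurable_circle|exact: L2_mul|exact/L2_mul/L2_cst/L2_cst|].
by move=> x /fa; rewrite -!expr2; exact: ler_sqr_norm.
Qed.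

Lemma nrm_le_bound f a : L2 f -> 0 <= a -> (forall x, circle x -> `|f x| <= a) ->
  nrm f <= a * Num.sqrt (pi *+ 2).
Proof.
move=> Lf a0 fa; rewrite -ler_sqr ?nnegrE ?mulr_ge0 ?sqrtr_ge0 ?nrm_ge0//.
rewrite sqr_nrm exprMn sqr_sqrtr ?ip_le_bound//.
by rewrite mulrn_wge0// pi_ge0.
Qed.

Lemma nrm_mulb f g a : L2 f -> measurable_fun (circle : set (measurableTypeR R)) g ->
  0 <= a -> (forall x, circle x -> `|g x| <= a) -> nrm (fun x => f x * g x) <= a * nrm f.
Proof.
move=> Lf mg a0 ga; have Lfg := L2_mulb Lf mg ga.
rewrite -ler_sqr ?nnegrE ?mulr_ge0 ?nrm_ge0// exprMn !sqr_nrm -[_ * ip f f]ipZl// .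
apply: le_Rintegral; [exact: measurable_circle|exact: L2_mul|exact/L2_mul/Lf/L2Z|].
move=> x /ga /ler_sqr_norm gx; rewrite !fctE /GRing.scale /=.
rewrite (_ : f x * g x * (f x * g x) = g x ^+ 2 * (f x * f x)); last by ring.
by rewrite -[leRHS]mulrA -expr2 ler_wpM2r// sqr_ge0.
Qed.

End L2.

(** * Fourier series *)

Section trig.
Context {R : realType}.
Implicit Types (f g h : R -> R) (a : R) (n m N : nat).
Local Notation mu := (@lebesgue_measure R).
Local Notation L2 := (@circle_L2 R).

Lemma twopi_gt0 : 0 < pi *+ 2 :> R.
Proof. by rewrite mulrn_wgt0// pi_gt0. Qed.

Lemma is_derive_continuous f (f' : R -> R) :
  (forall x, is_derive x (1 : R) f (f' x)) -> continuous f.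
Proof. by move=> df x; apply/differentiable_continuous/derivable1_diffP; have [] := df x. Qed.

Lemma continuous_derivable_oo f (f' : R -> R) a b :
  (forall x, is_derive x (1 : R) f (f' x)) -> derivable_oo_LRcontinuous f a b.
Proof.
move=> df; have cf := is_derive_continuous df; split.
- by move=> x _; have [] := df x.
- exact/cvg_at_right_filter/cf.
- exact/cvg_at_left_filter/cf.
Qed.

Lemma circle_FTC F f : (forall x, is_derive x (1 : R) F (f x)) -> continuous f ->
  \int[mu]_(x in circle) f x = F (pi *+ 2) - F 0.
Proof.
move=> dF cf; rewrite /Rintegral (@continuous_FTC2 _ f F)//.
- exact: twopi_gt0.
- exact: continuous_subspaceT.
- exact: continuous_derivable_oo dF.
- by move=> x _; rewrite derive1E; have [] := dF x.
Qed.

Lemma circle_by_parts F f G g :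
  (forall x, is_derive x (1 : R) F (f x)) -> continuous f -> periodic F (pi *+ 2) ->
  (forall x, is_derive x (1 : R) G (g x)) -> continuous g -> periodic G (pi *+ 2) ->
  ip F g = - ip f G.
Proof.
move=> dF cf pF dG cg pG.
rewrite /ip (@Rintegration_by_parts _ F G f g)//.
- by have := pF 0; have := pG 0; rewrite add0r => -> ->; rewrite subrr sub0r.
- exact: twopi_gt0.
- exact: continuous_subspaceT.
- exact: continuous_derivable_oo dF.
- by move=> x _; rewrite derive1E; have [] := dF x.
- exact: continuous_subspaceT.
- exact: continuous_derivable_oo dG.
- by move=> x _; rewrite derive1E; have [] := dG x.
Qed.

Lemma is_derive_mull a (x : R) : is_derive x (1 : R) (fun y => a * y) a.
Proof.
have := is_deriveZ a (is_derive_id x (1 : R)).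
by rewrite /GRing.scale /= mulr1.
Qed.

Lemma is_derive_cosM a (x : R) : is_derive x (1 : R) (fun y => cos (a * y)) (- (a * sin (a * x))).
Proof.
have := is_derive1_comp (is_derive_cos (a * x)) (is_derive_mull a x).
by move/is_derive_eq; apply; rewrite mulrC mulrN.
Qed.

Lemma is_derive_sinM a (x : R) : is_derive x (1 : R) (fun y => sin (a * y)) (a * cos (a * x)).
Proof.
have := is_derive1_comp (is_derive_sin (a * x)) (is_derive_mull a x).
by move/is_derive_eq; apply; rewrite mulrC.
Qed.

Lemma continuous_cosM a : continuous (fun y : R => cos (a * y)).
Proof. exact: is_derive_continuous (is_derive_cosM a). Qed.

Lemma continuous_sinM a : continuous (fun y : R => sin (a * y)).
Proof. exact: is_derive_continuous (is_derive_sinM a). Qed.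

Lemma circle_int_cos (z : int) :
  \int[mu]_(x in circle) cos (z%:~R * x) = (z == 0)%:R * (pi *+ 2).
Proof.
have [->|z0] := eqVneq z 0.
  rewrite (@eq_Rintegral _ _ _ _ _ (cst 1)); last by move=> x _; rewrite mul0r cos0.
  by rewrite (Rintegral_cst _ measurable_circle) /= mul1r circle_measure mul1r.
have zR : z%:~R != 0 :> R by rewrite intr_eq0.
have D (x : R) : is_derive x (1 : R) (z%:~R^-1 *: fun x => sin (z%:~R * x)) (cos (z%:~R * x)).
  apply: is_derive_eq (is_deriveZ _ (is_derive_sinM _ _)) _.
  by rewrite /GRing.scale /= mulKf.
rewrite (circle_FTC D (@continuous_cosM z%:~R)).
have := sinn_smooth_circle (R := R) z; rewrite inE => -[_ per].
by have := per 0; rewrite add0r !fctE => ->; rewrite subrr mul0r.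
Qed.

Lemma circle_int_sin (z : int) : \int[mu]_(x in circle) sin (z%:~R * x) = 0.
Proof.
have [->|z0] := eqVneq z 0.
  rewrite (@eq_Rintegral _ _ _ _ _ (cst 0)); last by move=> x _; rewrite mul0r sin0.
  by rewrite (Rintegral_cst _ measurable_circle) mul0r.
have zR : z%:~R != 0 :> R by rewrite intr_eq0.
have D (x : R) : is_derive x (1 : R) ((- z%:~R^-1) *: fun x => cos (z%:~R * x)) (sin (z%:~R * x)).
  apply: is_derive_eq (is_deriveZ _ (is_derive_cosM _ _)) _.
  by rewrite /GRing.scale /= mulrNN mulKf.
rewrite (circle_FTC D (@continuous_sinM z%:~R)).
have := cosn_smooth_circle (R := R) z; rewrite inE => -[_ per].
by have := per 0; rewrite add0r !fctE => ->; rewrite subrr.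
Qed.

Definition cs n (x : R) := cos (n%:R * x).
Definition sn n (x : R) := sin (n%:R * x).
(* Weight of the n-th harmonic: 2pi is the square of the L^2 norm of the
   constant 1, and pi that of every other cosine or sine. *)
Definition kap n : R := if n == 0%N then (pi *+ 2)^-1 else pi^-1.

Lemma kap_gt0 n : 0 < kap n.
Proof. by rewrite /kap; case: ifP => _; rewrite invr_gt0 ?twopi_gt0// pi_gt0. Qed.

Lemma kap_ge0 n : 0 <= kap n. Proof. exact/ltW/kap_gt0. Qed.

Lemma L2_cs n : L2 (cs n). Proof. exact/continuous_L2/continuous_cosM. Qed.

Lemma L2_sn n : L2 (sn n). Proof. exact/continuous_L2/continuous_sinM. Qed.

Lemma cs_le1 n x : `|cs n x| <= 1.
Proof. by rewrite ler_norml cos_geN1 cos_le1. Qed.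

Lemma sn_le1 n x : `|sn n x| <= 1.
Proof. by rewrite ler_norml sin_geN1 sin_le1. Qed.

Lemma sn0 : sn 0 = 0 :> (R -> R).
Proof. by apply/funext => x; rewrite /sn mul0r sin0. Qed.

Lemma cs0 : cs 0 = (fun=> 1) :> (R -> R).
Proof. by apply/funext => x; rewrite /cs mul0r cos0. Qed.

Let cos_int (z : int) : circle_integrable (fun x : R => cos (z%:~R * x)).
Proof. exact/L2_integrable/continuous_L2/continuous_cosM. Qed.
Let sin_int (z : int) : circle_integrable (fun x : R => sin (z%:~R * x)).
Proof. exact/L2_integrable/continuous_L2/continuous_sinM. Qed.

Lemma circle_int_lin2 a b f g : circle_integrable f -> circle_integrable g ->
  \int[mu]_(x in circle) (a * f x + b * g x) =
  a * (\int[mu]_(x in circle) f x) + b * (\int[mu]_(x in circle) g x).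
Proof.
move=> fi gi; rewrite RintegralD ?RintegralZl//;
  by [exact: measurable_circle|exact: circle_integrableZ].
Qed.

Lemma ip_cs_cs n m : kap n * ip (cs n) (cs m) = (n == m)%:R.
Proof.
have -> : ip (cs n) (cs m) = 2^-1 * (\int[mu]_(x in circle) cos ((n%:Z - m%:Z)%:~R * x)) +
    2^-1 * (\int[mu]_(x in circle) cos ((n%:Z + m%:Z)%:~R * x)).
  rewrite -circle_int_lin2//; apply: eq_Rintegral => x _.
  rewrite /cs rmorphB rmorphD /= mulrBl mulrDl cosB cosD; by field.
rewrite !circle_int_cos subr_eq0 eqz_nat /kap.
have p0 := @lt0r_neq0 _ _ (@pi_gt0 R).
case: n m => [|n] [|m]/=; rewrite ?mulr0n ?mul0r ?mulr0 ?addr0 ?mulr0//=.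
  by rewrite -[pi *+ 2]mulr_natl !mul1r; move: pi p0 => p p0; field.
rewrite -[pi *+ 2]mulr_natl; case: eqP => _; rewrite ?mulr0n ?mul0r ?mulr0 ?addr0//=.
by rewrite mulr1n mul1r; move: pi p0 => p p0; field.
Qed.

Lemma ip_sn_sn n m : kap n * ip (sn n) (sn m) = ((n == m) && (0 < n)%N)%:R.
Proof.
have -> : ip (sn n) (sn m) = 2^-1 * (\int[mu]_(x in circle) cos ((n%:Z - m%:Z)%:~R * x)) +
    (- 2^-1) * (\int[mu]_(x in circle) cos ((n%:Z + m%:Z)%:~R * x)).
  rewrite -circle_int_lin2//; apply: eq_Rintegral => x _.
  rewrite /sn rmorphB rmorphD /= mulrBl mulrDl cosB cosD; by field.
rewrite !circle_int_cos subr_eq0 eqz_nat /kap.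
have p0 := @lt0r_neq0 _ _ (@pi_gt0 R).
case: n m => [|n] [|m]/=; rewrite ?mulr0n ?mul0r ?mulr0 ?addr0 ?mulr0//=.
  by rewrite !mul1r mulNr subrr mulr0.
rewrite -[pi *+ 2]mulr_natl ltn0Sn andbT; case: eqP => _; rewrite ?mulr0n ?mul0r ?mulr0 ?addr0//=.
by rewrite mulr1n mul1r; move: pi p0 => p p0; field.
Qed.

Lemma ip_cs_sn n m : ip (cs n) (sn m) = 0.
Proof.
have -> : ip (cs n) (sn m) = 2^-1 * (\int[mu]_(x in circle) sin ((n%:Z + m%:Z)%:~R * x)) +
    (- 2^-1) * (\int[mu]_(x in circle) sin ((n%:Z - m%:Z)%:~R * x)).
  rewrite -circle_int_lin2//; apply: eq_Rintegral => x _.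
  rewrite /sn /cs rmorphB rmorphD /= mulrBl mulrDl sinB sinD; by field.
by rewrite !circle_int_sin !mulr0 addr0.
Qed.

Definition cf f n := ip f (cs n).
Definition sf f n := ip f (sn n).

Lemma cfD f g n : L2 f -> L2 g -> cf (f + g) n = cf f n + cf g n.
Proof. by move=> *; apply: ipDl => //; exact: L2_cs. Qed.
Lemma sfD f g n : L2 f -> L2 g -> sf (f + g) n = sf f n + sf g n.
Proof. by move=> *; apply: ipDl => //; exact: L2_sn. Qed.
Lemma cfZ a f n : L2 f -> cf (a *: f) n = a * cf f n.
Proof. by move=> *; apply: ipZl => //; exact: L2_cs. Qed.
Lemma sfZ a f n : L2 f -> sf (a *: f) n = a * sf f n.
Proof. by move=> *; apply: ipZl => //; exact: L2_sn. Qed.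
Lemma cfB f g n : L2 f -> L2 g -> cf (f - g) n = cf f n - cf g n.
Proof. by move=> *; apply: ipBl => //; exact: L2_cs. Qed.
Lemma sfB f g n : L2 f -> L2 g -> sf (f - g) n = sf f n - sf g n.
Proof. by move=> *; apply: ipBl => //; exact: L2_sn. Qed.

Lemma sf0 f : sf f 0 = 0.
Proof. by rewrite /sf sn0 ipC ip0l. Qed.

(** The weights [kap] are built in so that, below order [N], the sequences [p] and [q] are the
    coefficients [cf] and [sf] of the polynomial, except that [sf] of order 0 is always 0. *)
Definition trig_poly (p q : nat -> R) N : R -> R :=
  \sum_(n < N) kap n *: (p n *: cs n + q n *: sn n).

Lemma L2_trig_poly p q N : L2 (trig_poly p q N).
Proof. by apply: L2_sum => i; apply/L2Z/L2D; apply: L2Z; [exact: L2_cs|exact: L2_sn]. Qed.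

Lemma trig_polyE p q N x : trig_poly p q N x =
  \sum_(n < N) kap n * (p n * cs n x + q n * sn n x).
Proof. by rewrite /trig_poly fct_sumE; apply: eq_bigr. Qed.

Lemma ip_trig_poly p q N f : L2 f ->
  ip (trig_poly p q N) f = \sum_(n < N) kap n * (p n * cf f n + q n * sf f n).
Proof.
move=> Lf; have Lc n := L2_cs n; have Ls n := L2_sn n.
rewrite /trig_poly ip_suml//; last by move=> i; apply/L2Z/L2D; apply: L2Z.
apply: eq_bigr => n _; rewrite ipZl//; last by apply: L2D; apply: L2Z.
by rewrite ipDl//; [rewrite !ipZl// /cf /sf ![ip f _]ipC|exact: L2Z|exact: L2Z].
Qed.

Lemma cf_trig_poly p q N n : cf (trig_poly p q N) n = (n < N)%:R * p n.
Proof.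
rewrite /cf ip_trig_poly; last exact: L2_cs.
under eq_bigr do rewrite /cf /sf ip_cs_sn mulr0 addr0 mulrCA ipC ip_cs_cs.
case: ltnP => nN; last first.
  rewrite big1 ?mul0r// => i _; case: eqP => [ni|_]; last by rewrite mulr0.
  by move: nN; rewrite -ni leqNgt ltn_ord.
rewrite (bigD1 (Ordinal nN))//= eqxx mulr1 big1 ?addr0 ?mul1r// => i.
by rewrite -val_eqE /= => /negbTE ->; rewrite mulr0.
Qed.

Lemma sf_trig_poly p q N n : sf (trig_poly p q N) n = ((n < N) && (0 < n))%N%:R * q n.
Proof.
rewrite /sf ip_trig_poly; last exact: L2_sn.
under eq_bigr do rewrite /cf /sf ipC ip_cs_sn mulr0 add0r mulrCA ipC ip_sn_sn.
case: ltnP => nN; last first.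
  rewrite big1 ?mul0r// => i _; case: eqP => [ni|_]; last by rewrite mulr0.
  by move: nN; rewrite -ni leqNgt ltn_ord.
rewrite (bigD1 (Ordinal nN))//= eqxx /= big1 ?addr0 1?mulrC// => i.
by rewrite -val_eqE /= => /negbTE ->; rewrite mulr0.
Qed.

Definition S f N := trig_poly (cf f) (sf f) N.

Lemma L2_S f N : L2 (S f N). Proof. exact: L2_trig_poly. Qed.

Lemma cf_S f N n : cf (S f N) n = (n < N)%:R * cf f n.
Proof. exact: cf_trig_poly. Qed.

Lemma sf_S f N n : sf (S f N) n = (n < N)%:R * sf f n.
Proof.
by rewrite sf_trig_poly; case: n => [|n]; rewrite ?andbT// sf0 !mulr0.
Qed.

(** Partial sum of the Parseval series of [ip f g]. *)
Definition pars N f g := \sum_(n < N) kap n * (cf f n * cf g n + sf f n * sf g n).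

Lemma ip_S f g N : L2 g -> ip (S f N) g = pars N f g.
Proof. exact: ip_trig_poly. Qed.

Lemma parsC N f g : pars N f g = pars N g f.
Proof. by apply: eq_bigr => n _; rewrite mulrC [sf f n * _]mulrC [cf f n * _]mulrC mulrC. Qed.

Lemma pars_S f g N M : (N <= M)%N -> pars M (S f N) g = pars N f g.
Proof.
move=> NM; rewrite /pars -(subnKC NM) big_split_ord /= [X in _ + X]big1 ?addr0.
  by apply: eq_bigr => n _; rewrite cf_S sf_S ltn_ord !mul1r.
by move=> n _; rewrite cf_S sf_S ltnNge leq_addr !mul0r addr0 mulr0.
Qed.

Lemma bessel_eq f N : L2 f -> ip (f - S f N) (f - S f N) = ip f f - pars N f f.
Proof.
move=> Lf; have LS := L2_S f N; rewrite ip_sqrB//.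
rewrite [ip (S f N) (S f N)]ip_S// [ip f (S f N)]ipC ip_S// [pars N f (S f N)]parsC pars_S//; ring.
Qed.

Lemma bessel f N : L2 f -> pars N f f <= ip f f.
Proof. by move=> Lf; rewrite -subr_ge0 -bessel_eq// ip_ge0. Qed.

Lemma pars_term_ge0 f n : 0 <= kap n * (cf f n * cf f n + sf f n * sf f n).
Proof. by rewrite mulr_ge0 ?kap_ge0// -!expr2 addr_ge0 ?sqr_ge0. Qed.

Lemma pars_nondecreasing f : nondecreasing_seq (fun N => pars N f f).
Proof.
apply/nondecreasing_seqP => N; rewrite /pars big_ord_recr /= lerDl.
exact: pars_term_ge0.
Qed.

End trig.

(** * Fatou's lemma in L^2, the Riemann-Lebesgue lemma and the Dirichlet kernel *)

Section parseval.
Context {R : realType}.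
Implicit Types (f g h : R -> R) (a : R) (n m N : nat).
Local Notation mu := (@lebesgue_measure R).
Local Notation L2 := (@circle_L2 R).

Lemma ip_EFin f : L2 f -> (\int[mu]_(x in circle) (f x ^+ 2)%:E = (ip f f)%:E)%E.
Proof.
move=> Lf; rewrite /ip /Rintegral fineK.
  by apply: eq_integral => x _; rewrite expr2.
exact: (integrable_fin_num measurable_circle (L2_mul Lf Lf)).
Qed.

(** Fatou's lemma for the squares. It is used to turn almost everywhere convergence into L^2
    estimates, giving membership and norm bound at once. *)
Lemma fatou_L2 (F : nat -> R -> R) f (c : R) : (forall n, L2 (F n)) ->
  measurable_fun (circle : set (measurableTypeR R)) f ->
  {ae mu, forall x, circle x -> F ^~ x @ \oo --> f x} ->
  (forall n, ip (F n) (F n) <= c) -> L2 f /\ ip f f <= c.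
Proof.
move=> LF mf Ff Fc; have mc := @measurable_circle R.
have mF n : measurable_fun circle (fun x => (F n x ^+ 2)%:E).
  by apply/measurable_EFinP/measurable_funX; have [] := LF n.
have mf2 : measurable_fun circle (fun x => (f x ^+ 2)%:E).
  by apply/measurable_EFinP/measurable_funX.
have H : (\int[mu]_(x in circle) (f x ^+ 2)%:E <= c%:E)%E.
  have -> : (\int[mu]_(x in circle) (f x ^+ 2)%:E =
      \int[mu]_(x in circle) limn_einf (fun n => (F n x ^+ 2)%:E))%E.
    apply: ae_eq_integral => //.
      rewrite /limn_einf; apply: measurableT_comp => //.
      apply: measurable_fun_limn_esup => n.
      by apply: (measurableT_comp (@oppe_measurable R setT)); exact: mF.
    move: Ff; apply: filterS; first exact: (ae_filter_ringOfSetsType mu).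
    move=> x Fx cx.
    have /cvg_limn_einf_sup[-> _] // : (fun n => (F n x ^+ 2)%:E) @ \oo --> (f x ^+ 2)%:E.
    apply: cvg_EFin; first by near=> n.
    by rewrite /comp /=; under eq_fun do rewrite expr2; apply: cvgM; exact: Fx.
  have F0 (n : nat) (x : R) : circle x -> (0 <= (F n x ^+ 2)%:E)%E.
    by rewrite lee_fin sqr_ge0.
  apply: le_trans (fatou mu mc mF F0) _.
  rewrite limn_einf_lim; apply: lime_le; first exact: is_cvg_einfs.
  near=> n; apply: (@le_trans _ _ (\int[mu]_(x in circle) (F n x ^+ 2)%:E)%E).
    by apply: ereal_inf_lbound; exists n => /=.
  by rewrite ip_EFin// lee_fin.
have fi : circle_integrable (fun x => f x ^+ 2).
  apply/integrableP; split => //.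
  apply: le_lt_trans (ltry c); apply: le_trans H; rewrite le_eqVlt; apply/orP; left.
  by apply/eqP/eq_integral => x _; rewrite /= ger0_norm// sqr_ge0.
have Lf : L2 f by split.
by split=> //; rewrite -lee_fin -ip_EFin.
Unshelve. all: end_near. Qed.

Lemma cvg0_le (u v : nat -> R) : (forall n, `|u n| <= v n) ->
  v @ \oo --> 0 -> u @ \oo --> 0.
Proof.
move=> uv /cvgrPdist_lt v0; apply/cvgrPdist_lt => e /v0; apply: filterS => n.
rewrite !sub0r !normrN; apply: le_lt_trans; apply: le_trans (uv n) _.
exact: ler_norm.
Qed.

Lemma pars_cvg f : L2 f -> cvgn (fun N => pars N f f).
Proof.
move=> Lf; apply: nondecreasing_is_cvgn; first exact: pars_nondecreasing.
by exists (ip f f) => _ [N _ <-]; exact: bessel.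
Qed.

(** By Bessel's inequality the weighted squares of the coefficients form a convergent series, and
    the weights are bounded below by 1 / (2 pi). *)
Lemma riemann_lebesgue h : L2 h -> cf h n @[n --> \oo] --> 0 /\ sf h n @[n --> \oo] --> 0.
Proof.
move=> Lh.
have K0 : (fun n => kap n * (cf h n * cf h n + sf h n * sf h n)) @ \oo --> (0 : R).
  apply: cvg_series_cvg_0.
  have -> : series (fun n => kap n * (cf h n * cf h n + sf h n * sf h n)) =
     (fun N => pars N h h) by apply/funext => N; rewrite /series /= big_mkord.
  exact: pars_cvg.
have K1 : (fun n => cf h n ^+ 2 + sf h n ^+ 2) @ \oo --> (0 : R).
  have K1 : (fun n => 2 * pi * (kap n * (cf h n * cf h n + sf h n * sf h n)))
      @ \oo --> (0 : R).
    by rewrite -[0](mulr0 (2 * pi)); apply: cvgM => //; exact: cvg_cst.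
  apply: (cvg0_le _ K1) => n.
  rewrite ger0_norm ?addr_ge0 ?sqr_ge0//= -!expr2 mulrA ler_peMl ?addr_ge0 ?sqr_ge0//.
  have pi0 := @pi_gt0 R; rewrite /kap; case: ifP => _; rewrite ler_pdivlMr ?twopi_gt0// mul1r.
    by rewrite mulr_natl.
  by lra.
split; apply/cvgrPdist_lt => e e0; move/cvgrPdist_lt: K1 => /(_ (e ^+ 2)).
- rewrite exprn_gt0// => /(_ isT); apply: filterS => n; rewrite !sub0r !normrN => H.
  rewrite -ltr_sqr ?nnegrE ?(ltW e0)// real_normK ?num_real//; apply: le_lt_trans H.
  by rewrite ger0_norm ?addr_ge0 ?sqr_ge0// lerDl sqr_ge0.
- rewrite exprn_gt0// => /(_ isT); apply: filterS => n; rewrite !sub0r !normrN => H.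
  rewrite -ltr_sqr ?nnegrE ?(ltW e0)// real_normK ?num_real//; apply: le_lt_trans H.
  by rewrite ger0_norm ?addr_ge0 ?sqr_ge0// lerDr sqr_ge0.
Unshelve. all: end_near. Qed.

(** Closed form of the Dirichlet kernel, multiplied out by [sin (x / 2)] so that its zeros need not
    be excluded. The sum telescopes, since 2 cos a sin b = sin (a + b) - sin (a - b). *)
Lemma dirichlet_kernel N (x : R) :
  pi *+ 2 * (\sum_(n < N.+1) kap n * cos (n%:R * x)) * sin (x / 2) =
  sin (N%:R * x + x / 2).
Proof.
have pi0 := lt0r_neq0 (@pi_gt0 R).
elim: N => [|N IH].
  rewrite big_ord_recl big_ord0 /kap /= addr0 !mul0r cos0 add0r mulr1 mulfV ?mul1r//.
  by rewrite lt0r_neq0// twopi_gt0.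
rewrite big_ord_recr /= mulrDr mulrDl IH /kap /= mulrA.
have -> : pi *+ 2 / pi = 2 :> R by rewrite -[pi *+ 2]mulr_natl mulfK.

have -> : N%:R * x + x / 2 = N.+1%:R * x - x / 2.
  by rewrite -natr1; field.
by rewrite sinB sinD; ring.
Qed.

Lemma kernelE N (y : R) : (fun x => \sum_(n < N) kap n * cos (n%:R * (x - y))) =
  trig_poly (cs ^~ y) (sn ^~ y) N.
Proof.
apply/funext => x; rewrite trig_polyE; apply: eq_bigr => n _.
by rewrite mulrBr cosB /cs /sn; ring.
Qed.

Lemma S_kernel f N (y : R) : L2 f ->
  S f N y = ip f (fun x => \sum_(n < N) kap n * cos (n%:R * (x - y))).
Proof.
move=> Lf; have Lc n := @L2_cs R n; have Ls n := @L2_sn R n.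
rewrite kernelE ipC ip_trig_poly// /S trig_polyE; apply: eq_bigr => n _.
by rewrite mulrC [cf f n * _]mulrC [sf f n * _]mulrC mulrC.
Qed.

Lemma S_cst a N (y : R) : S (fun=> a) N.+1 y = a.
Proof.
have cfa n : kap n * cf (fun=> a) n = a * (n == 0%N)%:R.
  have -> : (fun=> a) = a *: cs 0 :> (R -> R).
    by rewrite cs0; apply/funext => x; rewrite fctE /GRing.scale /= mulr1.
  by rewrite cfZ; [rewrite mulrCA /cf ipC ip_cs_cs|exact: L2_cs].
have sfa n : sf (fun=> a) n = 0.
  have -> : (fun=> a) = a *: cs 0 :> (R -> R).
    by rewrite cs0; apply/funext => x; rewrite fctE /GRing.scale /= mulr1.
  by rewrite sfZ; [rewrite /sf ip_cs_sn mulr0|exact: L2_cs].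
rewrite /S trig_polyE big_ord_recl sfa mul0r addr0 mulrA cfa eqxx mulr1.
rewrite cs0 mulr1 big1 ?addr0// => i _.
by rewrite sfa mul0r addr0 mulrA cfa mulr0 mul0r.
Qed.

(** Since f - f(y) vanishes wherever sin ((x - y) / 2) is small, its quotient by that sine is still
    in L^2. The closed form of the kernel then writes S f N y - f(y) through the N-th coefficients
    of two fixed L^2 functions, which tend to 0. *)
Lemma dirichlet_localization f (y d : R) : L2 f -> 0 < d ->
  (forall x, circle x -> f x != f y -> d <= `|sin ((x - y) / 2)|) ->
  (fun N => S f N y) @ \oo --> f y.
Proof.
move=> Lf d0 fd; have pi0 := lt0r_neq0 (@pi_gt0 R).
pose h : R -> R := f - (fun=> f y).
have Lh : L2 h by apply: L2B Lf (L2_cst _).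
pose s (x : R) := sin ((x - y) / 2).
(* A continuous function equal to 1 / s where |s| >= d, that is, wherever [h] is not zero. *)
pose w x := s x / Num.max (s x ^+ 2) (d ^+ 2).
have cx2 : continuous (fun x : R => (x - y) / 2).
  by move=> x; apply: cvgM; [apply: cvgB; [exact: cvg_id|exact: cvg_cst]|exact: cvg_cst].
have cs_ : continuous s.
  by move=> x; apply: (continuous_comp (cx2 x)); exact: continuous_sin.
have cc_ : continuous (fun x : R => cos ((x - y) / 2)).
  by move=> x; apply: (continuous_comp (cx2 x)); exact: continuous_cos.
have mx x : 0 < Num.max (s x ^+ 2) (d ^+ 2) by rewrite lt_max [X in _ || X]exprn_gt0// orbT.
have cw : continuous w.
  move=> x; apply: cvgM; first exact: cs_.
  apply: cvgV; first by rewrite gt_eqF.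
  have : {for x, continuous ((fun x => s x ^+ 2 : R^o) \max (fun=> d ^+ 2 : R^o))}.
    by apply: continuous_max; [apply: cvgM; exact: cs_|exact: cvg_cst].
  exact.
have hw x : circle x -> h x * w x * s x = h x.
  move=> cx; rewrite /h !fctE; have [->|fxy] := eqVneq (f x) (f y).
    by rewrite subrr !mul0r.
  have ds : d ^+ 2 <= s x ^+ 2.
    by rewrite -[leRHS]real_normK ?num_real// ler_sqr ?nnegrE ?(ltW d0)// fd.
  rewrite /w max_l// -mulrA -[_ / _ * _]mulrAC -expr2 divff ?mulr1//.
  by rewrite gt_eqF// (lt_le_trans _ ds)// exprn_gt0.
pose k1 x := h x * (w x * cos ((x - y) / 2)).
pose k2 x := h x * (w x * s x).
have Lk (v : R -> R) : continuous v -> L2 (fun x => h x * v x).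
  move=> cv; have /compact_bounded[M [_ H]] : compact (v @` (circle : set R)).
    apply: continuous_compact; last exact: segment_compact.
    exact: continuous_subspaceT.
  apply: (@L2_mulb _ _ _ (`|M| + 1)) => //.
    by apply: measurable_funTS; exact: continuous_measurable_fun.
  by move=> x cx; apply: H; [rewrite ltr_pwDr// ler_norm|exists x].
have Lk1 : L2 k1 by apply: Lk => x; apply: cvgM; [exact: cw|exact: cc_].
have Lk2 : L2 k2 by apply: Lk => x; apply: cvgM; [exact: cw|exact: cs_].
have E N : S f N.+1 y - f y = (pi *+ 2)^-1 *
    ((sf k1 N * cs N y - cf k1 N * sn N y) + (cf k2 N * cs N y + sf k2 N * sn N y)).
  rewrite -{1}(@S_cst (f y) N y) !S_kernel// -?ipBl//; [|exact: L2_cst| |exact: L2_cst].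
  - have -> : forall D, ip (f - (fun=> f y)) D = ip h D by [].
    have -> : (sf k1 N * cs N y - cf k1 N * sn N y) + (cf k2 N * cs N y + sf k2 N * sn N y)
      = ip k1 (cs N y *: sn N - sn N y *: cs N) + ip k2 (cs N y *: cs N + sn N y *: sn N).
      have Lc := @L2_cs R N; have Ls := @L2_sn R N.
      by rewrite ipBr ?ipDr ?ipZr ?/sf ?/cf//; try (exact: L2Z); ring.
    have Lc := @L2_cs R N; have Ls := @L2_sn R N.
    rewrite /ip -RintegralD; [|exact: measurable_circle| |]; last 2 first.
      by apply: L2_mul => //; apply: L2B; exact: L2Z.
      by apply: L2_mul => //; apply: L2D; exact: L2Z.
    rewrite -RintegralZl; [|exact: measurable_circle|]; last first.
      by apply: circle_integrableD; apply: L2_mul => //; [apply: L2B|apply: L2D]; exact: L2Z.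
    apply: eq_Rintegral => x; rewrite inE => cx.
    rewrite !fctE -{1}hw// /k1 /k2 /GRing.scale /=.
    have := dirichlet_kernel N (x - y); set D := \sum_(n < _) _.
    rewrite -/(s x) => DN.
    have -> : h x * w x * s x * D = (pi *+ 2)^-1 * (h x * w x * (pi *+ 2 * D * s x)).
      by have p2 := lt0r_neq0 (@twopi_gt0 R); move: (pi *+ 2) p2 => p p2; field.
    rewrite DN sinD mulrBr sinB cosB /cs /sn /s.
    by congr (_ * _); ring.
  - by rewrite kernelE; exact: L2_trig_poly.
have -> : f y = f y + (pi *+ 2)^-1 * (0 + 0) by rewrite addr0 mulr0 addr0.
rewrite -(cvg_shiftS (fun N => S f N y)).
have -> : (fun N => S f N.+1 y) = (fun N => f y + (pi *+ 2)^-1 *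
    ((sf k1 N * cs N y - cf k1 N * sn N y) + (cf k2 N * cs N y + sf k2 N * sn N y))).
  by apply/funext => N; rewrite -E addrC subrK.
have bd (u v : nat -> R) : u @ \oo --> 0 -> (forall n, `|v n| <= 1) ->
    (fun n => u n * v n) @ \oo --> 0.
  move=> /cvg_norm; rewrite normr0 => u0 v1; apply: cvg0_le u0 => n.
  by rewrite normrM ler_piMr.
have [c1 s1] := riemann_lebesgue Lk1; have [c2 s2] := riemann_lebesgue Lk2.
have cb n : `|cs n y| <= 1 := cs_le1 n y; have sb n : `|sn n y| <= 1 := sn_le1 n y.
apply: cvgD; first exact: cvg_cst.
apply: cvgM; [exact: cvg_cst|apply: cvgD].
  by rewrite -[0]subr0; apply: cvgB; exact: bd.
by rewrite -[0]addr0; apply: cvgD; exact: bd.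
Unshelve. all: end_near. Qed.

End parseval.

(** * The Riesz-Fischer theorem *)

Section riesz_fischer.
Context {R : realType}.
Implicit Types (f g h : R -> R) (a : R) (n m N : nat).
Local Notation mu := (@lebesgue_measure R).
Local Notation L2 := (@circle_L2 R).

Lemma cvg_le_cst (u : nat -> R) (l c : R) : u @ \oo --> l ->
  (forall n, u n <= c) -> l <= c.
Proof.
move=> ul uc; rewrite -(cvg_lim (@Rhausdorff R) ul); apply: limr_le; last by near=> n.
by apply/cvg_ex; exists l.
Unshelve. all: end_near. Qed.

Lemma cvg_ge_cst (u : nat -> R) (l c : R) : u @ \oo --> l ->
  (forall n, c <= u n) -> c <= l.
Proof.
move=> ul uc; rewrite -(cvg_lim (@Rhausdorff R) ul); apply: limr_ge; last by near=> n.
by apply/cvg_ex; exists l.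
Unshelve. all: end_near. Qed.

Lemma ae_mono (P Q : R -> Prop) : (forall x, P x -> Q x) ->
  {ae mu, forall x, P x} -> {ae mu, forall x, Q x}.
Proof. by apply: filterS; exact: (ae_filter_ringOfSetsType mu). Qed.

Lemma cvg_addn (u : nat -> R) (l : R) k : u @ \oo --> l ->
  (fun j => u (k + j)%N) @ \oo --> l.
Proof.
move=> /cvgrPdist_lt ul; apply/cvgrPdist_lt => e /ul[N _ HN].
by exists N => // j /= Nj; apply: HN => /=; rewrite (leq_trans Nj)// leq_addl.
Qed.

Section coefficients.
Variables (p q : nat -> R) (w : R).
Let T := trig_poly p q.
Let W N : R := \sum_(n < N) kap n * (p n ^+ 2 + q n ^+ 2).
Hypothesis q0 : q 0%N = 0.
Hypothesis Ww : W @ \oo --> w.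

Let W_nd : nondecreasing_seq W.
Proof.
apply/nondecreasing_seqP => N; rewrite /W big_ord_recr /= lerDl.
by rewrite mulr_ge0 ?kap_ge0// addr_ge0 ?sqr_ge0.
Qed.

Let W_le N : W N <= w.
Proof.
rewrite -(cvg_lim (@Rhausdorff R) Ww); apply: nondecreasing_cvgn_le => //.
by apply/cvg_ex; exists w.
Qed.

Let ipT N M : (N <= M)%N -> ip (T N) (T M) = W N.
Proof.
move=> NM; rewrite ip_trig_poly; last exact: L2_trig_poly.
apply: eq_bigr => n _; rewrite cf_trig_poly sf_trig_poly (leq_trans (ltn_ord n) NM) /=.
by case: n => [[|n] /= _]; rewrite ?q0 ?mul0r ?mul1r ?expr0n ?addr0 -?expr2.
Qed.

Let ipTB N M : ip (T N - T M) (T N - T M) = `|W N - W M|.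
Proof.
wlog NM : N M / (M <= N)%N => [H|].
  have [|/ltnW] := leqP M N; first exact: H.
  move=> /H; rewrite distrC => <-; rewrite -opprB ipNl; first last.
  - by apply/L2N/L2B; exact: L2_trig_poly.
  - by apply/L2B; exact: L2_trig_poly.
  by rewrite ipC ipNl ?opprK//; apply: L2B; exact: L2_trig_poly.
have LT := L2_trig_poly p q; rewrite ip_sqrB// [ip (T N) (T M)]ipC !ipT//.
by rewrite ger0_norm ?subr_ge0 ?W_nd//; ring.
Qed.

(** A subsequence whose later terms stay within 2^-k of the k-th one in norm, hence the doubled
    exponent for the squares. The bound [k <= N_ k] makes it reach every order of coefficient. *)
Let fast : exists N_ : nat -> nat, forall k,
  (k <= N_ k)%N /\ (forall j, (k <= j)%N -> ip (T (N_ j) - T (N_ k)) (T (N_ j) - T (N_ k)) <= 2^-1 ^+ (k * 2)).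
Proof.
have H k : exists N, (k <= N)%N /\ w - W N <= 2^-1 ^+ (k * 2).
  have e0 : (0 : R) < 2^-1 ^+ (k * 2) by rewrite exprn_gt0// invr_gt0.
  move/cvgrPdist_lt: Ww => /(_ _ e0)[N _ HN].
  exists (maxn k N); split; first exact: leq_maxl.
  by apply/ltW/(le_lt_trans (ler_norm _))/HN; exact: leq_maxr.
have [N_ HN] := choice H; exists N_ => k; have [kN Nk] := HN k; split=> // j kj.
rewrite ipTB; have [_ Nj] := HN j.
have jk : 2^-1 ^+ (j * 2) <= 2^-1 ^+ (k * 2) :> R.
  by rewrite ler_wiXn2l ?invr_ge0// ?leq_mul2r ?kj// invf_le1// ler1n.
have := W_le (N_ j); have := W_le (N_ k); rewrite ler_norml => *.
by apply/andP; split; lra.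
Qed.

(** The increments of the fast subsequence have an integrable sum of absolute values, so the
    subsequence converges almost everywhere. Fatou's lemma bounds its L^2 distance to the limit,
    through which inner products, and so the coefficients, pass to the limit. *)
Lemma riesz_fischer : exists g, [/\ L2 g, forall n, cf g n = p n, forall n, sf g n = q n &
  ip g g <= w].
Proof.
have mc := @measurable_circle R; have LT := L2_trig_poly p q.
have [N_ HN] := fast.
pose d k := T (N_ k.+1) - T (N_ k).
have Ld k : L2 (d k) by apply: L2B; exact: LT.
have nd k : nrm (d k) <= 2^-1 ^+ k.
  rewrite -ler_sqr ?nnegrE ?nrm_ge0 ?exprn_ge0 ?invr_ge0// sqr_nrm -exprM.
  by have [_] := HN k; apply.
have Lad k : L2 (fun x => `|d k x|).
  split; first by apply: measurableT_comp => //; exact: L2_measurable (Ld k).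
  by apply: eq_circle_integrable (Ld k).2 => x _; rewrite real_normK ?num_real.
pose c := nrm (fun=> 1 : R).
(* Cauchy-Schwarz against the constant 1 turns the L^2 bound into an L^1 bound. *)
have Id k : (\int[mu]_(x in circle) `|d k x|%:E <= (c * 2^-1 ^+ k)%:E)%E.
  have := L2_integrable (Lad k) => /(integrable_fin_num mc) /fineK <-.
  rewrite lee_fin -[fine _]/(Rintegral _ _ _).
  have -> : (Rintegral mu circle (fun x => `|d k x|)) = ip (fun x => `|d k x|) (fun=> 1).
    by apply: eq_Rintegral => x _; rewrite mulr1.
  apply: le_trans (ler_norm _) _; apply: le_trans (ip_le (Lad k) (L2_cst 1)) _.
  rewrite mulrC; apply: ler_wpM2l; first exact: nrm_ge0.
  have -> : nrm (fun x => `|d k x|) = nrm (d k).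
    by rewrite /nrm /ip; congr Num.sqrt; apply: eq_Rintegral => x _; rewrite -expr2 real_normK ?num_real// expr2.
  exact: nd.
have mad k : measurable_fun circle (fun x => `|d k x|%:E).
  by apply/measurable_EFinP; exact: L2_measurable (Lad k).
pose D x := (\sum_(0 <= k <oo) `|d k x|%:E)%E.
have iD : mu.-integrable circle D.
  apply/integrableP; split.
    apply: ge0_emeasurable_sum => *; [by rewrite lee_fin|exact: mad].
  have -> : (\int[mu]_(x in circle) `|D x| = \int[mu]_(x in circle) D x)%E.
    apply: eq_integral => x _.
    by rewrite gee0_abs// nneseries_ge0// => k _ _; rewrite lee_fin.
  rewrite integral_nneseries//.
  apply: (@le_lt_trans _ _ (c * 2)%:E); last exact: ltry.
  apply: lime_le.
    by apply: is_cvg_nneseries => k _ _; apply: integral_ge0 => x _; rewrite lee_fin.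
  near=> n; apply: (@le_trans _ _ (\sum_(0 <= k < n) (c * 2^-1 ^+ k)%:E)%E).
    by apply: lee_sum => k _; exact: Id.
  rewrite sumEFin lee_fin -mulr_sumr ler_wpM2l ?nrm_ge0//.
  have -> : \sum_(0 <= k < n) 2^-1 ^+ k = 2 - 2 * 2^-1 ^+ n :> R.
    elim: (n) => [|j IH]; first by rewrite big_nil expr0; lra.
    by rewrite big_nat_recr//= IH exprS mulVKf//; lra.
  by rewrite lerBlDr lerDl mulr_ge0 ?exprn_ge0 ?invr_ge0.
have D_ae : {ae mu, forall x, circle x -> cvgn (fun k => T (N_ k) x)}.
  apply: (ae_mono _ (integrable_ae mc iD)).
  move=> x Dx cx; have {}Dx := Dx cx.
  have : cvgn (series (fun k => d k x)).
    apply: normed_cvg; rewrite -[X in cvgn X]/(series (fun k => `|d k x|)).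
    apply: nondecreasing_is_cvgn.
      by apply/nondecreasing_seqP => k; rewrite /series /= big_nat_recr//= lerDl.
    exists (fine (D x)) => _ [k _ <-]; rewrite -lee_fin fineK// /series /= -sumEFin.
    by apply: nneseries_lim_ge => j _; rewrite lee_fin.
  have E k : T (N_ k) x = T (N_ 0) x + series (fun k => d k x) k.
    rewrite /series /=; elim: k => [|k IH]; first by rewrite big_nil addr0.
    by rewrite big_nat_recr//= addrA -IH /d !fctE addrC subrK.
  have -> : (fun k => T (N_ k) x) = (fun k => T (N_ 0) x + series (fun k => d k x) k).
    exact/funext.
  by move=> H; apply: is_cvgD => //; exact: is_cvg_cst.
(* The upper limit is measurable without any convergence assumption and equals the limit where there
   is one. *)
pose g x := fine (limn_esup (fun k => (T (N_ k) x)%:E)).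
have mg : measurable_fun circle g.
  apply: measurableT_comp; first exact: fine_measurable.
  apply: measurable_fun_limn_esup => k; apply/measurable_EFinP.
  exact: L2_measurable (LT _).
have Tg : {ae mu, forall x, circle x -> (fun k => T (N_ k) x) @ \oo --> g x}.
  apply: (ae_mono _ D_ae).
  move=> x H cx; move: (H cx) => /cvg_ex[l xl].
  suff -> : g x = l by [].
  rewrite /g; have : (fun k => (T (N_ k) x)%:E) @ \oo --> l%:E.
    by apply: cvg_EFin; [near=> k|].
  by move=> /cvg_limn_einf_sup[_ ->].
have gT k : L2 (g - T (N_ k)) /\ ip (g - T (N_ k)) (g - T (N_ k)) <= 2^-1 ^+ (k * 2).
  apply: (@fatou_L2 R (fun j => T (N_ (k + j)%N) - T (N_ k))).
  - by move=> j; apply: L2B; exact: LT.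
  - by apply: measurable_funB => //; exact: L2_measurable (LT _).
  - apply: (ae_mono _ Tg).
    move=> x H cx; move: (H cx) => {}H; rewrite !fctE; apply: cvgB; last exact: cvg_cst.
    exact: (@cvg_addn (fun j => T (N_ j) x)).
  - by move=> j; have [_] := HN k; apply; exact: leq_addr.
have Lg : L2 g.
  have -> : g = (g - T (N_ 0)) + T (N_ 0) by rewrite subrK.
  by apply: L2D (LT _); have [] := gT 0%N.
(* An inner product that is eventually constant along the partial sums keeps its value at the limit
   [g]. *)
have coef (v : R -> R) (r : R) N0 : L2 v -> (forall N, (N0 <= N)%N -> ip (T N) v = r) -> ip g v = r.
  move=> Lv Hv; apply/eqP; rewrite -subr_eq0 -normr_le0; apply/ler_addgt0Pl => e e0.
  rewrite addr0.
  have : geometric (nrm v) (2^-1 : R) @ \oo --> (0 : R).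
    by apply: cvg_geometric; rewrite gtr0_norm ?invr_gt0// invf_lt1// ltr1n.
  move/cvgrPdist_lt => /(_ _ e0)[K _ HK].
  pose k := maxn K N0.
  have Nk : (N0 <= N_ k)%N by have [+ _] := HN k; apply: leq_trans; exact: leq_maxr.
  have [L1 H1] := gT k.
  have -> : ip g v - r = ip (g - T (N_ k)) v by rewrite ipBl// Hv.
  apply: le_trans (ip_le L1 Lv) _; have := HK k (leq_maxl _ _).
  rewrite sub0r normrN /geometric /= ger0_norm; last by rewrite mulr_ge0 ?nrm_ge0 ?exprn_ge0 ?invr_ge0.
  move=> /ltW; apply: le_trans; rewrite mulrC; apply: ler_wpM2l; first exact: nrm_ge0.
  by rewrite -ler_sqr ?nnegrE ?nrm_ge0 ?exprn_ge0 ?invr_ge0// sqr_nrm -exprM.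
exists g; split => //.
- move=> n; apply: (coef _ _ n.+1); first exact: L2_cs.
  by move=> N nN; rewrite -/(cf (T N) n) cf_trig_poly nN mul1r.
- move=> n; apply: (coef _ _ n.+1); first exact: L2_sn.
  move=> N nN; rewrite -/(sf (T N) n) sf_trig_poly nN /=.
  by case: n nN => [|n] nN; rewrite ?q0 ?mulr0 ?mul1r.
- have [] // := @fatou_L2 R (fun j => T (N_ j)) g w => //.
  by move=> j; rewrite ipT.
Unshelve. all: end_near. Qed.

End coefficients.
End riesz_fischer.

(** * Completeness of the trigonometric system and Parseval's identity *)

Section completeness.
Context {R : realType}.
Implicit Types (f g h : R -> R) (a : R) (n m N : nat).
Local Notation mu := (@lebesgue_measure R).
Local Notation L2 := (@circle_L2 R).

(** Testing a function against these indicators over the circle gives its primitive, while their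
    Fourier series can be summed by hand. *)
Definition step a (x : R) : R := (x <= a)%R%:R.

Lemma measurable_step a (D : set (measurableTypeR R)) : measurable_fun D (step a).
Proof.
have -> : step a = \1_(`]-oo, a]%classic : set R).
  apply/funext => x; rewrite /step indicE; congr (_%:R); congr nat_of_bool.
  by apply/idP/idP; rewrite inE /= in_itv.
by apply: measurable_indic; exact: measurable_itv.
Qed.

Lemma L2_step a : L2 (step a).
Proof.
apply: (@L2_bounded _ _ 1); first exact: measurable_step.
by move=> x _; rewrite /step; case: (x <= a) => /=; rewrite ?normr0 ?normr1.
Qed.

(** Localization applies: the value changes only at points x at distance at least |a - y| from y,
    and as y is interior, |x - y| / 2 also stays away from pi. *)
Lemma S_step_cvg a (y : R) : 0 < y -> y < pi *+ 2 -> y != a ->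
  (fun N => S (step a) N y) @ \oo --> step a y.
Proof.
move=> y0 y2 ya.
(* If the values at x and y differ, then |x - y| / 2 lies in [e, t0], a compact subset of (0, pi) on
   which the sine has a positive minimum. *)
pose t0 := Num.max y (pi *+ 2 - y) / 2; pose e := `|a - y| / 2.
have e0 : 0 < e by rewrite divr_gt0// normr_gt0 subr_eq0 eq_sym.
have t0pi : t0 < pi.
  by rewrite /t0 ltr_pdivrMr// mulr_natr gt_max y2 ltrBlDr ltrDl.
have [d [d0 Hd]] : exists d, 0 < d /\ forall t : R, e <= t <= t0 -> d <= sin t.
  have [et|te] := leP e t0; last first.
    exists 1; split => // t /andP[h1 h2]; have := lt_le_trans te h1.
    by rewrite ltNge h2.
  have [c] := @EVT_min _ (@sin R) _ _ et (continuous_subspaceT (@continuous_sin R)).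
  rewrite in_itv /= => /andP[ec ct] H; exists (sin c); split.
    by apply: sin_gt0_pi; rewrite (lt_le_trans e0 ec) (le_lt_trans ct t0pi).
  by move=> t et'; apply: H; rewrite in_itv.
apply: (dirichlet_localization (L2_step a) d0) => x.
rewrite /circle /= in_itv /= => /andP[x0 x2].
rewrite /step => H.
have xy : `|a - y| <= `|x - y|.
  move: H; case: (leP x a) => xa; case: (leP y a) => yb; rewrite ?eqxx// => _.
  - by rewrite ler0_norm ?subr_le0 ?(ltW yb)// ler0_norm ?subr_le0 ?(le_trans xa (ltW yb))//; lra.
  - by rewrite ger0_norm ?subr_ge0// ger0_norm ?subr_ge0 ?(le_trans yb (ltW xa))//; lra.
have -> : `|sin ((x - y) / 2)| = `|sin (`|x - y| / 2)|.
  have [xy0|/ltW xy0] := leP 0 (x - y); first by rewrite (ger0_norm xy0).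
  by rewrite (ler0_norm xy0) mulNr sinN normrN.
apply: le_trans (ler_norm _); apply: Hd; rewrite /e /t0 !ler_pM2r ?invr_gt0//.
rewrite xy /= le_max !ler_norml.
by have [xy0|xy0] := leP x y; apply/orP; [left|right]; apply/andP; split; lra.
Qed.

Lemma ae_neq (a : R) : {ae mu, forall x, x != a}.
Proof.
exists [set a]; split => //; first exact: lebesgue_measure_set1.
by move=> x /= /negP; rewrite negbK => /eqP.
Qed.

Lemma ae_and (P Q : R -> Prop) :
  {ae mu, forall x, P x} -> {ae mu, forall x, Q x} -> {ae mu, forall x, P x /\ Q x}.
Proof. by apply: filterI; exact: (ae_filter_ringOfSetsType mu). Qed.

Lemma ip_S_S f N M : (N <= M)%N -> ip (S f M - S f N) (S f M - S f N) = pars M f f - pars N f f.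
Proof.
move=> NM; have LS := L2_S f; rewrite ip_sqrB// !ip_S// ![pars _ f (S f _)]parsC.
by rewrite !pars_S//; ring.
Qed.

(** Bessel makes the partial sums Cauchy in L^2, and pointwise convergence almost everywhere
    identifies their limit: by Fatou, the squared distance from [f] to its N-th sum is at most the
    tail of the Bessel series. *)
Lemma step_parseval a : nrm (step a - S (step a) N) @[N --> \oo] --> 0.
Proof.
pose f := step a; have Lf : L2 f := L2_step a; have LS := L2_S f.
have [l fl] : exists l : R, (fun N => pars N f f) @ \oo --> l by apply/cvg_ex; exact: pars_cvg.
have pl N : pars N f f <= l.
  rewrite -(cvg_lim (@Rhausdorff R) fl); apply: nondecreasing_cvgn_le; last exact: pars_cvg.
  exact: pars_nondecreasing.
have H N : ip (f - S f N) (f - S f N) <= l - pars N f f.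
  have [] // := @fatou_L2 R (fun j => S f (N + j)%N - S f N) (f - S f N) (l - pars N f f).
  - by move=> j; apply: L2B.
  - by apply: L2_measurable; apply: L2B.
  - apply: (ae_mono _ (ae_and (ae_neq a) (ae_and (ae_neq 0) (ae_neq (pi *+ 2))))).
    move=> x [xa [x0 x2]]; rewrite /circle /= in_itv /= => /andP[x0' x2'].
    rewrite !fctE; apply: cvgB; last exact: cvg_cst.
    apply: (@cvg_addn _ (fun j => S f j x)); apply: S_step_cvg => //.
      by rewrite lt_def x0.
    by rewrite lt_def eq_sym x2.
  - by move=> j; rewrite ip_S_S ?leq_addr// lerB.
have K : (fun N => l - pars N f f) @ \oo --> (0 : R).
  by rewrite -(subrr l); apply: cvgB => //; exact: cvg_cst.
have K2 : (fun N => Num.sqrt (l - pars N f f)) @ \oo --> (0 : R).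
  by rewrite -(sqrtr0 R); apply: continuous_cvg => //; exact: sqrt_continuous.
apply: (cvg0_le _ K2) => N; rewrite ger0_norm ?nrm_ge0// /nrm.
by rewrite ler_sqrt// (le_trans _ (H N))// ip_ge0.
Qed.

(** Orthogonality to all harmonics passes to the indicators [step a], which are L^2 limits of
    trigonometric polynomials. The primitive of [r] is then 0, and Lebesgue's differentiation
    theorem gives r = 0 almost everywhere. *)
Lemma fourier_unique r : L2 r -> (forall n, cf r n = 0) -> (forall n, sf r n = 0) ->
  ip r r = 0.
Proof.
move=> Lr cr sr; have mc := @measurable_circle R.
have r_step a : ip r (step a) = 0.
  apply/eqP; rewrite -normr_le0; apply/ler_addgt0Pl => e e0; rewrite addr0.
  have n1 : 0 < nrm r + 1 by rewrite ltr_wpDl ?nrm_ge0.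
  have /cvgrPdist_lt/(_ (e / (nrm r + 1))) := step_parseval a.
  rewrite divr_gt0// => /(_ isT)[N _ /(_ N (leqnn _))]; rewrite /= sub0r normrN => HN.
  have LS := L2_S (step a) N; have Ls := L2_step a.
  have -> : ip r (step a) = ip r (step a - S (step a) N).
    rewrite ipBr// [X in _ - X]ipC ip_S// /pars big1 ?subr0// => n _.
    by rewrite cr sr !mulr0 addr0 mulr0.
  apply: le_trans (ip_le Lr (L2B Ls LS)) _.
  move/ltW: HN; rewrite ger0_norm ?nrm_ge0// => HN.
  apply: (@le_trans _ _ ((nrm r + 1) * (e / (nrm r + 1)))).
    by apply: ler_pM; rewrite ?nrm_ge0// lerDl.
  by rewrite mulrC divfK// gt_eqF.
pose rr : R -> R := r \_ circle.
have rrT : mu.-integrable setT (EFin \o rr).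
  have := L2_integrable Lr; rewrite /circle_integrable => /(integrable_mkcond _ mc).
  by rewrite -restrict_EFin.
have rr_int (D : set R) : measurable D -> mu.-integrable D (EFin \o rr).
  by move=> mD; apply: integrableS rrT.
have F0 x : \int[mu]_(t in `[0, x]) rr t = 0.
  rewrite Rintegral_mkcond -[RHS](r_step x) /ip [RHS]Rintegral_mkcond.
  apply: eq_Rintegral => t _; rewrite /rr !patchE /step.
  have [t0|t0] := boolP (t \in circle); last by rewrite if_same.
  have -> : (t \in `[0, x]%classic) = (t <= x)%R.
    have := set_mem t0; rewrite /circle /= in_itv /= => /andP[t0' _].
    apply/idP/idP => [/set_mem|tx]; first by rewrite /= in_itv /= => /andP[].
    by apply/mem_set; rewrite /= in_itv /= t0'.
  by case: (t <= x); rewrite ?mulr1 ?mulr0.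
have rr0 : {ae mu, forall x, circle x -> r x = 0}.
  have := @FTC1 R rr (BLeft 0) (fun y => rr_int _ (measurable_itv _)).
  have lr : locally_integrable setT rr by apply: integrable_locally => //; exact: L2_integrable.
  move=> /(_ lr) /= H1; apply: (ae_mono _ (ae_and (ae_neq 0) H1)).
  move=> x [xn0 H] cx; have cx' := cx.
  move: cx'; rewrite /circle /= in_itv /= => /andP[x0 x2].
  have [|_] := H; first by rewrite lte_fin lt_def xn0.
  rewrite /rr patchE mem_set// => <-; rewrite (_ : (fun _ => _) = cst 0).
    by rewrite derive1_cst.
  by apply/funext => z; exact: F0.
have -> : ip r r = ip 0 0; last by rewrite ip0l.
rewrite /ip /Rintegral; congr fine; apply: ae_eq_integral => //.
- by apply/measurable_EFinP/measurable_funM; exact: L2_measurable.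
- by apply/measurable_EFinP/measurable_funM; exact: measurable_cst.
- by apply: (ae_mono _ rr0) => x H cx; rewrite H// !mulr0.
Qed.

(** Riesz-Fischer gives [g] with the coefficients of [f] and with squared norm at most the sum [l]
    of the series; by uniqueness f - g has norm 0, so [ip f f <= l]. Bessel is the other
    inequality. *)
Theorem parseval f : L2 f -> (fun N => pars N f f) @ \oo --> ip f f.
Proof.
move=> Lf; have [l fl] : exists l : R, (fun N => pars N f f) @ \oo --> l.
  by apply/cvg_ex; exact: pars_cvg.
suff <- : l = ip f f by [].
apply/eqP; rewrite eq_le (cvg_le_cst fl (fun N => bessel N Lf)) /=.
have [||g [Lg gc gs gl]] := @riesz_fischer R (cf f) (sf f) l.
- exact: sf0.
- exact: fl.
apply: le_trans gl; have Lfg := L2B Lf Lg.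
have fg0 : ip (f - g) (f - g) = 0.
  by apply: fourier_unique => // n; rewrite ?cfB ?sfB// ?gc ?gs subrr.
have -> : f = g + (f - g) by rewrite addrC subrK.
rewrite ip_sqrD// fg0 addr0.
have := ip_sqr_le Lg Lfg; rewrite fg0 mulr0 => h.
have -> : ip g (f - g) = 0 by apply/eqP; rewrite -sqrf_eq0 eq_le h sqr_ge0.
by rewrite mulr0 addr0.
Qed.

Lemma S_cvg f : L2 f -> nrm (f - S f N) @[N --> \oo] --> 0.
Proof.
move=> Lf; have K : (fun N => ip f f - pars N f f) @ \oo --> (0 : R).
  by rewrite -(subrr (ip f f)); apply: cvgB; [exact: cvg_cst|exact: parseval].
have K2 : (fun N => Num.sqrt (ip f f - pars N f f)) @ \oo --> (0 : R).
  by rewrite -(sqrtr0 R); apply: continuous_cvg => //; exact: sqrt_continuous.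
by apply: (cvg0_le _ K2) => N; rewrite ger0_norm ?nrm_ge0// /nrm bessel_eq.
Qed.

Lemma parseval2 f g : L2 f -> L2 g -> (fun N => pars N f g) @ \oo --> ip f g.
Proof.
move=> Lf Lg; have K : (fun N => nrm (f - S f N) * nrm g) @ \oo --> (0 : R).
  by rewrite -(mul0r (nrm g)); apply: cvgM; [exact: S_cvg|exact: cvg_cst].
have K2 : (fun N => ip f g - pars N f g) @ \oo --> (0 : R).
  apply: (cvg0_le _ K) => N; have LS := L2_S f N.
  by rewrite -ip_S// -ipBl// ip_le//; exact: L2B.
have -> : (fun N => pars N f g) = (fun N => ip f g - (ip f g - pars N f g)).
  by apply/funext => N; ring.
by rewrite -[X in _ --> X]subr0; apply: cvgB => //; exact: cvg_cst.
Qed.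

End completeness.

(** * The half energy in Fourier coefficients *)

Section energy.
Context {R : realType}.
Implicit Types (f g h : R -> R) (a : R) (n m N : nat).
Local Notation mu := (@lebesgue_measure R).
Local Notation L2 := (@circle_L2 R).

(** Truncated energy. It is continuous for the L^2 norm and nondecreasing in [N], and this is where
    the lower semicontinuity of [En] comes from. *)
Definition enp N f : R := \sum_(n < N) kap n * n%:R * (cf f n ^+ 2 + sf f n ^+ 2).

Definition En f : R := limn (fun N => enp N f).

Lemma enp_ge0 N f : 0 <= enp N f.
Proof.
by apply: sumr_ge0 => n _; rewrite !mulr_ge0 ?kap_ge0// addr_ge0 ?sqr_ge0.
Qed.

Lemma enp_nondecreasing f : nondecreasing_seq (fun N => enp N f).
Proof.
apply/nondecreasing_seqP => N; rewrite /enp big_ord_recr /= lerDl.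
by rewrite !mulr_ge0 ?kap_ge0// addr_ge0 ?sqr_ge0.
Qed.

Lemma enp_cvg f B : (forall N, enp N f <= B) -> (fun N => enp N f) @ \oo --> En f.
Proof.
move=> fB; apply: (nondecreasing_is_cvgn (@enp_nondecreasing f)).
by exists B => _ [N _ <-].
Qed.

Lemma En_le f B : (forall N, enp N f <= B) -> En f <= B.
Proof. by move=> fB; apply: (cvg_le_cst (enp_cvg fB)). Qed.

Lemma fun_distrE f X : circle_integrable f -> fun_distr f X = ip f X.
Proof. by move=> fi; rewrite /fun_distr; case: pselect. Qed.

Lemma real_complexM (a x y : R) : (a%:C * (x +i* y) = (a * x) +i* (a * y))%C.
Proof. by rewrite /GRing.mul /= !mul0r subr0 addr0. Qed.

(** Cosine is even and sine odd, so the complex relation at -n is the conjugate of the one at n, and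
    the nonnegative frequencies suffice. *)
Lemma is_fracLapP s f g : L2 f -> L2 g ->
  is_fracLap s (fun_distr f) (fun_distr g) <->
  forall n, cf g n = n%:R `^ (2 * s) * cf f n /\ sf g n = n%:R `^ (2 * s) * sf f n.
Proof.
move=> Lf Lg; have fi := L2_integrable Lf; have gi := L2_integrable Lg.
have p0 : (pi *+ 2)^-1 != 0 :> R by rewrite invr_neq0// lt0r_neq0// twopi_gt0.
have E (h : R -> R) (n : int) : circle_integrable h -> fourier (fun_distr h) n =
    ((pi *+ 2)^-1 * ip h (cosn n) +i* ((pi *+ 2)^-1 * - ip h (sinn n)))%C.
  by move=> hi; rewrite /fourier !fun_distrE// real_complexM.
have EP (h : R -> R) (n : nat) : circle_integrable h -> fourier (fun_distr h) n =
    ((pi *+ 2)^-1 * cf h n +i* ((pi *+ 2)^-1 * - sf h n))%C by exact: E.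
have EN (h : R -> R) (n : nat) : L2 h -> fourier (fun_distr h) (Negz n) =
    ((pi *+ 2)^-1 * cf h n.+1 +i* ((pi *+ 2)^-1 * sf h n.+1))%C.
  move=> Lh; have e (x : R) : (Negz n)%:~R * x = - (n.+1%:R * x).
    by rewrite NegzE mulrNz mulNr.
  rewrite E; last exact: L2_integrable.
  have -> : ip h (cosn (Negz n)) = cf h n.+1.
    by apply: eq_ip => // x _; rewrite /= e cosN.
  have -> : ip h (sinn (Negz n)) = - sf h n.+1.
    rewrite /sf [ip h (sn _)]ipC -ipNl//; last exact: L2_sn.
    by rewrite ipC; apply: eq_ip => // x _; rewrite /= e sinN.
  by rewrite opprK.
have nz (n : nat) : `|n%:Z|%:~R = n%:R :> R by [].
split=> [H n|H [n|n]].
- have := H n; rewrite !EP// real_complexM nz; case.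
  set w := n%:R `^ _; move: (pi *+ 2)^-1 p0 => c c0 H1 H2; split.
    by apply: (mulfI c0); rewrite H1; ring.
  by apply: (mulfI c0); apply: oppr_inj; rewrite -mulrN H2; ring.
- rewrite !EP// real_complexM nz.
  by have [-> ->] := H n; congr Complex; ring.
- rewrite !EN// real_complexM.
  have -> : `|Negz n|%:~R = n.+1%:R :> R by rewrite NegzE normrN.
  by have [-> ->] := H n.+1; congr Complex; ring.
Qed.

Lemma powR_quarter n : n%:R `^ (2 * 4^-1) = Num.sqrt n%:R :> R.
Proof.
have -> : 2 * 4^-1 = 2^-1 :> R by field.
by rewrite powR12_sqrt.
Qed.

Lemma powR_half n : n%:R `^ (2 * 2^-1) = n%:R :> R.
Proof. by rewrite divff// powRr1. Qed.

Lemma pars_quarter f g N : L2 f -> has_fracLap 4^-1 f g -> pars N g g = enp N f.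
Proof.
move=> Lf [Lg /(is_fracLapP _ Lf Lg) H]; apply: eq_bigr => n _.
have [-> ->] := H n; rewrite powR_quarter.
have := @sqr_sqrtr R n%:R (ler0n _ _); set w := Num.sqrt _ => <-.
by ring.
Qed.

Lemma quarter_enp_le f g N : L2 f -> has_fracLap 4^-1 f g -> enp N f <= ip g g.
Proof. by move=> Lf fg; rewrite -(pars_quarter N Lf fg) bessel//; case: fg. Qed.

Lemma quarter_exists f B : L2 f -> (forall N, enp N f <= B) ->
  exists g, has_fracLap 4^-1 f g.
Proof.
move=> Lf fB.
have [||g [Lg gc gs _]] := @riesz_fischer R (fun n => Num.sqrt n%:R * cf f n)
    (fun n => Num.sqrt n%:R * sf f n) (En f).
- by rewrite sf0 mulr0.
- have <- : (fun N => enp N f) = (fun N => \sum_(n < N)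
    kap n * ((Num.sqrt n%:R * cf f n) ^+ 2 + (Num.sqrt n%:R * sf f n) ^+ 2)).
    apply/funext => N; apply: eq_bigr => n _; rewrite !exprMn sqr_sqrtr//; ring.
  exact: enp_cvg fB.
exists g; split=> //; apply/(is_fracLapP _ Lf Lg) => n.
by rewrite powR_quarter.
Qed.

Lemma ip_quarter f g : L2 f -> has_fracLap 4^-1 f g -> ip g g = En f.
Proof.
move=> Lf fg; have Lg : L2 g by case: fg.
have := parseval Lg.
have -> : (fun N => pars N g g) = (fun N => enp N f).
  by apply/funext => N; exact: pars_quarter.
by move=> /(cvg_lim (@Rhausdorff R)).
Qed.

Lemma fracLap_has s f : (exists g, has_fracLap s f g) -> has_fracLap s f (fracLap s f).
Proof. by case=> g fg; rewrite /fracLap; apply: xgetPex; exists g. Qed.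

Lemma circle_int_sum (I : Type) (r : seq I) (F : I -> R -> R) :
  (forall i, circle_integrable (F i)) ->
  circle_integrable (fun x => \sum_(i <- r) F i x) /\
  \int[mu]_(x in circle) (\sum_(i <- r) F i x) =
  \sum_(i <- r) \int[mu]_(x in circle) F i x.
Proof.
move=> Fi; have mc := @measurable_circle R; elim: r => [|i r [IH1 IH2]].
  split.
    by apply: eq_circle_integrable (circle_integrable_cst 0) => x _; rewrite big_nil.
  rewrite big_nil (@eq_Rintegral _ _ _ _ _ (cst 0)); last by move=> x _; rewrite big_nil.
  by rewrite Rintegral_cst// mul0r.
split.
  apply: eq_circle_integrable (circle_integrableD (Fi i) IH1) => x _.
  by rewrite big_cons.
rewrite big_cons -IH2 -RintegralD//; last exact: Fi.
by apply: eq_Rintegral => x _; rewrite big_cons.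
Qed.

(** Stated with bounds on truncated energies, since these survive L^2 limits; by Riesz-Fischer this
    amounts to the quarter Laplacian lying in L^2. *)
Definition finite_energy f := L2 f /\ exists B, forall N, enp N f <= B.

Lemma finite_energyP f : L2 f -> finite_energy f <-> exists g, has_fracLap 4^-1 f g.
Proof.
move=> Lf; split => [[_ [B]]|[g fg]]; first exact: quarter_exists.
by split=> //; exists (ip g g) => N; exact: quarter_enp_le.
Qed.

Lemma finite_energy_cvg f : finite_energy f -> (fun N => enp N f) @ \oo --> En f.
Proof. by move=> [_ [B]]; exact: enp_cvg. Qed.

Lemma enp_le_En f N : finite_energy f -> enp N f <= En f.
Proof.
move=> fe; have fE := finite_energy_cvg fe.
apply: nondecreasing_cvgn_le; first exact: enp_nondecreasing.
by apply/cvg_ex; exists (En f).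
Qed.

Lemma half_energyE k (u : R -> 'rV[R]_k) : (forall i, finite_energy (coordf u i)) ->
  half_energy u = \sum_i En (coordf u i).
Proof.
move=> ue; have H i : has_fracLap 4^-1 (coordf u i) (fracLap 4^-1 (coordf u i)).
  by apply/fracLap_has/finite_energyP; [case: (ue i)|exact: ue].
transitivity (\sum_i ip (fracLap 4^-1 (coordf u i)) (fracLap 4^-1 (coordf u i))).
  rewrite -(circle_int_sum _ _).2; last by move=> i; apply: L2_mul; case: (H i).
  by apply: eq_Rintegral => x _; apply: eq_bigr => i _; rewrite !mxE.
by apply: eq_bigr => i _; apply: ip_quarter => //; case: (ue i).
Qed.

Lemma in_H12P k (u : R -> 'rV[R]_k) : in_H12 u <->
  periodic u (pi *+ 2) /\ forall i, finite_energy (coordf u i).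
Proof.
split=> -[pu H]; split => // i; first by have [Lu ?] := H i; apply/finite_energyP.
by have [Lu ?] := H i; split => //; apply/finite_energyP.
Qed.

Lemma enpB f g N : L2 f -> L2 g -> enp N (f - g) <= 2 * enp N f + 2 * enp N g.
Proof.
move=> Lf Lg; rewrite /enp !mulr_sumr -big_split; apply: ler_sum => n _ /=.
rewrite cfB// sfB// -[leLHS]mul1r; set a := kap n * n%:R.
have a0 : 0 <= a by rewrite mulr_ge0 ?kap_ge0.
have := mulr_ge0 a0 (addr_ge0 (sqr_ge0 (cf f n + cf g n)) (sqr_ge0 (sf f n + sf g n))).
by lra.
Qed.

Lemma finite_energyB f g : finite_energy f -> finite_energy g -> finite_energy (f - g).
Proof.
move=> [Lf [B fB]] [Lg [C gC]]; split; first exact: L2B.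
exists (2 * B + 2 * C) => N; apply: le_trans (enpB N Lf Lg) _.
by rewrite lerD// ler_pM2l.
Qed.

Lemma finite_energy_S f N : L2 f -> finite_energy (S f N).
Proof.
move=> Lf; split; first exact: L2_S.
exists (enp N f) => M; have [MN|/ltnW NM] := leqP M N.
  rewrite (_ : enp M (S f N) = enp M f); first exact: enp_nondecreasing.
  apply: eq_bigr => n _; rewrite cf_S sf_S.
  by rewrite (leq_trans (ltn_ord n) MN) !mul1r.
rewrite /enp -(subnKC NM) big_split_ord /= [X in _ + X]big1 ?addr0; last first.
  move=> n _; rewrite cf_S sf_S ltnNge leq_addr !mul0r expr0n addr0 mulr0//.
by apply: ler_sum => n _; rewrite cf_S sf_S ltn_ord !mul1r.
Qed.

(** The difference keeps exactly the coefficients of order at least [N], so its energy is the tail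
    of the series. *)
Lemma En_sub_S f N : finite_energy f -> En (f - S f N) <= En f - enp N f.
Proof.
move=> fe; have Lf : L2 f by case: fe.
apply: En_le => M; apply: (@le_trans _ _ (enp (M + N)%N (f - S f N))).
  by apply: enp_nondecreasing; exact: leq_addr.
rewrite lerBrDr; apply: le_trans (enp_le_En (M + N)%N fe).
rewrite [leRHS]/enp addnC big_split_ord [leLHS]addrC lerD//.
rewrite /enp big_split_ord /= big1 ?add0r; last first.
  move=> n _; rewrite cfB ?sfB ?cf_S ?sf_S ?ltn_ord ?mul1r ?subrr//; try exact: L2_S.
  by rewrite expr0n addr0 mulr0.
apply: ler_sum => n _; rewrite cfB ?sfB ?cf_S ?sf_S//; try exact: L2_S.
by rewrite ltnNge leq_addr !mul0r !subr0.
Qed.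

Lemma En_S_cvg f : finite_energy f -> (fun N => En (f - S f N)) @ \oo --> 0.
Proof.
move=> fe; have K : (fun N => En f - enp N f) @ \oo --> (0 : R).
  rewrite -(subrr (En f)); apply: cvgB; first exact: cvg_cst.
  exact: finite_energy_cvg.
apply: (cvg0_le _ K) => N; rewrite ger0_norm ?En_sub_S//.
have [_ [B HB]] := finite_energyB fe (finite_energy_S N fe.1).
apply: (cvg_ge_cst (enp_cvg HB)) => M; exact: enp_ge0.
Qed.

End energy.

(** * The quadratic form *)

Section form.
Context {R : realType}.
Implicit Types (f g h : R -> R) (a : R) (n m N : nat) (X : R -> R).
Local Notation mu := (@lebesgue_measure R).
Local Notation L2 := (@circle_L2 R).

(* With h = \sum_(n >= 1) n (c_n - i s_n) e^(inx) / pi, one has |D|f = Re h and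
   f' = - Im h, so that |D|f f' = - Im (h^2) / 2 involves X only through its
   (n + m)-th coefficients with n, m >= 1; this is why the form extends to L^2. *)
Definition bq X N f g : R := 2^-1 * \sum_(n < N) \sum_(m < N)
  (kap n * n%:R) * (kap m * m%:R) *
   ((cf f n * sf g m + sf f n * cf g m) * cf X (n + m) -
    (cf f n * cf g m - sf f n * sf g m) * sf X (n + m)).

(** The form is symmetric in [f] and [g] only up to exchanging the two indices, so the identity
    holds after adding the terms (n, m) and (m, n), not term by term. *)
Lemma bqDB X N f g : L2 f -> L2 g -> bq X N f f - bq X N g g = bq X N (f - g) (f + g).
Proof.
move=> Lf Lg; rewrite /bq -mulrBr; congr (_ * _).
have D (F : 'I_N -> 'I_N -> R) : \sum_(n < N) \sum_(m < N) F n m =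
    2^-1 * \sum_(n < N) \sum_(m < N) (F n m + F m n).
  under [in RHS]eq_bigr do rewrite big_split /=.
  rewrite big_split /= [X in _ + X]exchange_big /= -mulr2n -[X in _ * X]mulr_natl.
  by rewrite mulKf.
rewrite -sumrB; under eq_bigr do rewrite -sumrB.
rewrite [LHS]D [RHS]D.
congr (_ * _); apply: eq_bigr => n _; apply: eq_bigr => m _.
rewrite !cfB// !sfB// !cfD// !sfD// [(m + n)%N]addnC; ring.
Qed.

(** The factors are the harmonics of |D|f and f', with coefficients [c], [s] at order [n] and [d],
    [t] at order [m]. Adding the product with the orders exchanged cancels the frequency n - m. *)
Lemma cs_mul n m (x : R) (c s d t : R) :
  (c * cs n x + s * sn n x) * (t * cs m x - d * sn m x) +
  (d * cs m x + t * sn m x) * (c * sn n x * (-1) + s * cs n x) =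
  (c * t + s * d) * cs (n + m) x - (c * d - s * t) * sn (n + m) x.
Proof. by rewrite /cs /sn natrD [(_ + _) * x]mulrDl cosD sinD; ring. Qed.

(** The two trigonometric polynomials are the half-Laplacian and the derivative of [S f N]. *)
Lemma bqE X N f : L2 X -> bq X N f f =
  ip (fun x => trig_poly (fun n => n%:R * cf f n) (fun n => n%:R * sf f n) N x *
    trig_poly (fun n => n%:R * sf f n) (fun n => - (n%:R * cf f n)) N x) X.
Proof.
move=> LX.
pose F n m : R -> R := (2^-1 * ((kap n * n%:R) * (kap m * m%:R))) *:
  ((cf f n * sf f m + sf f n * cf f m) *: cs (n + m) -
    (cf f n * cf f m - sf f n * sf f m) *: sn (n + m)).
have LF n m : L2 (F n m) by apply/L2Z/L2B; apply: L2Z; [exact: L2_cs|exact: L2_sn].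
have -> : (fun x => trig_poly (fun n => n%:R * cf f n) (fun n => n%:R * sf f n) N x *
    trig_poly (fun n => n%:R * sf f n) (fun n => - (n%:R * cf f n)) N x) =
    \sum_(n < N) \sum_(m < N) F n m.
  apply/funext => x; rewrite !trig_polyE fct_sumE.
  under [RHS]eq_bigr do rewrite fct_sumE.
  rewrite big_distrlr /=.
  transitivity (2^-1 * \sum_(n < N) \sum_(m < N)
    ((kap n * n%:R) * (kap m * m%:R) *
       ((cf f n * sf f m + sf f n * cf f m) * cs (n + m) x -
        (cf f n * cf f m - sf f n * sf f m) * sn (n + m) x))); last first.
    rewrite mulr_sumr; apply: eq_bigr => n _; rewrite mulr_sumr; apply: eq_bigr => m _.
    by rewrite /F !fctE /GRing.scale /= !mulrA.
  under [in RHS]eq_bigr => n _ do under eq_bigr => m _ do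
    rewrite -(cs_mul n m x (cf f n) (sf f n) (cf f m) (sf f m)) mulrDr.
  under [in RHS]eq_bigr do rewrite big_split /=.
  rewrite big_split /= [X in _ + X]exchange_big /= -big_split /= mulr_sumr.
  apply: eq_bigr => n _; rewrite -big_split /= mulr_sumr; apply: eq_bigr => m _.
  by field.
rewrite ip_suml//; last by move=> i; exact: L2_sum.
rewrite /bq mulr_sumr; apply: eq_bigr => n _.
rewrite ip_suml// mulr_sumr; apply: eq_bigr => m _.
have Lc := @L2_cs R (n + m); have Ls := @L2_sn R (n + m).
rewrite ipZl//; last by apply: L2B; exact: L2Z.
rewrite ipBl//; try exact: L2Z.
by rewrite !ipZl// /cf /sf ![ip X _]ipC; ring.
Qed.

Lemma sum_cauchy_schwarz N (u v : nat -> R) :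
  (\sum_(n < N) u n * v n) ^+ 2 <= (\sum_(n < N) u n ^+ 2) * (\sum_(n < N) v n ^+ 2).
Proof.
elim: N => [|N IH]; first by rewrite !big_ord0 expr0n mulr0.
rewrite !big_ord_recr /=; move: IH.
set A := \sum_(n < N) u n ^+ 2; set B := \sum_(n < N) v n ^+ 2.
set C := \sum_(n < N) _; move=> IH.
have A0 : 0 <= A by apply: sumr_ge0 => n _; exact: sqr_ge0.
have B0 : 0 <= B by apply: sumr_ge0 => n _; exact: sqr_ge0.
suff : 2 * (C * (u N * v N)) <= A * v N ^+ 2 + B * u N ^+ 2.
  by rewrite sqrrD mulrDl !mulrDr exprMn; lra.
have A1 := mulr_ge0 A0 (sqr_ge0 (v N)); have B1 := mulr_ge0 B0 (sqr_ge0 (u N)).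
apply: le_trans (ler_norm _) _; rewrite -ler_sqr ?nnegrE ?addr_ge0//.
rewrite real_normK ?num_real//.
apply: (@le_trans _ _ (4 * (A * B) * (u N * v N) ^+ 2)).
  rewrite !exprMn; have -> : 2 ^+ 2 = 4 :> R by ring.
  by have := ler_wpM2r (mulr_ge0 (sqr_ge0 (u N)) (sqr_ge0 (v N))) IH; lra.
rewrite -subr_ge0 (_ : _ - _ = (A * v N ^+ 2 - B * u N ^+ 2) ^+ 2) ?sqr_ge0//.
by ring.
Qed.

(** The sum that remains once the decay of X has turned the weight n into 1 / n; its term n = 0 is 0
    because [0^-1 = 0]. *)
Definition rho N f : R := \sum_(n < N) (`|cf f n| + `|sf f n|) / n%:R.

Lemma rho_ge0 N f : 0 <= rho N f.
Proof. by apply: sumr_ge0 => n _; rewrite divr_ge0// addr_ge0. Qed.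

(** Comparison with the telescoping bound 2 - 1 / n; the term of index 0 is 0. *)
Lemma sum_inv_sqr N : \sum_(n < N) (n%:R^-1 : R) ^+ 2 <= 2.
Proof.
case: N => [|[|N]]; first by rewrite big_ord0.
  by rewrite big_ord_recl big_ord0 invr0 expr0n addr0.
apply: (@le_trans _ _ (2 - N.+1%:R^-1)); last by rewrite lerBlDr lerDl invr_ge0.
elim: N => [|N IH].
  by rewrite !big_ord_recl big_ord0 invr0 expr0n addr0 add0r invr1 expr1n; lra.
rewrite big_ord_recr /=; apply: le_trans (lerD IH (lexx _)) _.
have n1 : (0 : R) < N.+1%:R by rewrite ltr0n.
rewrite -[N.+2%:R]natr1; set b := N.+1%:R in n1 *.
have -> : 2 - (b + 1)^-1 = 2 - b^-1 + b^-1 * (b + 1)^-1.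
  by field; rewrite !gt_eqF// addr_gt0.
rewrite lerD2l expr2 ler_wpM2r ?invr_ge0 ?addr_ge0 ?(ltW n1)//.
by rewrite lef_pV2 ?posrE ?addr_gt0// lerDl.
Qed.

Lemma kap_ge n : 1 <= pi *+ 2 * kap n :> R.
Proof.
have pi0 := @pi_gt0 R; rewrite /kap; case: ifP => _.
  by rewrite mulfV// lt0r_neq0// twopi_gt0.
by rewrite ler_pdivlMr// mul1r mulr2n lerDl ltW.
Qed.

Lemma kap_le1 n : kap n <= 1 :> R.
Proof.
have p1 : 1 <= pi :> R by apply: le_trans (pi_ge2 R); rewrite ler1n.
rewrite /kap; case: ifP => _; rewrite invf_le1 ?twopi_gt0 ?pi_gt0//.
by rewrite mulr2n (le_trans p1)// lerDl pi_ge0.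
Qed.

Lemma rho_le N f : L2 f -> rho N f <= 4 * Num.sqrt pi * nrm f.
Proof.
move=> Lf; rewrite -ler_sqr ?nnegrE ?rho_ge0 ?mulr_ge0 ?sqrtr_ge0 ?nrm_ge0//.
rewrite !exprMn sqr_nrm sqr_sqrtr ?pi_ge0//.
apply: le_trans (sum_cauchy_schwarz N (fun n => `|cf f n| + `|sf f n|) (fun n => n%:R^-1)) _.
apply: (@le_trans _ _ ((2 * (pi *+ 2) * ip f f) * 2)); last first.
  have := mulr_ge0 (@pi_ge0 R) (ip_ge0 f); rewrite -[pi *+ 2]mulr_natl; lra.
apply: ler_pM; rewrite ?sum_inv_sqr//; try by apply: sumr_ge0 => n _; exact: sqr_ge0.
apply: le_trans (ler_wpM2l _ (bessel N Lf)); last by rewrite mulr_ge0// ltW// twopi_gt0.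
rewrite /pars mulr_sumr; apply: ler_sum => n _; rewrite -!expr2.
set c := cf f n; set s := sf f n.
apply: (@le_trans _ _ (2 * (c ^+ 2 + s ^+ 2))).
  rewrite -[in leRHS](real_normK (num_real c)) -[in leRHS](real_normK (num_real s)).
  by have := sqr_ge0 (`|c| - `|s|); lra.
rewrite -!mulrA ler_pM2l// mulrA ler_peMl ?kap_ge//.
by rewrite addr_ge0 ?sqr_ge0.
Qed.

(** As (n m)^2 <= (n + m)^4, fourth-order decay of the coefficients of X turns the weight n m into
    at most K / (n m). The double sum then splits into [rho N f * rho N g], and [rho_le] gives the
    constant (4 sqrt pi)^2 = 16 pi. *)
Lemma bq_le X (K : R) N f g : L2 f -> L2 g ->
  (forall n, n%:R ^+ 4 * `|cf X n| <= K /\ n%:R ^+ 4 * `|sf X n| <= K) ->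
  `|bq X N f g| <= 16 * pi * K * (nrm f * nrm g).
Proof.
move=> Lf Lg HK.
have K0 : 0 <= K by have [] := HK 0%N; rewrite expr0n mul0r.
apply: (@le_trans _ _ (K * (rho N f * rho N g))); last first.
  rewrite [16 * _ * K]mulrC -mulrA ler_wpM2l//.
  have -> : 16 * pi * (nrm f * nrm g) = (4 * Num.sqrt pi * nrm f) * (4 * Num.sqrt pi * nrm g).
    by rewrite -[pi in LHS](sqr_sqrtr (@pi_ge0 R)); ring.
  by apply: ler_pM; rewrite ?rho_ge0 ?rho_le.
rewrite /bq normrM ger0_norm ?invr_ge0//.
apply: (@le_trans _ _ (2^-1 * \sum_(n < N) \sum_(m < N)
  2 * K * ((`|cf f n| + `|sf f n|) / n%:R * ((`|cf g m| + `|sf g m|) / m%:R)))); last first.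
  under eq_bigr do rewrite -mulr_sumr -mulr_sumr.
  by rewrite -mulr_sumr -mulr_suml /rho; lra.
rewrite ler_pM2l ?invr_gt0//; apply: le_trans (ler_norm_sum _ _ _) _.
apply: ler_sum => n _; apply: le_trans (ler_norm_sum _ _ _) _; apply: ler_sum => m _.
have A0 (h : R -> R) j : 0 <= `|cf h j| + `|sf h j| by rewrite addr_ge0.
have aa := A0 f n; have bb := A0 g m.
have fg0 : 0 <= 2 * K * ((`|cf f n| + `|sf f n|) / n%:R * ((`|cf g m| + `|sf g m|) / m%:R)).
  by rewrite !mulr_ge0 ?invr_ge0.
have [n0|n0] := eqVneq (n%:R : R) 0; first by move: fg0; rewrite n0 mulr0 !mul0r normr0.
have [m0|m0] := eqVneq (m%:R : R) 0; first by move: fg0; rewrite m0 !mulr0 !mul0r normr0.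
have {n0}np : 0 < n%:R :> R by rewrite lt_def n0 ler0n.
have {m0}mp : 0 < m%:R :> R by rewrite lt_def m0 ler0n.
have nm4 : (n%:R * m%:R) ^+ 2 <= (n + m)%:R ^+ 4 :> R.
  rewrite (_ : (n + m)%:R ^+ 4 = ((n + m)%:R ^+ 2) ^+ 2); last by rewrite -exprM.
  rewrite ler_sqr ?nnegrE ?sqr_ge0 ?mulr_ge0// natrD.
  by have := sqr_ge0 (n%:R - m%:R : R); nra.
have nm0 : 0 < (n%:R * m%:R) ^+ 2 :> R by rewrite exprn_gt0// mulr_gt0.
have bd (c : R) : (n + m)%:R ^+ 4 * `|c| <= K -> `|c| <= K / (n%:R * m%:R) ^+ 2.
  move=> cK; rewrite ler_pdivlMr// mulrC; apply: le_trans cK.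
  by rewrite ler_wpM2r.
have [/bd HC /bd HS] := HK (n + m)%N.
move: {fg0} (cf X _) (sf X _) HC HS (cf f n) (sf f n) (cf g m) (sf g m) aa bb => C S_ HC HS c s d t a0 b0.
rewrite normrM [`|kap n * _ * _|]ger0_norm; last by rewrite !mulr_ge0 ?kap_ge0.
apply: (@le_trans _ _ (n%:R * m%:R *
    ((`|c| + `|s|) * (`|d| + `|t|) * (2 * (K / (n%:R * m%:R) ^+ 2))))); last first.
  by rewrite le_eqVlt; apply/orP; left; apply/eqP; field; rewrite !gt_eqF.
apply: ler_pM; rewrite ?mulr_ge0 ?kap_ge0//.
  by apply: ler_pM; rewrite ?mulr_ge0 ?kap_ge0//; rewrite ler_piMl ?kap_le1.
apply: le_trans (ler_normB _ _) _; rewrite !normrM.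
have h1 : `|c * t + s * d| <= (`|c| + `|s|) * (`|d| + `|t|).
  apply: le_trans (ler_normD _ _) _; rewrite !normrM.
  by have := mulr_ge0 (normr_ge0 c) (normr_ge0 d); have := mulr_ge0 (normr_ge0 s) (normr_ge0 t); lra.
have h2 : `|c * d - s * t| <= (`|c| + `|s|) * (`|d| + `|t|).
  apply: le_trans (ler_normB _ _) _; rewrite !normrM.
  by have := mulr_ge0 (normr_ge0 c) (normr_ge0 t); have := mulr_ge0 (normr_ge0 s) (normr_ge0 d); lra.
by rewrite [2 * _]mulr_natl mulr2n mulrDr; apply: lerD; apply: ler_pM.
Qed.

End form.

(** * The form on L^2 as a limit of its truncations *)

Section quadratic_form.
Context {R : realType}.
Implicit Types (f g h : R -> R) (a : R) (n m N : nat) (X : R -> R).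
Local Notation mu := (@lebesgue_measure R).
Local Notation L2 := (@circle_L2 R).

Lemma test_measurable_continuous X : continuous X ->
  measurable_fun (circle : set (measurableTypeR R)) X.
Proof. by move=> cX; apply: measurable_funTS; exact: continuous_measurable_fun. Qed.

Definition fast_decay X (K : R) :=
  forall n, n%:R ^+ 4 * `|cf X n| <= K /\ n%:R ^+ 4 * `|sf X n| <= K.

Definition qN X f N := bq X N f f.

Definition qf X f : R := limn (fun N => qN X f N).

Lemma big_ord_trunc (F : nat -> R) N M : (N <= M)%N ->
  (forall n, (N <= n)%N -> F n = 0) -> \sum_(n < M) F n = \sum_(n < N) F n.
Proof.
move=> NM F0; rewrite -(subnKC NM) big_split_ord /= [X in _ + X]big1 ?addr0//.
by move=> n _; rewrite F0// leq_addr.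
Qed.

Lemma qN_S X f N M : (N <= M)%N -> qN X (S f N) M = qN X f N.
Proof.
move=> NM; rewrite /qN /bq; congr (_ * _).
pose T n m := (kap n * n%:R) * (kap m * m%:R) *
   ((cf (S f N) n * sf (S f N) m + sf (S f N) n * cf (S f N) m) * cf X (n + m) -
    (cf (S f N) n * cf (S f N) m - sf (S f N) n * sf (S f N) m) * sf X (n + m)).
have T0 n m : ((N <= n) || (N <= m))%N -> T n m = 0.
  rewrite /T !cf_S !sf_S; case/orP; rewrite leqNgt => /negbTE ->;
    by rewrite ?mul0r ?mulr0 ?mul0r ?subr0 ?addr0 ?mul0r ?subr0 ?mulr0.
transitivity (\sum_(n < N) \sum_(m < N) T n m).
  rewrite (@big_ord_trunc (fun n => \sum_(m < M) T n m) N M NM).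
    apply: eq_bigr => n _; apply: (@big_ord_trunc (T n) N M NM) => m Nm.
    by rewrite T0// Nm orbT.
  by move=> n Nn; rewrite big1// => m _; rewrite T0// Nn.
apply: eq_bigr => n _; apply: eq_bigr => m _.
by rewrite /T !cf_S !sf_S !ltn_ord !mul1r.
Qed.

Lemma qN_dist X K f g N : fast_decay X K -> L2 f -> L2 g ->
  `|qN X f N - qN X g N| <= 16 * pi * K * (nrm (f - g) * nrm (f + g)).
Proof.
by move=> HK Lf Lg; rewrite /qN bqDB// bq_le//; [exact: L2B|exact: L2D].
Qed.

Lemma fast_decay_ge0 X K : fast_decay X K -> 0 <= K.
Proof. by move=> /(_ 0%N)[]; rewrite expr0n mul0r. Qed.

(** For M >= N the N-th truncation at [f] is the M-th one at [S f N], so L^2 continuity of the M-th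
    form, uniform in M, gives a Cauchy sequence. *)
Lemma qN_cvg X K f : fast_decay X K -> L2 f -> (fun N => qN X f N) @ \oo --> qf X f.
Proof.
move=> HK Lf; have K0 := fast_decay_ge0 HK.
have c0 : 0 <= 16 * pi * K * (2 * nrm f + 1).
  by rewrite !mulr_ge0 ?pi_ge0 ?addr_ge0 ?mulr_ge0 ?nrm_ge0.
have H N M : (N <= M)%N -> nrm (f - S f N) <= 1 ->
    `|qN X f M - qN X f N| <= 16 * pi * K * (2 * nrm f + 1) * nrm (f - S f N).
  move=> NM n1; rewrite -(@qN_S X f N M)//; have LS := L2_S f N.
  apply: le_trans (qN_dist M HK Lf LS) _; rewrite -[leRHS]mulrA.
  rewrite ler_wpM2l ?mulr_ge0 ?pi_ge0// mulrC ler_wpM2r ?nrm_ge0//.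
  have -> : f + S f N = (2 *: f) - (f - S f N).
    by apply/funext => x; rewrite !fctE /GRing.scale /=; ring.
  apply: le_trans (nrmB (L2Z 2 Lf) (L2B Lf LS)) _.
  by rewrite nrmZ// ger0_norm// lerD2l.
apply/cauchy_cvgP/cauchy_exP => e e0.
pose C := 16 * pi * K * (2 * nrm f + 1) + 1.
have C0 : 0 < C by rewrite ltr_wpDl.
have /cvgrPdist_lt/(_ (Num.min 1 (e / C))) := S_cvg Lf.
rewrite lt_min ltr01 !divr_gt0// => /(_ isT)[N _ HN].
have := HN N (leqnn _); rewrite /= sub0r normrN ger0_norm ?nrm_ge0// lt_min.
move=> /andP[/ltW n1 n2].
exists (qN X f N); exists N => // M /= NM; rewrite /ball /= distrC.
apply: le_lt_trans (H _ _ NM n1) _.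
apply: (@le_lt_trans _ _ (C * nrm (f - S f N))).
  by rewrite ler_wpM2r ?nrm_ge0// lerDl.
by move: n2; rewrite ltr_pdivlMr// mulrC.
Qed.

Lemma qf_dist X K f g : fast_decay X K -> L2 f -> L2 g ->
  `|qf X f - qf X g| <= 16 * pi * K * (nrm (f - g) * nrm (f + g)).
Proof.
move=> HK Lf Lg; have c1 := qN_cvg HK Lf; have c2 := qN_cvg HK Lg.
apply: (cvg_le_cst (cvg_norm (cvgB c1 c2))) => N; exact: qN_dist.
Qed.

Lemma qN0 X N : qN X 0 N = 0.
Proof.
have c n : cf (0 : R -> R) n = 0 by rewrite /cf ip0l.
have s n : sf (0 : R -> R) n = 0 by rewrite /sf ip0l.
rewrite /qN /bq big1 ?mulr0// => n _; rewrite big1// => m _.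
by rewrite !c !s !mul0r addr0 subr0 !mul0r subrr mulr0.
Qed.

Lemma qf_le X K f : fast_decay X K -> L2 f -> `|qf X f| <= 16 * pi * K * ip f f.
Proof.
move=> HK Lf; apply: (cvg_le_cst (cvg_norm (qN_cvg HK Lf))) => N.
by have := qN_dist N HK Lf (@L2_0 R); rewrite qN0 !subr0 addr0 -expr2 sqr_nrm.
Qed.

Lemma qN_lin X Y a f N : L2 X -> L2 Y -> qN (a *: X + Y) f N = a * qN X f N + qN Y f N.
Proof.
move=> LX LY; rewrite /qN /bq mulrCA -mulrDr; congr (_ * _).
rewrite mulr_sumr -big_split; apply: eq_bigr => n _ /=.
rewrite mulr_sumr -big_split; apply: eq_bigr => m _ /=.
by rewrite cfD ?sfD ?cfZ ?sfZ//; try exact: L2Z; ring.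
Qed.

Lemma qf_lin X Y K K' K'' a f : L2 X -> L2 Y -> L2 f ->
  fast_decay X K -> fast_decay Y K' -> fast_decay (a *: X + Y) K'' ->
  qf (a *: X + Y) f = a * qf X f + qf Y f.
Proof.
move=> LX LY Lf HX HY HXY; apply: (cvg_lim (@Rhausdorff R)).
under eq_fun do rewrite qN_lin//.
apply: cvgD; last exact: qN_cvg HY Lf.
by apply: cvgM; [exact: cvg_cst|exact: qN_cvg HX Lf].
Qed.

Definition decaying X := exists K, fast_decay X K.

Lemma decaying_lin X Y a : L2 X -> L2 Y -> decaying X -> decaying Y ->
  decaying (a *: X + Y).
Proof.
move=> LX LY [K HX] [K' HY]; exists (`|a| * K + K') => n.
have [X1 X2] := HX n; have [Y1 Y2] := HY n; have LZ := L2Z a LX.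
rewrite cfD// sfD// cfZ// sfZ//.
have n4 : 0 <= n%:R ^+ 4 :> R by rewrite exprn_ge0.
have H (c d : R) : n%:R ^+ 4 * `|c| <= K -> n%:R ^+ 4 * `|d| <= K' ->
    n%:R ^+ 4 * `|a * c + d| <= `|a| * K + K'.
  move=> cK dK; apply: le_trans (ler_wpM2l n4 (ler_normD _ _)) _.
  by rewrite normrM mulrDr mulrCA lerD// ler_wpM2l.
by split; exact: H.
Qed.

Lemma decaying_finite X L : (forall n, (L <= n)%N -> cf X n = 0) ->
  (forall n, (L <= n)%N -> sf X n = 0) -> decaying X.
Proof.
move=> X0 X1; pose F n : R := n%:R ^+ 4 * `|cf X n| + n%:R ^+ 4 * `|sf X n|.
have F0 n : 0 <= F n by rewrite addr_ge0 ?mulr_ge0 ?exprn_ge0.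
exists (\sum_(n < L) F n) => n; have [Ln|nL] := leqP L n.
  by rewrite X0// X1// normr0 mulr0; split; apply: sumr_ge0.
rewrite (bigD1 (Ordinal nL))//= /F.
have S0 : 0 <= \sum_(i < L | i != Ordinal nL) F i by apply: sumr_ge0.
have n4 (c : R) : 0 <= n%:R ^+ 4 * `|c| by rewrite mulr_ge0 ?exprn_ge0.
by have := n4 (cf X n); have := n4 (sf X n); split; rewrite /F in S0; lra.
Qed.

Lemma decaying_cs l : decaying (cs l).
Proof.
have k0 n := lt0r_neq0 (@kap_gt0 R n).
apply: (@decaying_finite _ l.+1) => n ln; last exact: ip_cs_sn.
apply: (mulfI (k0 l)); rewrite /cf ip_cs_cs mulr0.
by case: eqP ln => // ->; rewrite ltnn.
Qed.

Lemma decaying_sn l : decaying (sn l).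
Proof.
have k0 n := lt0r_neq0 (@kap_gt0 R n).
apply: (@decaying_finite _ l.+1) => n ln; first by rewrite /cf ipC ip_cs_sn.
apply: (mulfI (k0 l)); rewrite /sf ip_sn_sn mulr0.
by case: eqP ln => // ->; rewrite ltnn.
Qed.

Lemma decaying_S X L : decaying (S X L).
Proof.
by apply: (@decaying_finite _ L) => n Ln; rewrite ?cf_S ?sf_S ltnNge Ln mul0r.
Qed.

Lemma qf_add X Y a f : L2 X -> L2 Y -> L2 f -> decaying X -> decaying Y ->
  qf (a *: X + Y) f = a * qf X f + qf Y f.
Proof.
move=> LX LY Lf dX dY; have [K'' H] := decaying_lin a LX LY dX dY.
by case: dX dY => [K HX] [K' HY]; exact: qf_lin HX HY H.
Qed.

(** One order of decay beyond the four that [Q] requires makes the remainder of the Fourier series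
    of X small: cut at L + 1, its fourth-order decay constant is at most K / (L + 1). *)
Lemma trig_eq0 (Q : (R -> R) -> R) (C K : R) (X : R -> R) :
  (forall (a : R) (Y Z : R -> R), L2 Y -> L2 Z -> decaying Y -> decaying Z ->
    Q (a *: Y + Z) = a * Q Y + Q Z) ->
  (forall (Y : R -> R) M, L2 Y -> fast_decay Y M -> `|Q Y| <= C * M) ->
  L2 X -> fast_decay X K ->
  (forall n, n%:R ^+ 5 * `|cf X n| <= K /\ n%:R ^+ 5 * `|sf X n| <= K) ->
  (forall n, Q (cs n) = 0) -> (forall n, Q (sn n) = 0) -> Q X = 0.
Proof.
move=> Qadd Qle LX HX HK qc qs.
have qS L : Q (S X L) = 0.
  elim: L => [|L IH].
    rewrite /S /trig_poly big_ord0; apply/eqP; rewrite -normr_le0.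
    apply: le_trans (Qle 0 0 (@L2_0 R) _) _; last by rewrite mulr0.
    by move=> n; rewrite /cf /sf !ip0l normr0 mulr0.
  have -> : S X L.+1 = (kap L * cf X L) *: cs L + ((kap L * sf X L) *: sn L + S X L).
    rewrite /S /trig_poly big_ord_recr /= addrC scalerDr !scalerA -!addrA; congr (_ + _).
  have Lc := @L2_cs R L; have Ls := @L2_sn R L; have LSL := L2_S X L.
  have dc := decaying_cs L; have ds := decaying_sn L; have dS := decaying_S X L.
  rewrite Qadd//; [|by apply: L2D => //; exact: L2Z|exact: decaying_lin].
  by rewrite Qadd// qc qs IH !mulr0 !addr0.
have K0 : 0 <= K := fast_decay_ge0 HX.
have bd L : `|Q X| <= C * (K * L.+1%:R^-1).
  have LS := L2_S X L.+1.
  have dX : decaying X by exists K.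
  have -> : Q X = Q (X - S X L.+1).
    rewrite -[X - _]addrC -scaleN1r Qadd//; last exact: decaying_S.
    by rewrite qS mulr0 add0r.
  apply: Qle; first exact: L2B.
  move=> n; rewrite cfB// sfB// cf_S sf_S.
  have n0 : (0 : R) < L.+1%:R by rewrite ltr0n.
  have [nL|Ln] := ltnP n L.+1.
    by rewrite !mul1r !subrr normr0 mulr0; rewrite mulr_ge0 ?invr_ge0.
  rewrite !mul0r !subr0; have [H1 H2] := HK n.
  have H (c : R) : n%:R ^+ 5 * `|c| <= K -> n%:R ^+ 4 * `|c| <= K / L.+1%:R.
    move=> cK; rewrite ler_pdivlMr//; apply: le_trans cK.
    have -> : n%:R ^+ 5 * `|c| = n%:R ^+ 4 * `|c| * n%:R by rewrite exprSr mulrAC.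
    rewrite ler_wpM2l ?mulr_ge0 ?exprn_ge0//.
    by rewrite ler_nat.
  by split; exact: H.
apply/eqP; rewrite -normr_le0; apply: (cvg_ge_cst _ bd).
rewrite -[X in _ --> X](_ : C * (K * 0) = 0); last by rewrite !mulr0.
apply: cvgM; first exact: cvg_cst.
by apply: cvgM; [exact: cvg_cst|exact: cvg_harmonic].
Qed.

Lemma coef_deriv v v' n : (forall x, is_derive x (1 : R) v (v' x)) -> continuous v' ->
  periodic v (pi *+ 2) -> cf v' n = n%:R * sf v n /\ sf v' n = - (n%:R * cf v n).
Proof.
move=> dv cv' pv; have cv := is_derive_continuous dv.
have [_ pc] : smooth (fun x : R => cos (n%:Z%:~R * x)) /\ periodic (fun x : R => cos (n%:Z%:~R * x)) (pi *+ 2).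
  by have := cosn_smooth_circle (R := R) n; rewrite inE.
have [_ ps] : smooth (fun x : R => sin (n%:Z%:~R * x)) /\ periodic (fun x : R => sin (n%:Z%:~R * x)) (pi *+ 2).
  by have := sinn_smooth_circle (R := R) n; rewrite inE.
have dc (x : R) : is_derive x (1 : R) (cs n) ((- n%:R *: sn n) x).
  by have := is_derive_cosM n%:R x; rewrite fctE /GRing.scale /= mulNr.
have ds (x : R) : is_derive x (1 : R) (sn n) ((n%:R *: cs n) x).
  exact: is_derive_sinM n%:R x.
have cc : continuous ((- n%:R : R) *: sn n).
  by move=> x; apply: cvgZl_tmp; exact: continuous_sinM.
have cS : continuous ((n%:R : R) *: cs n).
  by move=> x; apply: cvgZl_tmp; exact: continuous_cosM.
have Lv := continuous_L2 cv.
split.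
  have := circle_by_parts dv cv' pv dc cc pc.
  rewrite ipZr//; last exact: L2_sn.
  by rewrite mulNr => /(@oppr_inj R) H; exact: esym H.
have := circle_by_parts dv cv' pv ds cS ps.
rewrite ipZr//; last exact: L2_cs.
by move=> H; rewrite -[cf v n]/(ip v (cs n)) H opprK.
Qed.

(* g plays the role of the half-Laplacian of v. *)
Lemma qf_C1 v v' : (forall x, is_derive x (1 : R) v (v' x)) -> continuous v' ->
  periodic v (pi *+ 2) ->
  exists g, [/\ L2 g, forall n, cf g n = n%:R * cf v n, forall n, sf g n = n%:R * sf v n &
    ip g g <= ip v' v'].
Proof.
move=> dv cv' pv; have Lv' := continuous_L2 cv'.
have [||g [Lg gc gs gl]] := @riesz_fischer R (fun n => n%:R * cf v n)
  (fun n => n%:R * sf v n) (ip v' v').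
- by rewrite mul0r.
- have <- : (fun N => pars N v' v') = (fun N => \sum_(n < N)
      kap n * ((n%:R * cf v n) ^+ 2 + (n%:R * sf v n) ^+ 2)).
    apply/funext => N; apply: eq_bigr => n _.
    by have [-> ->] := coef_deriv n dv cv' pv; ring.
  exact: parseval.
by exists g.
Qed.

(** Identifies the abstract form with the integral of |D|v v' X when v is C^1. The truncation [qN]
    pairs [S g N] with [S v' N] times X, and both partial sums converge in L^2. *)
Lemma qf_pairing v v' g X K : (forall x, is_derive x (1 : R) v (v' x)) -> continuous v' ->
  periodic v (pi *+ 2) -> L2 g -> (forall n, cf g n = n%:R * cf v n) ->
  (forall n, sf g n = n%:R * sf v n) -> fast_decay X K -> continuous X ->
  qf X v = ip g (fun x => v' x * X x).
Proof.
move=> dv cv' pv Lg gc gs HX cX.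
have Lv' := continuous_L2 cv'; have LX := continuous_L2 cX.
have Lv := continuous_L2 (is_derive_continuous dv).
have [M [M0 XM]] : exists M : R, 0 <= M /\ forall x, circle x -> `|X x| <= M.
  have /compact_bounded[M [_ h]] : compact (X @` (circle : set R)).
    apply: continuous_compact; last exact: segment_compact.
    exact: continuous_subspaceT.
  exists (`|M| + 1); split; first by rewrite addr_ge0.
  by move=> x cx; apply: h; [rewrite ltr_pwDr// ler_norm|exists x].
have mX := test_measurable_continuous cX.
have LmX h : L2 h -> L2 (fun x => h x * X x) by move=> Lh; exact: L2_mulb XM.
have nX h : L2 h -> nrm (fun x => h x * X x) <= M * nrm h.
  by move=> Lh; exact: nrm_mulb.
have E N : qN X v N = ip (S g N) (fun x => S v' N x * X x).
  rewrite /qN bqE//; apply: eq_Rintegral => x _; rewrite mulrA; congr (_ * _ * _).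
    by rewrite /S !trig_polyE; apply: eq_bigr => n _; rewrite gc gs.
  rewrite /S !trig_polyE; apply: eq_bigr => n _.
  by have [-> ->] := coef_deriv n dv cv' pv.
apply: (cvg_lim (@Rhausdorff R)).
have cg := S_cvg Lg; have cv2 := S_cvg Lv'.
have b0 : (fun N => nrm (g - S g N) * (M * nrm v') +
    (nrm g + nrm (g - S g N)) * (M * nrm (v' - S v' N))) @ \oo --> (0 : R).
  have -> : (0 : R) = 0 * (M * nrm v') + (nrm g + 0) * (M * 0).
    by rewrite mul0r !mulr0 addr0.
  move: (nrm v') (nrm g) cg cv2 => c d cg cv2.
  apply: cvgD; first exact: cvgM cg (cvg_cst _).
  apply: cvgM; first exact: cvgD (cvg_cst _) cg.
  exact: cvgM (cvg_cst _) cv2.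
have D : (fun N => ip g (fun x => v' x * X x) - qN X v N) @ \oo --> (0 : R).
  apply: (cvg0_le _ b0) => N; rewrite E.
  have LS := L2_S g N; have LS' := L2_S v' N.
  have Ld := L2B Lg LS; have Ld' := L2B Lv' LS'.
  have -> : ip g (fun x => v' x * X x) - ip (S g N) (fun x => S v' N x * X x) =
    ip (g - S g N) (fun x => v' x * X x) +
    ip (S g N) (fun x => (v' - S v' N) x * X x).
    have -> : (fun x => (v' - S v' N) x * X x) =
        (fun x => v' x * X x) - (fun x => S v' N x * X x).
      by apply/funext => x; rewrite !fctE mulrBl.
    have L1 := LmX _ Lv'; have L3 := LmX _ LS'.
    by rewrite ipBr// ipBl//; ring.
  apply: le_trans (ler_normD _ _) _; apply: lerD.
    apply: le_trans (ip_le Ld (LmX _ Lv')) _.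
    by rewrite ler_wpM2l ?nrm_ge0// nX.
  apply: le_trans (ip_le LS (LmX _ Ld')) _.
  apply: ler_pM; rewrite ?nrm_ge0 ?nX//.
  have {1}-> : S g N = g - (g - S g N) by apply/funext => x; rewrite !fctE; ring.
  exact: nrmB.
rewrite (_ : (fun N => qN X v N) = (fun N => ip g (fun x => v' x * X x) -
   (ip g (fun x => v' x * X x) - qN X v N))); last by apply/funext => N; ring.
by rewrite -[X in _ --> X]subr0; apply: cvgB => //; exact: cvg_cst.
Qed.

End quadratic_form.

(** * Flows *)

Section calculus.
Context {R : realType}.
Implicit Types (f g F G : R -> R) (a b x y t : R).
Local Notation mu := (@lebesgue_measure R).

Lemma mvt F f a b : a <= b -> (forall x, a <= x <= b -> is_derive x (1 : R) F (f x)) ->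
  exists2 c, a <= c <= b & F b - F a = f c * (b - a).
Proof.
move=> ab dF; have [x||c] := @MVT_segment R F f a b ab.
- by rewrite in_itv /= => /andP[/ltW ax /ltW xb]; apply: dF; rewrite ax.
- apply: derivable_within_continuous => x; rewrite in_itv /= => xab.
  by have [] := dF _ xab.
by rewrite in_itv => cab ->; exists c.
Qed.

Lemma mvt_le F f (M : R) a b : (forall x, Num.min a b <= x <= Num.max a b ->
    is_derive x (1 : R) F (f x) /\ `|f x| <= M) ->
  `|F b - F a| <= M * `|b - a|.
Proof.
wlog ab : a b / a <= b => [H|].
  case/orP: (le_total a b); first exact: H.
  by move=> ba H1; rewrite distrC [`|b - a|]distrC; apply: H => //; rewrite minC maxC.
rewrite min_l// max_r// => H.
have [|c cab ->] := @mvt F f a b ab; first by move=> x /H[].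
by rewrite normrM ler_wpM2r//; have [] := H _ cab.
Qed.

Lemma is_derive_lipschitz F f (M : R) : (forall x, is_derive x (1 : R) F (f x)) ->
  (forall x, `|f x| <= M) -> forall a b, `|F b - F a| <= M * `|b - a|.
Proof. by move=> dF fM a b; apply: (@mvt_le F f) => x _; split. Qed.

Lemma taylor2 F f (M : R) a b : (forall x, is_derive x (1 : R) F (f x)) ->
  (forall x y, `|f y - f x| <= M * `|y - x|) ->
  `|F b - F a - f a * (b - a)| <= M * (b - a) ^+ 2.
Proof.
move=> dF fM.
have M0 : 0 <= M by have := fM 0 1; rewrite subr0 normr1 mulr1; apply: le_trans.
have -> : F b - F a - f a * (b - a) = (F b - f a * b) - (F a - f a * a) by ring.
rewrite -[X in _ <= M * X]real_normK ?num_real// expr2 mulrA.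
apply: (@mvt_le (fun x => F x - f a * x) (fun x => f x - f a)) => x xab; split.
  exact: is_deriveB (dF x) (is_derive_mull _ _).
apply: le_trans (fM _ _) _; rewrite ler_wpM2l//.
move: xab; rewrite ge_min le_max ler_norml => /andP[/orP[h|h] /orP[h'|h']];
  have := ler_norm (b - a); have := ler_norm (a - b); rewrite [`|a - b|]distrC => ? ?;
  by apply/andP; split; lra.
Qed.

Lemma near_dist x (d : R) : 0 < d -> \forall y \near x, `|x - y| < d.
Proof. exact: nbhsx_ballx. Qed.

Lemma is_derive_quadratic f x (a C : R) :
  (forall y, `|f y - f x - (y - x) * a| <= C * (y - x) ^+ 2) -> is_derive x (1 : R) f a.
Proof.
move=> H; apply/is_derive1_caratheodory.
exists (fun z => if z == x then a else (f z - f x) / (z - x)); split.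
- move=> z; case: eqVneq => [->|zx]; first by rewrite !subrr mulr0.
  by rewrite divfK// subr_eq0.
- apply/cvgrPdist_le => e e0; rewrite eqxx.
  near=> z; case: eqVneq => [_|zx]; first by rewrite subrr normr0 ltW.
  have zx0 : z - x != 0 by rewrite subr_eq0.
  have zp : 0 < `|z - x| by rewrite normr_gt0.
  rewrite distrC (_ : _ / _ - a = (f z - f x - (z - x) * a) / (z - x)); last by field.
  rewrite normrM normfV ler_pdivrMr//; apply: le_trans (H z) _.
  rewrite -real_normK ?num_real// expr2 mulrA ler_wpM2r//.
  have C1 : 0 < `|C| + 1 by rewrite ltr_wpDl.
  apply: (@le_trans _ _ ((`|C| + 1) * `|z - x|)).
    by rewrite ler_wpM2r// (le_trans (ler_norm C))// lerDl.
  rewrite mulrC -ler_pdivlMr// distrC; apply: ltW; near: z.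
  by apply: near_dist; rewrite divr_gt0.
- by rewrite eqxx.
Unshelve. all: end_near. Qed.

Lemma antiderivative f (T : R) : continuous f -> 0 < T ->
  exists G, G 0 = 0 /\ forall t, - T < t < T -> is_derive t (1 : R) G (f t).
Proof.
move=> cf T0; pose F (x : R) := \int[mu]_(t in `[- T, x]) f t.
exists (fun x => F x - F 0); split; first by rewrite subrr.
move=> t /andP[Tt tT].
have fi : mu.-integrable `[- T, T] (EFin \o f).
  apply: continuous_compact_integrable; first exact: segment_compact.
  exact: continuous_subspaceT.
have [dF F't] := continuous_FTC1_closed tT fi Tt (cf t).
have D : is_derive t (1 : R) F (f t) by split; rewrite -?derive1E.
by have := is_deriveB D (is_derive_cst (F 0) t 1); rewrite subr0.
Qed.

Lemma is_derive_expRM (G : R -> R) (g c t : R) : is_derive t (1 : R) G g ->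
  is_derive t (1 : R) (fun s => expR (c * G s)) (c * g * expR (c * G t)).
Proof.
move=> dG; have d1 : is_derive t (1 : R) (fun s => c * G s) (c * g).
  have := is_deriveZ c dG; exact.
have := @is_derive1_comp _ expR (fun s => c * G s) t _ _ (is_derive_expR (c * G t)) d1.
by rewrite mulrC.
Qed.

Lemma lipschitz_continuous f (C : R) : (forall x y, `|f x - f y| <= C * `|x - y|) ->
  continuous f.
Proof.
move=> fC x; apply/cvgrPdist_le => e e0; near=> y.
apply: le_trans (fC x y) _; apply: (@le_trans _ _ ((`|C| + 1) * `|x - y|)).
  by rewrite ler_wpM2r// (le_trans (ler_norm C))// lerDl.
have C1 : 0 < `|C| + 1 by rewrite ltr_wpDl.
rewrite mulrC -ler_pdivlMr//; apply: ltW; near: y.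
by apply: near_dist; rewrite divr_gt0.
Unshelve. all: end_near. Qed.

Lemma is_derive_mul (F G : R -> R) (f g t : R) : is_derive t (1 : R) F f ->
  is_derive t (1 : R) G g -> is_derive t (1 : R) (fun s => F s * G s) (F t * g + f * G t).
Proof.
move=> dF dG; have := is_deriveM dF dG.
by rewrite /GRing.scale /= [G t * f]mulrC.
Qed.

Lemma is_derive_comp_shift f (f' c x : R) : is_derive (x + c) (1 : R) f f' ->
  is_derive x (1 : R) (fun y => f (y + c)) f'.
Proof.
move=> df; have ds : is_derive x (1 : R) (fun y => y + c) 1.
  by have := is_deriveD (is_derive_id x 1) (is_derive_cst c x 1); rewrite addr0.
by have := @is_derive1_comp _ f (fun y => y + c) _ _ _ df ds; rewrite mulr1.
Qed.

Lemma is_derive_comp_opp f (f' x : R) : is_derive (- x) (1 : R) f f' ->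
  is_derive x (1 : R) (fun y => f (- y)) (- f').
Proof.
move=> df; have ds : is_derive x (1 : R) (fun y => - y) (-1).
  exact: is_deriveN (is_derive_id x 1).
by have := @is_derive1_comp _ f (fun y => - y) _ _ _ df ds; rewrite mulrN1.
Qed.

(** The function D^2 e^(-2Lt) is nonincreasing; squaring avoids differentiating an absolute
    value. *)
Lemma gronwall_ge0 (D D' : R -> R) (L : R) : (forall t, is_derive t (1 : R) D (D' t)) ->
  (forall t, `|D' t| <= L * `|D t|) -> forall t, 0 <= t -> `|D t| <= expR (L * t) * `|D 0|.
Proof.
move=> dD DL t t0.
have [|c _] := @mvt (fun s => D s * D s * expR (- (2 * L) * s))
  (fun s => (D s * D s) * (- (2 * L) * 1 * expR (- (2 * L) * s)) +
    (D s * D' s + D' s * D s) * expR (- (2 * L) * s)) 0 t t0.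
  move=> s _; apply: is_derive_mul; first exact: is_derive_mul.
  exact: is_derive_expRM (is_derive_id s 1).
rewrite mulr0 expR0 mulr1 subr0 => E.
have H : D t * D t * expR (- (2 * L) * t) <= D 0 * D 0.
  rewrite -subr_le0 E; apply: mulr_le0_ge0 => //.
  rewrite mulr1 mulrA -mulrDl; apply: mulr_le0_ge0; last exact: expR_ge0.
  have h1 : D c * D' c <= `|D c| * (L * `|D c|).
    by apply: le_trans (ler_norm _) _; rewrite normrM ler_wpM2l.
  have h2 : `|D c| * `|D c| = D c * D c by rewrite -normrM ger0_norm// -expr2 sqr_ge0.
  by move: h1; rewrite mulrCA h2; lra.
rewrite -ler_sqr ?nnegrE ?mulr_ge0 ?expR_ge0// exprMn !real_normK ?num_real//.
rewrite !expr2 -expRD; have e0 := expR_gt0 (L * t + L * t).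
rewrite -ler_pdivrMl//; apply: le_trans H; rewrite -expRN mulrC.
by rewrite (_ : - (L * t + L * t) = - (2 * L) * t)//; ring.
Qed.

Lemma gronwall (D D' : R -> R) (L : R) : (forall t, is_derive t (1 : R) D (D' t)) ->
  (forall t, `|D' t| <= L * `|D t|) -> forall t, `|D t| <= expR (L * `|t|) * `|D 0|.
Proof.
move=> dD DL t; have [t0|/ltW t0] := leP 0 t.
  by rewrite (ger0_norm t0); exact: (gronwall_ge0 dD DL t0).
rewrite (ler0_norm t0); have t1 : 0 <= - t by rewrite oppr_ge0.
have := @gronwall_ge0 (fun s => D (- s)) (fun s => - D' (- s)) L _ _ _ t1.
rewrite opprK oppr0; apply.
- by move=> s; apply: is_derive_comp_opp.
- by move=> s; rewrite normrN.
Qed.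

End calculus.

(** * Regularity of a flow in the space variable *)

Section flow.
Context {R : realType}.
Variables (X X' : R -> R) (L M : R) (phi : R -> R -> R).
Hypothesis dX : forall x, is_derive x (1 : R) X (X' x).
Hypothesis XL : forall x, `|X' x| <= L.
Hypothesis XM : forall x y, `|X' y - X' x| <= M * `|y - x|.
Hypothesis pX : periodic X (pi *+ 2).
Hypothesis phi0 : forall x, phi 0 x = x.
Hypothesis dphi : forall x t, is_derive t (1 : R) (phi ^~ x) (X (phi t x)).

Let L0 : 0 <= L. Proof. exact: le_trans (XL 0). Qed.
Let M0 : 0 <= M.
Proof. by have := XM 0 1; rewrite subr0 normr1 mulr1; apply: le_trans. Qed.

Lemma ode_lipschitz (y z : R -> R) : (forall t, is_derive t (1 : R) y (X (y t))) ->
  (forall t, is_derive t (1 : R) z (X (z t))) ->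
  forall t, `|y t - z t| <= expR (L * `|t|) * `|y 0 - z 0|.
Proof.
move=> dy dz; apply: (@gronwall _ (fun t => y t - z t) (fun t => X (y t) - X (z t))) => t.
exact: is_derive_lipschitz dX XL _ _.
Qed.

Lemma ode_unique (y z : R -> R) : (forall t, is_derive t (1 : R) y (X (y t))) ->
  (forall t, is_derive t (1 : R) z (X (z t))) -> y 0 = z 0 -> forall t, y t = z t.
Proof.
move=> dy dz yz t; have := ode_lipschitz dy dz t.
by rewrite yz subrr normr0 mulr0 normr_le0 subr_eq0 => /eqP.
Qed.

Lemma flow_lipschitz t x y : `|phi t x - phi t y| <= expR (L * `|t|) * `|x - y|.
Proof. by have := ode_lipschitz (dphi x) (dphi y) t; rewrite !phi0. Qed.

Lemma flow_shift t x : phi t (x + pi *+ 2) = phi t x + pi *+ 2.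
Proof.
apply: (@ode_unique (phi ^~ (x + pi *+ 2)) (fun s => phi s x + pi *+ 2)).
- move=> s; rewrite pX; have := is_deriveD (dphi x s) (is_derive_cst (pi *+ 2 : R) s 1).
  by rewrite addr0.
- by rewrite !phi0.
Qed.

Lemma flow_add s t x : phi s (phi t x) = phi (s + t) x.
Proof.
apply: (@ode_unique (phi ^~ (phi t x)) (fun s => phi (s + t) x)).
- by move=> r; apply: (@is_derive_comp_shift _ (phi ^~ x)); exact: dphi.
- by rewrite phi0 add0r.
Qed.

Lemma flow_cancel t x : phi (- t) (phi t x) = x.
Proof. by rewrite flow_add addNr phi0. Qed.

Lemma flow_cancel' t x : phi t (phi (- t) x) = x.
Proof. by rewrite flow_add subrr phi0. Qed.

Lemma flow_continuous_space t : continuous (phi t).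
Proof. exact: lipschitz_continuous (flow_lipschitz t). Qed.

(** Trajectories do not cross: a change of order would make them meet at some time, and running the
    flow back from there would identify the starting points. *)
Lemma flow_homo t x y : x <= y -> phi t x <= phi t y.
Proof.
move=> xy; rewrite leNgt; apply/negP => lt_yx.
pose D s := phi s y - phi s x.
have cD : continuous D.
  by move=> s; apply: cvgB; exact: is_derive_continuous (dphi _) s.
have D0 : 0 <= D 0 by rewrite /D !phi0 subr_ge0.
have Dt : D t < 0 by rewrite /D subr_lt0.
have [s sD] : exists s, D s = 0.
  case/orP: (le_total 0 t) => t0.
    have [|s _ <-] := @IVT R D 0 t 0 t0 (continuous_subspaceT cD); last by exists s.
    by rewrite ge_min le_max D0 (ltW Dt) orbT.
  have [|s _ <-] := @IVT R D t 0 0 t0 (continuous_subspaceT cD); last by exists s.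
  by rewrite ge_min le_max D0 (ltW Dt) orbT.
have yx : y = x.
  by rewrite -(flow_cancel s y) -(flow_cancel s x); congr phi; apply/eqP; rewrite -subr_eq0 -/(D s) sD.
by move: lt_yx; rewrite yx ltxx.
Qed.

(** The space derivative is the solution exp (\int_0^t X'(phi_s x) ds) of the linearised equation;
    [G x t] is the integral in the exponent. Restricting to |t| <= 1 keeps every constant
    independent of t. *)
Lemma flow_C1 : exists w : R -> R -> R,
  [/\ forall t x, `|t| <= 1 -> is_derive x (1 : R) (phi t) (w t x),
      forall t, `|t| <= 1 -> continuous (w t),
      forall t x, `|t| <= 1 -> X (phi t x) = X x * w t x &
      forall t x, `|t| <= 1 -> `|w t x| <= expR L].
Proof.
have cX' : continuous X'.
  exact: (@lipschitz_continuous _ _ M (fun x y => XM y x)).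
have cphi x : continuous (fun t => phi t x) := is_derive_continuous (dphi x).
have cf x : continuous (fun t => X' (phi t x)).
  by move=> t; apply: (continuous_comp (cphi x t)); exact: cX'.
(* The open interval (-2, 2) leaves room for two-sided derivatives at |t| = 1. *)
have HG (x : R) : exists G : R -> R, G 0 = 0 /\
    forall t : R, - 2 < t < 2 -> is_derive t (1 : R) G (X' (phi t x)).
  by apply: antiderivative.
have [G HG'] := choice HG.
have G0 x : G x 0 = 0 by have [] := HG' x.
have dG x t : `|t| <= 1 -> is_derive t (1 : R) (G x) (X' (phi t x)).
  by have [_ H] := HG' x; rewrite ler_norml => /andP[h1 h2]; apply: H; apply/andP; split; lra.
have tle (t s : R) : `|t| <= 1 -> Num.min 0 t <= s <= Num.max 0 t -> `|s| <= 1.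
  rewrite !ler_norml ge_min le_max => /andP[h1 h2] /andP[/orP[a1|a1] /orP[a2|a2]];
    by apply/andP; split; lra.
have GL t x : `|t| <= 1 -> `|G x t| <= L.
  move=> t1; rewrite -[G x t]subr0 -(G0 x).
  apply: (@le_trans _ _ (L * `|t - 0|)); last by rewrite subr0 ler_piMr.
  apply: (@mvt_le _ (G x) (fun s => X' (phi s x))) => s st; split; last exact: XL.
  by apply: dG; exact: tle st.
have eG t x : `|t| <= 1 -> expR (G x t) <= expR L /\ expR (- G x t) <= expR L.
  by move=> /(GL t x); rewrite !ler_expR ler_norml => /andP[]; split; lra.
have est t x y : `|t| <= 1 ->
    `|phi t y - phi t x - (y - x) * expR (G x t)| <= M * expR (4 * L) * (y - x) ^+ 2.
  move=> t1.
  pose D s := phi s y - phi s x.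
  have dD s : is_derive s (1 : R) D (X (phi s y) - X (phi s x)) by exact: is_deriveB.
  have D0 : D 0 = y - x by rewrite /D !phi0.
  have e0 := expR_gt0 (G x t).
  (* The exponential factor removes the linear part of the equation for [D]: the time derivative of
     the product is the Taylor remainder of X times that factor, hence at most M (e^L |y - x|)^2
     e^L. *)
  have H : `|D t * expR (- 1 * G x t) - D 0 * expR (-1 * G x 0)| <=
      (M * expR (3 * L) * (y - x) ^+ 2) * `|t - 0|.
    apply: (@mvt_le _ (fun s => D s * expR (- 1 * G x s)) (fun s =>
      D s * (-1 * X' (phi s x) * expR (-1 * G x s)) +
      (X (phi s y) - X (phi s x)) * expR (-1 * G x s))) => s /(tle _ _ t1) s1.
    split; first by apply: is_derive_mul (dD s) _; apply: is_derive_expRM; exact: dG.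
    rewrite mulrA -mulrDl normrM [`|expR _|]ger0_norm ?expR_ge0//.
    have -> : M * expR (3 * L) * (y - x) ^+ 2 =
        (M * (expR L * `|y - x|) ^+ 2) * expR L.
      have -> : 3 * L = L + L + L by ring.
      by rewrite exprMn real_normK ?num_real// !expRD; ring.
    apply: ler_pM; rewrite ?expR_ge0//; last by rewrite mulN1r; have [] := eG s x s1.
    have -> : D s * (-1 * X' (phi s x)) + (X (phi s y) - X (phi s x)) =
      X (phi s y) - X (phi s x) - X' (phi s x) * (phi s y - phi s x) by rewrite /D; ring.
    apply: le_trans (taylor2 _ _ dX XM) _; rewrite ler_wpM2l//.
    rewrite -real_normK ?num_real// ler_sqr ?nnegrE ?mulr_ge0 ?expR_ge0//.
    apply: le_trans (flow_lipschitz _ _ _) _; rewrite ler_wpM2r// ler_expR.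
    by rewrite ler_piMr.
  have -> : phi t y - phi t x - (y - x) * expR (G x t) =
      (D t * expR (- 1 * G x t) - D 0 * expR (-1 * G x 0)) * expR (G x t).
    rewrite G0 mulr0 expR0 D0 mulN1r expRN /D; move: (expR _) e0 => w w0.
    by field; rewrite gt_eqF.
  rewrite normrM (ger0_norm (ltW e0)).
  have -> : M * expR (4 * L) * (y - x) ^+ 2 = (M * expR (3 * L) * (y - x) ^+ 2) * expR L.
    have -> : 4 * L = 3 * L + L by ring.
    by rewrite expRD; ring.
  apply: ler_pM => //; last by have [] := eG t x t1.
  apply: le_trans H _; rewrite subr0 ler_piMr//; apply: mulr_ge0; last exact: sqr_ge0.
  by rewrite mulr_ge0 ?expR_ge0.
exists (fun t x => expR (G x t)); split.
- by move=> t x t1; apply: is_derive_quadratic => y; exact: est.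
- move=> t t1; pose C := M * expR (4 * L); apply: (@lipschitz_continuous _ _ (2 * C)) => x y.
  have C0 : 0 <= C by rewrite mulr_ge0 ?expR_ge0.
  have lip : `|expR (G x t) - expR (G y t)| <= 2 * C * `|x - y|.
    have [->|xy] := eqVneq x y; first by rewrite !subrr normr0 mulr0.
    have xy0 : 0 < `|x - y| by rewrite normr_gt0 subr_eq0.
    rewrite -(ler_pM2r xy0) -normrM.
    have -> : 2 * C * `|x - y| * `|x - y| = 2 * C * (x - y) ^+ 2.
      by rewrite -[(x - y) ^+ 2]real_normK ?num_real//; ring.
    have := est t x y t1; have := est t y x t1; rewrite -/C -[(y - x) ^+ 2]sqrrN opprB.
    rewrite !ler_norml => /andP[h1 h2] /andP[h3 h4].
    by apply/andP; split; lra.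
  exact: lip.
- move=> t x t1.
  (* Along a trajectory, X and the exponential of [G] solve the same linear equation, so their
     quotient is constant. *)
  have H : `|X (phi t x) * expR (-1 * G x t) - X (phi 0 x) * expR (-1 * G x 0)| <= 0 * `|t - 0|.
    apply: (@mvt_le _ (fun s => X (phi s x) * expR (- 1 * G x s)) (fun s =>
      X (phi s x) * (-1 * X' (phi s x) * expR (-1 * G x s)) +
      (X' (phi s x) * X (phi s x)) * expR (-1 * G x s))) => s /(tle _ _ t1) s1.
    split; last by rewrite (_ : _ + _ = 0) ?normr0//; ring.
    by apply: is_derive_mul; apply: is_derive_expRM; exact: dG.
  move: H; rewrite mul0r normr_le0 G0 mulr0 expR0 mulr1 phi0 subr_eq0 => /eqP <-.
  by rewrite mulN1r expRN divfK// gt_eqF// expR_gt0.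
- by move=> t x t1; rewrite ger0_norm ?expR_ge0//; have [] := eG t x t1.
Unshelve. all: end_near. Qed.

End flow.

(** * Pushforward of Lebesgue measure by a monotone map with Lipschitz inverse *)

Section pushforward_bound.
Context {R : realType}.
Local Notation mu := (@lebesgue_measure R).
Local Notation mR := (measurableTypeR R).
Variables (phi psi : R -> R) (c : R).
Hypothesis cphi : continuous phi.
Hypothesis cpsi : continuous psi.
Hypothesis phi_psi : forall x y, (phi x <= y) = (x <= psi y).
Hypothesis psi_nd : {homo psi : x y / x <= y}.
Hypothesis psi_c : forall x y, x <= y -> psi y - psi x <= c * (y - x).

Let c0 : 0 <= c.
Proof.
have := psi_c ler01; rewrite subr0 mulr1; apply: le_trans.
by rewrite subr_ge0 psi_nd.
Qed.

(** Stieltjes function of the excess of c times Lebesgue measure over the pushforward; [psi_c] says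
    that it is nondecreasing. *)
Let f2 (x : R) : R := c * x - psi x.
Let f3 (x : R) : R := c * x.

Let f2_nd : {homo f2 : x y / x <= y}.
Proof. by move=> x y xy; rewrite /f2; have := psi_c xy; lra. Qed.

Let f3_nd : {homo f3 : x y / x <= y}.
Proof. by move=> x y xy; rewrite /f3 ler_wpM2l. Qed.

Let cf3 : continuous f3.
Proof. exact: is_derive_continuous (is_derive_mull c). Qed.

Let f2_rc : right_continuous f2.
Proof. by apply: right_continuousW => x; apply: cvgB; [exact: cf3|exact: cpsi]. Qed.

Let f3_rc : right_continuous f3.
Proof. exact: right_continuousW. Qed.

HB.instance Definition _ := isCumulative.Build R _ R f2 f2_nd f2_rc.
HB.instance Definition _ := isCumulative.Build R _ R f3 f3_nd f3_rc.

Let mphi : measurable_fun (setT : set mR) (phi : mR -> mR).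
Proof. exact: continuous_measurable_fun. Qed.

Let nu : {measure set mR -> \bar R} :=
  measure_function_pushforward__canonical__measure_function_Measure mu mphi.
Let nu2 : {measure set mR -> \bar R} := lebesgue_stieltjes_measure f2.

Let LS_oc (f : cumulative R R) a b : a <= b ->
  lebesgue_stieltjes_measure f `]a, b]%classic = (f b - f a)%:E.
Proof.
move=> ab; rewrite /lebesgue_stieltjes_measure/= /measure_extension/=.
by rewrite measurable_mu_extE/= ?wlength_itv_bnd//; exact: is_ocitv.
Qed.

Let nu_add A : measurable A -> mscale (NngNum c0) mu A = measure_add nu nu2 A.
Proof.
move=> mA; transitivity (lebesgue_stieltjes_measure f3 A).
  apply/esym/lebesgue_stieltjes_measure_unique => // X /ocitvP[->|[[a b] /= ab ->]].
    by rewrite !measure0.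
  rewrite LS_oc ?(ltW ab)// [RHS]/mscale /= lebesgue_measure_itv/= lte_fin ab.
  by rewrite -EFinB -EFinM /f3 mulrBr.
apply: lebesgue_stieltjes_measure_unique => // X /ocitvP[->|[[a b] /= ab ->]].
  by rewrite !measure0.
transitivity ((c * b - c * a)%:E); first by rewrite LS_oc ?(ltW ab).
transitivity (nu `]a, b]%classic + nu2 `]a, b]%classic)%E; last exact/esym/measure_addE.
rewrite [nu2 _]LS_oc ?(ltW ab)//.
have -> : nu `]a, b]%classic = (psi b - psi a)%:E.
  rewrite /nu /= /pushforward.
  have -> : phi @^-1` `]a, b]%classic = `]psi a, psi b]%classic.
    by apply/seteqP; split => x /=; rewrite !in_itv /= !ltNge !phi_psi.
  rewrite lebesgue_measure_itv/= lte_fin; case: ltgtP => // [h|->].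
    by have := psi_nd (ltW ab); rewrite leNgt h.
  by rewrite subrr.
transitivity ((psi b - psi a) + (f2 b - f2 a))%:E; last by [].
by congr (_%:E); rewrite /f2; ring.
Qed.

(** The pushforward gives []a, b]] the mass psi(b) - psi(a), so adding the Stieltjes measure of [f2]
    yields c times Lebesgue measure. This replaces a change of variables and uses no
    differentiability of [phi]. *)
Lemma ge0_integral_pushforward_le (h : R -> R) : (forall x, 0 <= h x) ->
  measurable_fun (setT : set mR) h ->
  (\int[mu]_x (h (phi x))%:E <= c%:E * \int[mu]_x (h x)%:E)%E.
Proof.
move=> h0 mh; have mE : measurable_fun (setT : set mR) (EFin \o h) by exact/measurable_EFinP.
have h0' (x : mR) : setT x -> (0 <= (EFin \o h) x)%E by rewrite /= lee_fin.
have -> : (c%:E * \int[mu]_x (h x)%:E = \int[mscale (NngNum c0) mu]_x (h x)%:E)%E.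
  by rewrite ge0_integral_mscale.
have -> : (\int[mscale (NngNum c0) mu]_x (h x)%:E = \int[measure_add nu nu2]_x (h x)%:E)%E.
  by apply: eq_measure_integral => A mA _; exact: nu_add.
rewrite ge0_integral_measure_add//.
have -> : (\int[mu]_x (h (phi x))%:E = \int[nu]_x (h x)%:E)%E.
  rewrite /nu ge0_integral_pushforward//.
  by move=> x _; rewrite lee_fin.
by rewrite leeDl// integral_ge0// => x _; rewrite lee_fin.
Qed.

End pushforward_bound.

(** * Periodic functions and test functions *)

Section periodic_composition.
Context {R : realType}.
Implicit Types (f g : R -> R) (x y t : R).
Local Notation mu := (@lebesgue_measure R).
Local Notation mR := (measurableTypeR R).
Local Notation L2 := (@circle_L2 R).

Definition reduce x : R := x - (pi *+ 2) * (Num.floor (x / (pi *+ 2)))%:~R.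

Lemma reduce_itv x : 0 <= reduce x < pi *+ 2.
Proof.
have := floor_itv (x / (pi *+ 2)); have p0 := @twopi_gt0 R.
rewrite intrD ler_pdivlMr// ltr_pdivrMr// /reduce.
move: (pi *+ 2) (_%:~R) => p k /andP[h1 h2]; apply/andP; split; lra.
Qed.

Lemma reduce_circle x : circle (reduce x).
Proof.
by have /andP[h1 h2] := reduce_itv x; rewrite /circle /= in_itv /= h1 ltW.
Qed.

Lemma periodicz f (z : int) x : periodic f (pi *+ 2) -> f (x + (pi *+ 2) * z%:~R) = f x.
Proof.
move=> pf; case: z => n; first by rewrite -[_%:~R]/(n%:R) mulr_natr periodicn.
by rewrite NegzE mulrNz -[_%:~R]/(n.+1%:R) mulrN mulr_natr -[LHS](periodicn pf n.+1) subrK.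
Qed.

Lemma periodic_reduce f x : periodic f (pi *+ 2) -> f (reduce x) = f x.
Proof. by move=> pf; rewrite /reduce -mulrN -mulrNz periodicz. Qed.

Lemma measurable_reduce : measurable_fun (setT : set mR) (reduce : mR -> mR).
Proof.
apply: measurable_funB => //; apply: measurable_funM => //.
apply: nondecreasing_measurable => // x y xy; rewrite ler_int.
by apply: le_floor; rewrite ler_wpM2r// invr_ge0 ltW// twopi_gt0.
Qed.

Lemma periodic_measurable f : periodic f (pi *+ 2) ->
  measurable_fun (circle : set mR) f -> measurable_fun (setT : set mR) f.
Proof.
move=> pf mf.
have m0 : measurable_fun (setT : set mR) (f \_ circle).
  by apply: (measurable_restrictT f (@measurable_circle R)).1.
have -> : f = (f \_ circle) \o reduce.
  apply/funext => x; rewrite /= patchE mem_set ?periodic_reduce//.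
  exact: reduce_circle.
by apply: measurableT_comp m0 _; exact: measurable_reduce.
Qed.

(* The image of the circle meets at most 2m+1 fundamental domains. *)
Lemma L2_comp (phi psi : R -> R) (c : R) (m : nat) f :
  continuous phi -> continuous psi ->
  (forall x y, (phi x <= y) = (x <= psi y)) -> {homo psi : x y / x <= y} ->
  (forall x y, x <= y -> psi y - psi x <= c * (y - x)) ->
  (forall x, circle x -> `|phi x| <= (pi *+ 2) * m%:R) ->
  periodic f (pi *+ 2) -> L2 f ->
  L2 (f \o phi) /\ ip (f \o phi) (f \o phi) <= c * (2 * m).+1%:R * ip f f.
Proof.
move=> cphi cpsi pp nd lip im pf Lf; have p0 := @twopi_gt0 R.
have mc := @measurable_circle R.
have mphi : measurable_fun (setT : set mR) (phi : mR -> mR) by exact: continuous_measurable_fun.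
have mf := periodic_measurable pf Lf.1.
have mfp : measurable_fun (setT : set mR) (f \o phi) by exact: measurableT_comp.
pose h : R -> R := (fun x => f x ^+ 2) \_ circle.
have h0 x : 0 <= h x by rewrite /h patchE; case: ifP => // _; rewrite sqr_ge0.
have mh : measurable_fun (setT : set mR) h.
  apply: (measurable_restrictT _ mc).1; apply: measurable_funX; exact: Lf.1.
(* Removal of i - m periods, an integer between -m and m; the index with i - m = floor (phi x / 2
   pi) brings phi x into the fundamental domain. *)
pose ph (i : nat) x := phi x + (pi *+ 2) * (m%:R - i%:R).
pose ps (i : nat) y := psi (y - (pi *+ 2) * (m%:R - i%:R)).
have ct (a : R) : continuous (fun x : R => x + a).
  by move=> x; apply: cvgD; [exact: cvg_id|exact: cvg_cst].
have cph i : continuous (ph i).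
  by move=> x; apply: cvgD; [exact: cphi|exact: cvg_cst].
have cps i : continuous (ps i).
  by move=> x; apply: (continuous_comp (ct _ x)); exact: cpsi.
have bd i : (\int[mu]_x (h (ph i x))%:E <= c%:E * (ip f f)%:E)%E.
  have <- : (\int[mu]_x (h x)%:E = (ip f f)%:E)%E.
    rewrite -(ip_EFin Lf) [RHS]integral_mkcond; apply: eq_integral => x _.
    by rewrite /h !patchE; case: ifP.
  apply: (@ge0_integral_pushforward_le _ (ph i) (ps i)) => //.
  - by move=> x y; rewrite /ph /ps -lerBrDr pp.
  - by move=> x y xy; apply: nd; rewrite lerD2r.
  - move=> x y xy; rewrite /ps; set d := _ * (_ - _).
    by have := lip (x - d) (y - d); rewrite lerD2r => /(_ xy); lra.
have mhi i : measurable_fun (setT : set mR) (fun x => (h (ph i x))%:E).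
  apply/measurable_EFinP; apply: (measurableT_comp mh).
  exact: continuous_measurable_fun.
have key x : circle x -> f (phi x) ^+ 2 <= \sum_(i < (2 * m).+1) h (ph i x).
  move=> /im xm; set z := Num.floor (phi x / (pi *+ 2)).
  have z1 := floor_itv (phi x / (pi *+ 2)); rewrite -/z in z1.
  have [i im1 zi] : exists2 i : nat, (i < (2 * m).+1)%N & z = i%:Z - m%:Z.
    have z2 : - m%:Z <= z <= m%:Z.
      move: xm; rewrite ler_norml => /andP[a1 a2].
      have b1 : - m%:R <= phi x / (pi *+ 2) by rewrite ler_pdivlMr// mulNr mulrC.
      have b2 : phi x / (pi *+ 2) <= m%:R by rewrite ler_pdivrMr// mulrC.
      apply/andP; split.
        by rewrite -ltzD1 -(ltr_int R) rmorphN /=; apply: le_lt_trans b1 _; case/andP: z1.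
      by rewrite -(ler_int R); apply: le_trans b2; case/andP: z1.
    case/andP: z2 => z2 z3.
    have z4 : 0 <= z + m%:Z by rewrite -lerBlDr sub0r.
    exists (absz (z + m%:Z)); last by rewrite gez0_abs// addrK.
    rewrite ltnS -lez_nat gez0_abs// mul2n -addnn PoszD.
    by rewrite lerD2r.
  rewrite (bigD1 (Ordinal im1))//= -[leLHS]addr0 lerD//; last by apply: sumr_ge0.
  have -> : ph i x = reduce (phi x).
    by rewrite /ph /reduce -/z zi rmorphB /= -mulrN opprB.
  rewrite /h patchE mem_set; last exact: reduce_circle.
  by rewrite periodic_reduce.
have B : (\int[mu]_(x in circle) (f (phi x) ^+ 2)%:E <= (c * (2 * m).+1%:R * ip f f)%:E)%E.
  apply: (@le_trans _ _ (\int[mu]_(x in circle) \sum_(i < (2 * m).+1) (h (ph i x))%:E)%E).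
    apply: ge0_le_integral => //.
    - by move=> x _; rewrite lee_fin sqr_ge0.
    - apply/measurable_EFinP/measurable_funX; exact: measurable_funTS.
    - by apply: emeasurable_sum => i; apply: measurable_funTS; exact: mhi.
    - by move=> x cx; rewrite sumEFin lee_fin; exact: key.
  apply: (@le_trans _ _ (\int[mu]_x \sum_(i < (2 * m).+1) (h (ph i x))%:E)%E).
    apply: ge0_subset_integral => //.
    - by apply: emeasurable_sum => i; exact: mhi.
    - by move=> x _; apply: sume_ge0 => i _; rewrite lee_fin.
  rewrite ge0_integral_sum//; last by move=> i x _; rewrite lee_fin.
  apply: (@le_trans _ _ (\sum_(i < (2 * m).+1) (c * ip f f)%:E)%E).
    by apply: lee_sum => i _; exact: bd.
  by rewrite sumEFin lee_fin sumr_const card_ord -[leLHS]mulr_natr mulrAC.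
have fi : circle_integrable (fun x => f (phi x) ^+ 2).
  apply/integrableP; split.
    by apply/measurable_EFinP/measurable_funX; exact: measurable_funTS.
  apply: le_lt_trans (ltry (c * (2 * m).+1%:R * ip f f)).
  apply: le_trans B; apply: ge0_le_integral => //.
  - apply/measurable_EFinP; apply: measurableT_comp => //; apply: measurable_funX; exact: measurable_funTS.
  - apply/measurable_EFinP; apply: measurable_funX; exact: measurable_funTS.
  - by move=> x _; rewrite /= ger0_norm ?sqr_ge0.
have Lfp : L2 (f \o phi) by split => //; exact: measurable_funTS.
by split=> //; rewrite -lee_fin -(ip_EFin Lfp).
Qed.

End periodic_composition.

(** * Bounds on test functions and decay of their coefficients *)

Section tests.
Context {R : realType}.
Implicit Types (X : test_function R) (x y : R) (n p : nat).
Local Notation mu := (@lebesgue_measure R).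
Local Notation L2 := (@circle_L2 R).

Lemma test_is_derive X p x : is_derive x (1 : R) (derive1n p X) (derive1n p.+1 X x).
Proof.
have := testP X; rewrite inE => -[/(_ p x) dX _].
by split; [exact: dX|rewrite derive1nS derive1E].
Qed.

Lemma test_derive_continuous X p : continuous (derive1n p X : R -> R).
Proof. exact: is_derive_continuous (test_is_derive X p). Qed.

Lemma test_derive_periodic X p : periodic (derive1n p X) (pi *+ 2 : R).
Proof.
elim: p => [|p IH] x; first by have := testP X; rewrite inE => -[_ /(_ x)].
have d1 := test_is_derive X p (x + pi *+ 2).
have d2 := is_derive_comp_shift d1.
have e : (fun y => derive1n p X (y + pi *+ 2)) = derive1n p X.
  by apply/funext => y; exact: IH.
have [_ <-] := d2; have [_ <-] := test_is_derive X p x.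
by rewrite e.
Qed.

Lemma test_periodic X : periodic X (pi *+ 2 : R).
Proof. exact: test_derive_periodic X 0. Qed.

Lemma sup_test_ge X p x : `|derive1n p X x| <= sup [set `|derive1n p X y| | y in circle].
Proof.
rewrite -(periodic_reduce x (test_derive_periodic X p)).
apply: ub_le_sup; last by exists (reduce x) => //; exact: reduce_circle.
have /compact_bounded[M [_ h]] : compact (derive1n p X @` (circle : set R)).
  apply: continuous_compact; last exact: segment_compact.
  exact/continuous_subspaceT/test_derive_continuous.
exists (`|M| + 1) => _ [y cy <-]; apply: h; last by exists y.
by rewrite ltr_pwDr// ler_norm.
Qed.

Lemma Cnorm_ge X N p x : (p < N)%N -> `|derive1n p X x| <= Cnorm N X.
Proof.
move=> pN; rewrite /Cnorm (bigD1 (Ordinal pN))//= -[leLHS]addr0 lerD ?sup_test_ge//.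
by apply: sumr_ge0 => i _; apply: le_trans (sup_test_ge X i 0).
Qed.

Lemma Cnorm_ge0 X N : 0 <= Cnorm N X.
Proof. by apply: sumr_ge0 => i _; apply: le_trans (sup_test_ge X i 0). Qed.

Lemma test_lipschitz X p x y :
  `|derive1n p X y - derive1n p X x| <= Cnorm p.+2 X * `|y - x|.
Proof.
apply: (is_derive_lipschitz (test_is_derive X p)) => z.
exact: Cnorm_ge.
Qed.

Lemma test_L2 X p : L2 (derive1n p X).
Proof. exact/continuous_L2/test_derive_continuous. Qed.

Lemma coef_le (f g : R -> R) (b : R) : L2 f -> L2 g -> 0 <= b -> (forall x, `|f x| <= b) ->
  (forall x, `|g x| <= 1) -> `|ip f g| <= b * (pi *+ 2).
Proof.
move=> Lf Lg b0 fb g1; apply: le_trans (ip_le Lf Lg) _.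
have -> : b * (pi *+ 2) = (b * Num.sqrt (pi *+ 2)) * (1 * Num.sqrt (pi *+ 2)).
  rewrite mul1r -mulrA -expr2 sqr_sqrtr// ltW//; exact: twopi_gt0.
by apply: ler_pM; rewrite ?nrm_ge0//; apply: nrm_le_bound.
Qed.

Lemma test_coef_decay X p n :
  n%:R ^+ p * `|cf X n| <= Cnorm p.+1 X * (pi *+ 2) /\
  n%:R ^+ p * `|sf X n| <= Cnorm p.+1 X * (pi *+ 2).
Proof.
have B : `|cf (derive1n p X) n| <= Cnorm p.+1 X * (pi *+ 2) /\
    `|sf (derive1n p X) n| <= Cnorm p.+1 X * (pi *+ 2).
  split; apply: coef_le; rewrite ?Cnorm_ge0//; try exact: test_L2; try exact: L2_cs;
    try exact: L2_sn; try (by move=> x; exact: Cnorm_ge).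
  - by move=> x; exact: cs_le1.
  - by move=> x; exact: sn_le1.
(* Each derivative multiplies by n and exchanges cosine and sine coefficients up to sign, so the two
   cases alternate with the parity of [p]. *)
have E : (`|cf (derive1n p X) n| = n%:R ^+ p * `|cf X n| /\
    `|sf (derive1n p X) n| = n%:R ^+ p * `|sf X n|) \/
    (`|cf (derive1n p X) n| = n%:R ^+ p * `|sf X n| /\
    `|sf (derive1n p X) n| = n%:R ^+ p * `|cf X n|).
  clear B; elim: p => [|p IH]; first by left; rewrite !expr0 !mul1r.
  have [-> ->] := coef_deriv n (test_is_derive X p) (@test_derive_continuous X p.+1)
    (test_derive_periodic X p).
  by rewrite normrN !normrM normr_nat; case: IH => -[-> ->]; [right|left];
    rewrite !exprS !mulrA.
by case: B; case: E => -[-> ->].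
Qed.

Lemma test_fast_decay X : fast_decay X (Cnorm 5 X * (pi *+ 2)).
Proof. by move=> n; exact: test_coef_decay. Qed.

Lemma test_decaying X : decaying X.
Proof. by exists (Cnorm 5 X * (pi *+ 2)); exact: test_fast_decay. Qed.

End tests.

(** * Energy along a flow *)

Section energy_duality.
Context {R : realType}.
Implicit Types (f g v w : R -> R) (n N : nat).
Local Notation L2 := (@circle_L2 R).

Lemma finite_energy_half v g : L2 v -> L2 g -> (forall n, cf g n = n%:R * cf v n) ->
  (forall n, sf g n = n%:R * sf v n) -> finite_energy v.
Proof.
move=> Lv Lg gc gs; split=> //; exists (ip g g) => N; apply: le_trans (bessel N Lg).
apply: ler_sum => n _; rewrite gc gs -mulrA ler_wpM2l ?kap_ge0//.
rewrite -!expr2 !exprMn -mulrDr ler_wpM2r ?addr_ge0 ?sqr_ge0// expr2 -natrM ler_nat.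
by case: (nat_of_ord n) => // k; rewrite leq_pmulr.
Qed.

(* Convexity of the energy: |a|^2 - |b|^2 <= 2 a.(a - b). *)
Lemma En_sub_le v w g : L2 v -> L2 g -> finite_energy w ->
  (forall n, cf g n = n%:R * cf v n) -> (forall n, sf g n = n%:R * sf v n) ->
  En v - En w <= 2 * ip g (v - w).
Proof.
move=> Lv Lg fw gc gs; have fv := finite_energy_half Lv Lg gc gs.
have Lw : L2 w by case: fw.
rewrite -subr_ge0; have c1 := parseval2 Lg (L2B Lv Lw).
have c2 := finite_energy_cvg fv; have c3 := finite_energy_cvg fw.
apply: (cvg_ge_cst (cvgB (cvgM (cvg_cst (2 : R)) c1) (cvgB c2 c3))) => N.
rewrite (_ : (_ - _) N = 2 * pars N g (v - w) - (enp N v - enp N w))//.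
rewrite subr_ge0 /enp /pars -sumrB mulr_sumr; apply: ler_sum => n _.
rewrite gc gs cfB// sfB// -subr_ge0.
have -> : 2 * (kap n * (n%:R * cf v n * (cf v n - cf w n) + n%:R * sf v n * (sf v n - sf w n))) -
  (kap n * n%:R * (cf v n ^+ 2 + sf v n ^+ 2) - kap n * n%:R * (cf w n ^+ 2 + sf w n ^+ 2)) =
  kap n * n%:R * ((cf v n - cf w n) ^+ 2 + (sf v n - sf w n) ^+ 2) by ring.
by rewrite !mulr_ge0 ?kap_ge0// addr_ge0 ?sqr_ge0.
Qed.

Lemma En_S_le f N : finite_energy f -> En (S f N) <= En f.
Proof.
move=> fe; apply: En_le => M; apply: le_trans (enp_le_En M fe).
apply: ler_sum => n _; rewrite cf_S sf_S; case: (_ < _)%N; rewrite ?mul1r//.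
by rewrite !mul0r expr0n addr0 mulr0 !mulr_ge0 ?kap_ge0// addr_ge0 ?sqr_ge0.
Qed.

Lemma cvg_coef (F : nat -> R -> R) f h : (forall N, L2 (F N)) -> L2 f -> L2 h ->
  nrm (F N - f) @[N --> \oo] --> 0 -> ip (F N) h @[N --> \oo] --> ip f h.
Proof.
move=> LF Lf Lh F0.
have K : (fun N => ip (F N) h - ip f h) @ \oo --> (0 : R).
  have K0 : (fun N => nrm (F N - f) * nrm h) @ \oo --> (0 : R).
    by rewrite -(mul0r (nrm h)); apply: cvgM => //; exact: cvg_cst.
  apply: (cvg0_le _ K0) => N; rewrite -ipBl//; apply: ip_le => //; exact: L2B.
rewrite (_ : (fun N => ip (F N) h) = (fun N => (ip (F N) h - ip f h) + ip f h)); last first.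
  by apply/funext => N; rewrite subrK.
by rewrite -[X in _ --> X]add0r; apply: cvgD => //; exact: cvg_cst.
Qed.

Lemma cvg_enp (F : nat -> R -> R) f M : (forall N, L2 (F N)) -> L2 f ->
  nrm (F N - f) @[N --> \oo] --> 0 -> enp M (F N) @[N --> \oo] --> enp M f.
Proof.
move=> LF Lf F0; rewrite /enp; elim: M => [|M IH].
  by rewrite big_ord0; under eq_fun do rewrite big_ord0; exact: cvg_cst.
rewrite big_ord_recr /=; under eq_fun do rewrite big_ord_recr /=.
apply: cvgD => //; apply: cvgM; first exact: cvg_cst.
by apply: cvgD; rewrite expr2; under eq_fun do rewrite expr2; apply: cvgM; apply: cvg_coef => //;
  solve [exact: L2_cs | exact: L2_sn].
Qed.

(** On n + 1 equal steps the quadratic errors add up to C t^2 / (n + 1). The conclusion is free of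
    [C], so [C] may later depend on the approximation to which the bound is applied. *)
Lemma polygon_bound (e q : R -> R) (r C a eps t : R) : `|t| <= r ->
  (forall s s', `|s| <= r -> `|s'| <= r ->
     e s' - e s <= 2 * (s' - s) * q s' + C * (s' - s) ^+ 2) ->
  (forall s, `|s| <= r -> `|q s - a| <= eps) -> e t - e 0 <= 2 * t * a + 2 * `|t| * eps.
Proof.
move=> tr He Hq.
have H n k : (k <= n.+1)%N -> e (k%:R * (t / n.+1%:R)) - e 0 <=
    k%:R * (2 * (t / n.+1%:R) * a + 2 * (`|t| / n.+1%:R) * eps + C * (t / n.+1%:R) ^+ 2).
  have n0 : (0 : R) < n.+1%:R by rewrite ltr0n.
  have inr i : (i <= n.+1)%N -> `|i%:R * (t / n.+1%:R)| <= r.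
    move=> ik; apply: le_trans tr; rewrite !normrM normr_nat normfV normr_nat.
    by rewrite mulrA ler_pdivrMr// mulrC ler_wpM2l// ler_nat.
  elim: k => [|k IH] kn; first by rewrite !mul0r subrr.
  have := He _ _ (inr _ (ltnW kn)) (inr _ kn); have := IH (ltnW kn).
  have := Hq _ (inr _ kn); rewrite -natr1 mulrDl !mul1r.
  have -> : k%:R * (t / n.+1%:R) + t / n.+1%:R - k%:R * (t / n.+1%:R) = t / n.+1%:R by ring.
  move: (_ + t / _) => s; rewrite ler_norml => /andP[q1 q2].
  have qq : (t / n.+1%:R) * (q s - a) <= `|t| / n.+1%:R * eps.
    apply: le_trans (ler_norm _) _; rewrite !normrM normfV normr_nat ler_wpM2l//.
    by rewrite ler_norml q1.
  by move: qq; move: (t / _) (`|t| / _) => d d'; lra.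
have {}H n : e t - e 0 <= 2 * t * a + 2 * `|t| * eps + C * t ^+ 2 * n.+1%:R^-1.
  have := H n n.+1 (leqnn _); have n0 : (n.+1%:R : R) != 0 by rewrite pnatr_eq0.
  move: n0; move: (n.+1%:R : R) (`|t|) => N t' n0 h.
  have Nt : N * (t / N) = t by rewrite mulrC divfK.
  rewrite Nt in h; apply: le_trans h _; rewrite le_eqVlt; apply/orP; left.
  by apply/eqP; field.
apply: (cvg_ge_cst _ H); rewrite -[X in _ --> X]addr0; apply: cvgD; first exact: cvg_cst.
by rewrite -(mulr0 (C * t ^+ 2)); apply: cvgM; [exact: cvg_cst|exact: cvg_harmonic].
Qed.

Lemma is_derive_epsilon (F : R -> R) (x a : R) : (forall e, 0 < e -> exists2 d, 0 < d &
    forall y, `|y - x| <= d -> `|F y - F x - (y - x) * a| <= e * `|y - x|) ->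
  is_derive x (1 : R) F a.
Proof.
move=> H; apply/is_derive1_caratheodory.
exists (fun z => if z == x then a else (F z - F x) / (z - x)); split.
- move=> z; case: eqVneq => [->|zx]; first by rewrite !subrr mulr0.
  by rewrite divfK// subr_eq0.
- apply/cvgrPdist_le => e e0; rewrite eqxx; have [d d0 Hd] := H e e0.
  near=> z; case: eqVneq => [_|zx]; first by rewrite subrr normr0 ltW.
  have zx0 : z - x != 0 by rewrite subr_eq0.
  have zp : 0 < `|z - x| by rewrite normr_gt0.
  rewrite distrC (_ : _ / _ - a = (F z - F x - (z - x) * a) / (z - x)); last by field.
  rewrite normrM normfV ler_pdivrMr//; apply: Hd; rewrite distrC; apply: ltW; near: z.
  exact: near_dist.
- by rewrite eqxx.
Unshelve. all: end_near. Qed.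

End energy_duality.

(** * Uniform L^2 bounds and smooth estimates along a flow *)

Section flow_energy.
Context {R : realType}.
Variables (X : test_function R) (phi : R -> R -> R).
Hypothesis Hphi : is_flow X phi.
Implicit Types (f g u : R -> R) (s t x : R) (N : nat).
Local Notation L2 := (@circle_L2 R).

Let phi0 x : phi 0 x = x. Proof. by case: Hphi. Qed.
Let dphi x t : is_derive t (1 : R) (phi ^~ x) (X (phi t x)). Proof. by case: Hphi. Qed.
Let dX x : is_derive x (1 : R) X (derive1n 1 X x). Proof. exact: (test_is_derive X 0). Qed.
Let XL x : `|derive1n 1 X x| <= Cnorm 2 X. Proof. exact: Cnorm_ge. Qed.
Let XM x y : `|derive1n 1 X y - derive1n 1 X x| <= Cnorm 3 X * `|y - x|.
Proof. exact: test_lipschitz. Qed.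
Let pX := @test_periodic R X.
Let L := Cnorm 2 X.
Let L0 : 0 <= L. Proof. exact: Cnorm_ge0. Qed.
Let XB x : `|X x| <= Cnorm 1 X. Proof. exact: (@Cnorm_ge R X 1 0). Qed.

Let fcan := flow_cancel dX XL phi0 dphi.
Let fcan' := flow_cancel' dX XL phi0 dphi.

Let fcont t : continuous (phi t).
Proof. exact: (flow_continuous_space dX XL phi0 dphi). Qed.

Lemma flow_periodic f t : periodic f (pi *+ 2) -> periodic (f \o phi t) (pi *+ 2).
Proof.
move=> pf x /=; rewrite -(pf (phi t x)).
by rewrite (flow_shift dX XL pX phi0 dphi).
Qed.

Lemma flow_time_lipschitz x s t : `|phi t x - phi s x| <= Cnorm 1 X * `|t - s|.
Proof. exact: is_derive_lipschitz (dphi x) (fun s => XB _) _ _. Qed.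

(** The inverse of phi_t is phi_(-t), which is monotone and e^L-Lipschitz for |t| <= 1, as [L2_comp]
    requires. *)
Lemma flow_L2 : exists2 C, 0 <= C & forall t f, `|t| <= 1 -> periodic f (pi *+ 2) -> L2 f ->
  L2 (f \o phi t) /\ nrm (f \o phi t) <= C * nrm f.
Proof.
have p0 := @twopi_gt0 R.
(* The image of the circle stays within 2 pi + [Cnorm 1 X] of the origin: one unit accounts for the
   circle itself and one for the truncation. *)
pose m := (Num.trunc (Cnorm 1 X / (pi *+ 2))).+2.
have c0 : 0 <= expR L * (2 * m).+1%:R by rewrite mulr_ge0 ?expR_ge0.
exists (Num.sqrt (expR L * (2 * m).+1%:R)); first exact: sqrtr_ge0.
move=> t f t1 pf Lf.
have cl s (x y : R) : phi s x <= phi s y -> x <= y.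
  move=> h; rewrite -(fcan s x) -(fcan s y).
  exact: (flow_homo dX XL phi0 dphi).
have [] := @L2_comp R (phi t) (phi (- t)) (expR L) m f.
- exact: fcont.
- exact: fcont.
- move=> x y; apply/idP/idP => h.
    rewrite -(fcan t x); exact: (flow_homo dX XL phi0 dphi).
  by rewrite -(fcan' t y); apply: (flow_homo dX XL phi0 dphi).
- by move=> x y; exact: (flow_homo dX XL phi0 dphi).
- move=> x y xy; have := flow_lipschitz dX XL phi0 dphi (- t) y x.
  rewrite normrN [`|y - x|]ger0_norm ?subr_ge0// => h; apply: le_trans (ler_norm _) _.
  apply: le_trans h _; rewrite ler_wpM2r ?subr_ge0// ler_expR.
  by rewrite -/L ler_piMr.
- move=> x; rewrite /circle /= in_itv /= => /andP[x0 x1].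
  have h1 := flow_time_lipschitz x 0 t; rewrite phi0 subr0 in h1.
  have h2 : Cnorm 1 X * `|t| <= Cnorm 1 X by rewrite ler_piMr// Cnorm_ge0.
  have h3 : `|phi t x| <= pi *+ 2 + Cnorm 1 X.
    have -> : phi t x = x + (phi t x - x) by ring.
    apply: le_trans (ler_normD _ _) _; rewrite lerD//; first by rewrite ger0_norm.
    exact: le_trans h2.
  apply: le_trans h3 _; have := truncnS_gt (Cnorm 1 X / (pi *+ 2)).
  rewrite /m -[in X in _ -> X]natr1 mulrDr mulr1 ltr_pdivrMr// mulrC => /ltW h.
  by rewrite addrC lerD2r.
- by [].
- by [].
move=> Lc H; split=> //.
rewrite -ler_sqr ?nnegrE ?mulr_ge0 ?sqrtr_ge0//.
by rewrite exprMn !sqr_nrm sqr_sqrtr.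
Qed.

Lemma flow_qf_dist : exists2 C, 0 <= C & forall t f g, `|t| <= 1 ->
  periodic f (pi *+ 2) -> periodic g (pi *+ 2) -> L2 f -> L2 g ->
  `|qf X (f \o phi t) - qf X (g \o phi t)| <= C * (nrm (f - g) * nrm (f + g)).
Proof.
have [C C0 HC] := flow_L2; have K0 : 0 <= 16 * pi * (Cnorm 5 X * (pi *+ 2)).
  by rewrite !mulr_ge0 ?Cnorm_ge0 ?pi_ge0// ltW// twopi_gt0.
exists (16 * pi * (Cnorm 5 X * (pi *+ 2)) * (C * C)).
  by apply: mulr_ge0 => //; exact: mulr_ge0.
move=> t f g t1 pf pg Lf Lg.
have [Lft _] := HC t f t1 pf Lf; have [Lgt _] := HC t g t1 pg Lg.
apply: le_trans (qf_dist (test_fast_decay X) Lft Lgt) _.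
rewrite -[leRHS]mulrA ler_wpM2l//.
have pB : periodic (f - g) (pi *+ 2) by move=> x; rewrite !fctE pf pg.
have pD : periodic (f + g) (pi *+ 2) by move=> x; rewrite !fctE pf pg.
have [_ h1] := HC t _ t1 pB (L2B Lf Lg).
have [_ h2] := HC t _ t1 pD (L2D Lf Lg).
by rewrite mulrACA; apply: ler_pM; rewrite ?nrm_ge0.
Qed.

(** With U = u' X, the time derivative of u o phi_t is U o phi_t, and the form at u o phi_t is the
    pairing of its half-Laplacian with U o phi_t. Convexity at u o phi_t and a Taylor expansion of u
    o phi_s around s = t give the energy estimate. *)
Lemma smooth_flow_estimates (u : test_function R) : exists C,
  [/\ forall t, `|t| <= 1 -> finite_energy (u \o phi t),
      forall s t, `|s| <= 1 -> `|t| <= 1 ->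
        En (u \o phi t) - En (u \o phi s) <=
        2 * (t - s) * qf X (u \o phi t) + C * (t - s) ^+ 2 &
      forall t, `|t| <= 1 -> `|qf X (u \o phi t) - qf X u| <= C * `|t|].
Proof.
have [w [dw cw Xw wL]] := flow_C1 dX XL XM phi0 dphi.
pose u' := derive1n 1 u.
have du x : is_derive x (1 : R) u (u' x) := test_is_derive u 0 x.
have cu' : continuous u' := @test_derive_continuous _ u 1.
pose v' t x := u' (phi t x) * w t x.
have dv t x : `|t| <= 1 -> is_derive x (1 : R) (u \o phi t) (v' t x).
  move=> t1; exact: is_derive1_comp (du _) (dw t x t1).
have cv' t : `|t| <= 1 -> continuous (v' t).
  move=> t1 x; apply: cvgM; last exact: cw.
  by apply: (continuous_comp (@fcont t x)); exact: cu'.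
have pv t : periodic (u \o phi t) (pi *+ 2) := flow_periodic t (@test_periodic _ u).
pose B := Cnorm 2 u * expR L.
have B0 : 0 <= B by rewrite mulr_ge0 ?Cnorm_ge0 ?expR_ge0.
have vB t x : `|t| <= 1 -> `|v' t x| <= B.
  by move=> t1; rewrite normrM; apply: ler_pM; rewrite ?wL//; apply: Cnorm_ge.
have Lv t : `|t| <= 1 -> L2 (u \o phi t).
  by move=> t1; apply: continuous_L2; exact: is_derive_continuous (fun x => dv t x t1).
have half t : `|t| <= 1 -> exists g, [/\ L2 g, forall n, cf g n = n%:R * cf (u \o phi t) n,
    forall n, sf g n = n%:R * sf (u \o phi t) n, nrm g <= B * Num.sqrt (pi *+ 2) &
    qf X (u \o phi t) = ip g ((fun x => u' x * X x) \o phi t)].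
  move=> t1; have [g [Lg gc gs gB]] := qf_C1 (fun x => dv t x t1) (cv' t t1) (pv t).
  exists g; split=> //.
    apply: (@le_trans _ _ (nrm (v' t))); first exact: ler_wsqrtr.
    apply: nrm_le_bound => //; first by apply: continuous_L2; exact: cv'.
    by move=> x _; exact: vB.
  rewrite (qf_pairing (fun x => dv t x t1) (cv' t t1) (pv t) Lg gc gs (test_fast_decay X)
     (@test_continuous _ X)).
  (* The chain rule factor [w] is absorbed by X(phi_t x) = X(x) w(t, x). *)
  apply: eq_ip => // x _; rewrite /v' /= Xw//; ring.
have fe t : `|t| <= 1 -> finite_energy (u \o phi t).
  move=> t1; have [g [Lg gc gs _ _]] := half t t1.
  by apply: finite_energy_half gc gs => //; exact: Lv.
pose U x := u' x * X x.
have UL x y : `|U y - U x| <= (Cnorm 2 u * Cnorm 2 X + Cnorm 3 u * Cnorm 1 X) * `|y - x|.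
  have -> : U y - U x = u' y * (X y - X x) + (u' y - u' x) * X x by rewrite /U; ring.
  apply: le_trans (ler_normD _ _) _; rewrite [leRHS]mulrDl !normrM lerD//.
    rewrite -mulrA; apply: ler_pM => //; first exact: Cnorm_ge.
    exact: is_derive_lipschitz dX XL _ _.
  rewrite mulrAC; apply: ler_pM => //; exact: test_lipschitz.
pose C1 := (Cnorm 2 u * Cnorm 2 X + Cnorm 3 u * Cnorm 1 X) * Cnorm 1 X.
have C10 : 0 <= C1 by rewrite mulr_ge0 ?addr_ge0 ?mulr_ge0 ?Cnorm_ge0.
have Ut x s t : `|U (phi t x) - U (phi s x)| <= C1 * `|t - s|.
  apply: le_trans (UL _ _) _; rewrite -mulrA ler_wpM2l ?addr_ge0 ?mulr_ge0 ?Cnorm_ge0//.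
  exact: flow_time_lipschitz.
have T x s t : `|u (phi t x) - u (phi s x) - (t - s) * U (phi s x)| <= C1 * (t - s) ^+ 2.
  rewrite [(t - s) * _]mulrC; apply: (@taylor2 _ (fun s => u (phi s x)) (fun s => U (phi s x))).
    move=> r; exact: is_derive1_comp (du _) (dphi x r).
  by move=> r r'; exact: Ut.
pose q := Num.sqrt (pi *+ 2 : R).
have q0 : 0 <= q by exact: sqrtr_ge0.
(* Here [B * q] bounds the norm of the half-Laplacian and [C1 * q], times (t - s)^2, that of the
   Taylor remainder. *)
pose C := 2 * (B * q * (C1 * q)).
have C0 : 0 <= C by apply: mulr_ge0 => //; apply: mulr_ge0; apply: mulr_ge0.
have cU : continuous U by move=> x; apply: cvgM; [exact: cu'|exact: test_continuous].
have LU t : `|t| <= 1 -> L2 (U \o phi t).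
  move=> t1; apply: continuous_L2 => x; apply: (continuous_comp (@fcont t x)); exact: cU.
(* The constant of [qf_dist] times bounds on the norms of u o phi_t - u, divided by |t|, and of u o
   phi_t + u. *)
pose K := 16 * pi * (Cnorm 5 X * (pi *+ 2)) * (Cnorm 2 u * Cnorm 1 X * q * (2 * Cnorm 1 u * q)).
have K0 : 0 <= K.
  rewrite /K !mulr_ge0 ?Cnorm_ge0 ?pi_ge0//; rewrite ltW//; exact: twopi_gt0.
exists (C + K); split=> // [s t s1 t1|t t1].
  have [g [Lg gc gs gB ->]] := half t t1.
  apply: le_trans (En_sub_le (Lv t t1) Lg (fe s s1) gc gs) _.
  pose r : R -> R := ((u \o phi t) - (u \o phi s)) - (t - s) *: (U \o phi t).
  have LZ := L2Z (t - s) (LU t t1).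
  have Lr : L2 r by apply: L2B => //; apply: L2B; exact: Lv.
  have -> : (u \o phi t) - (u \o phi s) = (t - s) *: (U \o phi t) + r.
    by rewrite /r [RHS]addrC subrK.
  rewrite ipDr// ipZr//; last exact: LU.
  have rB : nrm r <= C1 * (t - s) ^+ 2 * q.
    apply: nrm_le_bound => //; first by rewrite mulr_ge0 ?sqr_ge0.
    move=> x _; have := T x t s; rewrite -[(s - t) ^+ 2]sqrrN opprB; congr (_ <= _).
    by rewrite -normrN /r !fctE /GRing.scale /=; congr `|_|; ring.
  have H : ip g r <= B * q * (C1 * (t - s) ^+ 2 * q).
    apply: le_trans (ler_norm _) _; apply: le_trans (ip_le Lg Lr) _.
    by apply: ler_pM; rewrite ?nrm_ge0.
  have K1 : 0 <= K * (t - s) ^+ 2 by rewrite mulr_ge0 ?sqr_ge0.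
  by move: H K1; rewrite /C; move: (ip g _) (ip g r) ((t - s) ^+ 2); move=> i1 i2 z; nra.
have Lu : L2 u by exact: (test_L2 u 0).
apply: le_trans (qf_dist (test_fast_decay X) (Lv t t1) Lu) _.
apply: (@le_trans _ _ (K * `|t|)); last by rewrite ler_wpM2r// lerDr.
rewrite /K -[leRHS]mulrA ler_wpM2l//.
  by rewrite !mulr_ge0 ?Cnorm_ge0 ?pi_ge0// ltW// twopi_gt0.
rewrite mulrAC; apply: ler_pM; rewrite ?nrm_ge0//.
  rewrite mulrAC; apply: nrm_le_bound; first by apply: L2B => //; exact: Lv.
    by rewrite !mulr_ge0 ?Cnorm_ge0.
  move=> x _; rewrite !fctE /=.
  apply: le_trans (is_derive_lipschitz du (fun x => @Cnorm_ge _ u 2 1 x isT) _ _) _.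
  rewrite -mulrA ler_wpM2l ?Cnorm_ge0//.
  by have := flow_time_lipschitz x 0 t; rewrite phi0 subr0.
apply: nrm_le_bound; first by apply: L2D => //; exact: Lv.
  by rewrite mulr_ge0 ?Cnorm_ge0.
move=> x _; rewrite !fctE; apply: le_trans (ler_normD _ _) _.
have H y : `|u y| <= Cnorm 1 u := @Cnorm_ge _ u 1 0 y isT.
by have := lerD (H (phi t x)) (H x); rewrite -mulr2n mulr_natl.
Qed.

End flow_energy.

(** * Derivative of the energy for functions of finite energy *)

Section flow_derivative.
Context {R : realType}.
Implicit Types (f g : R -> R) (s t x : R) (N : nat).
Local Notation L2 := (@circle_L2 R).

Lemma dist3 (a b c d x e : R) : `|a - b| <= x -> `|b - c| <= e / 3 -> `|d - c| <= x ->
  x <= e / 3 -> `|a - d| <= e.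
Proof. by rewrite !ler_norml => /andP[? ?] /andP[? ?] /andP[? ?] ?; apply/andP; split; lra. Qed.

Lemma test_sum (X Y : test_function R) a b : exists Z : test_function R,
  (Z : R -> R) = a *: (X : R -> R) + b *: (Y : R -> R).
Proof. by exists (a *: X + b *: Y). Qed.

Lemma S_test f N : exists u : test_function R, (u : R -> R) = S f N.
Proof.
rewrite /S /trig_poly; elim: N => [|N [u IH]].
  by exists 0; rewrite big_ord0.
have [Z1 E1] := test_sum (cosn N) (sinn N) (cf f N) (sf f N).
have [Z2 E2] := test_sum u Z1 1 (kap N).
by exists Z2; rewrite big_ord_recr /= E2 E1 scale1r IH.
Qed.

Lemma S_periodic f N : periodic (S f N) (pi *+ 2).
Proof. by have [u <-] := S_test f N; exact: test_periodic. Qed.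

Variables (X : test_function R) (phi : R -> R -> R).
Hypothesis Hphi : is_flow X phi.

(** The error [D] is uniform in [s] because composition with the flow is uniformly bounded on L^2;
    the subdivision argument needs one error for all times. *)
Lemma flow_qf_approx f : periodic f (pi *+ 2) -> L2 f ->
  exists2 D : nat -> R, D @ \oo --> 0 & forall N s, `|s| <= 1 ->
    `|qf X (f \o phi s) - qf X (S f N \o phi s)| <= D N.
Proof.
move=> pf Lf.
have [C2 C20 H2] := flow_qf_dist Hphi.
have LS N := L2_S f N; have pS N := S_periodic f N.
pose d N := nrm (f - S f N).
have dc : d @ \oo --> 0 := S_cvg Lf.
exists (fun N => C2 * (d N * (2 * nrm f + d N))).
  rewrite -(mulr0 C2) -(mul0r (2 * nrm f + 0)); apply: cvgM; first exact: cvg_cst.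
  by apply: cvgM => //; apply: cvgD => //; exact: cvg_cst.
move=> N s s1; apply: le_trans (H2 s _ _ s1 pf (pS N) Lf (LS N)) _.
rewrite ler_wpM2l// ler_wpM2l ?nrm_ge0//.
have -> : f + S f N = 2 *: f - (f - S f N).
  by apply/funext => x; rewrite !fctE /GRing.scale /=; ring.
apply: le_trans (nrmB (L2Z 2 Lf) (L2B Lf (LS N))) _.
by rewrite nrmZ// ger0_norm.
Qed.

(* Only this upper bound is stable under u_N -> u, the energy being merely lower
   semicontinuous; the matching lower bound is this lemma for u o phi_t and -t. *)
Lemma flow_energy_le f (r t a eps : R) : periodic f (pi *+ 2) -> finite_energy f ->
  r <= 1 -> `|t| <= r -> (forall s, `|s| <= r -> `|qf X (f \o phi s) - a| <= eps) ->
  finite_energy (f \o phi t) /\ En (f \o phi t) <= En f + 2 * t * a + 2 * `|t| * eps.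
Proof.
move=> pf fe r1 tr Hq; have Lf : L2 f by case: fe.
have phi0 x : phi 0 x = x by case: Hphi.
have [C1 C10 H1] := flow_L2 Hphi.
have LS N := L2_S f N; have pS N := S_periodic f N.
pose d N := nrm (f - S f N).
have dc : d @ \oo --> 0 := S_cvg Lf.
have [D D0 HD] := flow_qf_approx pf Lf.
(* The constant [C] of the smooth estimates depends on [N], but [polygon_bound] eliminates it before
   [N] goes to infinity. *)
have key M N : enp M (S f N \o phi t) <= En f + 2 * t * a + 2 * `|t| * (eps + D N).
  have [u uE] := S_test f N.
  have [C [fu eu _]] := smooth_flow_estimates Hphi u; rewrite uE in fu eu.
  have t1 : `|t| <= 1 := le_trans tr r1.
  apply: le_trans (enp_le_En M (fu t t1)) _.
  have := @polygon_bound _ (fun s => En (S f N \o phi s)) (fun s => qf X (S f N \o phi s)) r C a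
    (eps + D N) t tr.
  have -> : S f N \o phi 0 = S f N by apply/funext => x; rewrite /= phi0.
  have E := En_S_le N fe.
  move=> H; have : En (S f N \o phi t) - En (S f N) <= 2 * t * a + 2 * `|t| * (eps + D N).
    apply: H => [s s' sr s'r|s sr]; first by apply: eu; exact: le_trans r1.
    apply: le_trans (ler_distD (qf X (f \o phi s)) _ _) _.
    rewrite distrC addrC; exact: lerD (Hq s sr) (HD N s (le_trans sr r1)).
  by rewrite lerBlDl => h; apply: le_trans h _; rewrite -[leRHS]addrA lerD2r.
have t1 : `|t| <= 1 := le_trans tr r1.
have [Lft _] := H1 t f t1 pf Lf.
(* For fixed [M] the truncated energy is continuous in L^2, so [N] can go to infinity first. *)
have B M : enp M (f \o phi t) <= En f + 2 * t * a + 2 * `|t| * eps.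
  have LSt N : L2 (S f N \o phi t) by have [] := H1 t _ t1 (pS N) (LS N).
  have c1 : enp M (S f N \o phi t) @[N --> \oo] --> enp M (f \o phi t).
    apply: cvg_enp => //.
    have K0 : (fun N => C1 * d N) @ \oo --> (0 : R).
      by rewrite -(mulr0 C1); apply: cvgM => //; exact: cvg_cst.
    apply: (cvg0_le _ K0) => N; rewrite ger0_norm ?nrm_ge0//.
    have pB : periodic (S f N - f) (pi *+ 2) by move=> x; rewrite !fctE pf pS.
    have [_] := H1 t _ t1 pB (L2B (LS N) Lf).
    by rewrite /d -[f - S f N]opprB nrmN//; exact: L2B.
  have c2 : En f + 2 * t * a + 2 * `|t| * (eps + D N) @[N --> \oo] -->
      En f + 2 * t * a + 2 * `|t| * eps.
    apply: cvgD; first exact: cvg_cst.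
    apply: cvgM; first exact: cvg_cst.
    by rewrite -[X in _ --> X]addr0; apply: cvgD => //; exact: cvg_cst.
  rewrite -subr_ge0; apply: (cvg_ge_cst (cvgB c2 c1)) => N.
  by rewrite subr_ge0; exact: key.
by split; [split=> //; eexists; exact: B|exact: En_le].
Qed.

Lemma flow_qf_continuous f e : periodic f (pi *+ 2) -> L2 f -> 0 < e ->
  exists2 d, 0 < d & forall s, `|s| <= d -> `|qf X (f \o phi s) - qf X f| <= e.
Proof.
move=> pf Lf e0; have phi0 x : phi 0 x = x by case: Hphi.
have [D D0 HD] := flow_qf_approx pf Lf.
have e3 : 0 < e / 3 by rewrite divr_gt0.
have /cvgrPdist_lt/(_ _ e3)[N _ HN] := D0.
have {HN} DN : D N <= e / 3.
  by have := HN N (leqnn N); rewrite /= sub0r normrN => /ltW; apply: le_trans; exact: ler_norm.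
have [u uE] := S_test f N.
have [C [_ _ Hu]] := smooth_flow_estimates Hphi u; rewrite uE in Hu.
have C1 : 0 < `|C| + 1 by rewrite ltr_wpDl.
exists (Num.min 1 (e / 3 / (`|C| + 1))); first by rewrite lt_min ltr01 divr_gt0.
move=> s; rewrite le_min => /andP[s1]; rewrite ler_pdivlMr// => s2.
have h1 := HD N s s1; have h2 := HD N 0; rewrite normr0 in h2.
have e0' : (f \o phi 0 = f) /\ (S f N \o phi 0 = S f N).
  by split; apply/funext => x; rewrite /= phi0.
have {}h2 := h2 ler01; rewrite e0'.1 e0'.2 in h2.
have h3 : `|qf X (S f N \o phi s) - qf X (S f N)| <= e / 3.
  apply: le_trans (Hu s s1) _; apply: le_trans s2; rewrite mulrC ler_wpM2l//.
  by rewrite (le_trans (ler_norm C))// lerDl.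
exact: dist3 h1 h3 h2 DN.
Qed.

(** The upper bound on the energy with [a = 0], the deviation of the form being bounded crudely by
    its L^2 estimate. *)
Lemma flow_finite_energy f t : periodic f (pi *+ 2) -> finite_energy f -> `|t| <= 1 ->
  finite_energy (f \o phi t).
Proof.
move=> pf fe t1; have Lf : L2 f by case: fe.
have [C C0 HC] := flow_L2 Hphi.
have [|] := @flow_energy_le f 1 t 0 (16 * pi * (Cnorm 5 X * (pi *+ 2)) * (C * nrm f) ^+ 2) pf fe (lexx _) t1 => //.
move=> s s1; rewrite subr0; have [Ls Hs] := HC s f s1 pf Lf.
apply: le_trans (qf_le (test_fast_decay X) Ls) _; rewrite ler_wpM2l//.
  by rewrite !mulr_ge0 ?Cnorm_ge0 ?pi_ge0// ltW// twopi_gt0.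
by rewrite -sqr_nrm ler_sqr ?nnegrE ?mulr_ge0 ?nrm_ge0.
Qed.

Lemma is_derive_En_flow f : periodic f (pi *+ 2) -> finite_energy f ->
  is_derive (0 : R) (1 : R) (fun t => En (f \o phi t)) (2 * qf X f).
Proof.
move=> pf fe; have Lf : L2 f by case: fe.
have phi0 x : phi 0 x = x by case: Hphi.
apply: is_derive_epsilon => e e0.
(* The error in [flow_energy_le] is 2 |t| times this. Below, the radius is at most d / 2 because the
   bound started from f o phi_t needs |t + s| <= d. *)
have e2 : 0 < e / 2 by rewrite divr_gt0.
have [d d0 Hd] := flow_qf_continuous pf Lf e2.
have c0 : 0 < Num.min 1 (d / 2) by rewrite lt_min ltr01 divr_gt0.
exists (Num.min 1 (d / 2)) => // t; rewrite subr0 => td.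
have : Num.min 1 (d / 2) <= 1 by rewrite ge_min lexx.
have : Num.min 1 (d / 2) <= d / 2 by rewrite ge_min lexx orbT.
move: c0 td; move: (Num.min _ _) => r r0 tr rd r1.
have -> : f \o phi 0 = f by apply/funext => x; rewrite /= phi0.
have H1 s : `|s| <= r -> `|qf X (f \o phi s) - qf X f| <= e / 2.
  by move=> sr; apply: Hd; lra.
have [fet u1] := flow_energy_le pf fe r1 tr H1.
have pft := flow_periodic Hphi t pf.
have comp s : (f \o phi t) \o phi s = f \o phi (t + s).
  apply/funext => x /=; congr f.
  exact: (flow_add (test_is_derive X 0) (fun x => @Cnorm_ge _ X 2 1 x isT) phi0 Hphi.2).
have Nt : `|- t| <= r by rewrite normrN.
have [|_] := @flow_energy_le (f \o phi t) r (- t) (qf X f) (e / 2) pft fet r1 Nt.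
  move=> s sr; rewrite comp; apply: Hd; apply: le_trans (ler_normD _ _) _; lra.
rewrite comp subrr; have -> : f \o phi 0 = f by apply/funext => x; rewrite /= phi0.
rewrite normrN; move: u1; move: (En _) (En _) (qf _ _) `|t|; move=> a b q t' u1 u2.
by rewrite ler_norml; apply/andP; split; lra.
Qed.

End flow_derivative.

(** * The inner variation *)

Section distribution_topology.
Context {R : realType}.
Implicit Types (T : circle_distr R) (X : test_function R).

Lemma pairing_continuous X : continuous (fun T : circle_distr R => T X).
Proof.
move=> T; apply: (@continuous_comp _ {ptws test_function R -> R} _ (@pairing R)
  (@proj _ (fun=> R) X)).
  exact: (@initial_continuous _ {ptws test_function R -> R} (@pairing R)).
exact: proj_continuous.
Qed.

Lemma circle_distr_cvg (F : set_system (circle_distr R)) T : Filter F ->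
  (forall X, (fun T' : circle_distr R => T' X) @ F --> T X) -> F --> T.
Proof.
move=> FF H.
have H1 : (@pairing R : circle_distr R -> {ptws test_function R -> R}) @ F -->
    (T : {ptws test_function R -> R}).
  apply/cvg_sup => X A [_ [[W oW <-] WT]] /filterS; apply.
  by apply: H; exact: open_nbhs_nbhs.
move=> A [_ [[W oW <-] WT]] /filterS; apply.
by apply: H1; exact: open_nbhs_nbhs.
Qed.

End distribution_topology.

(** * The inner variation as a continuous family of distributions *)

Section variation.
Context {R : realType} {k : nat}.
Implicit Types (u v w : R -> 'rV[R]_k) (X Y : test_function R) (N n : nat).
Local Notation mu := (@lebesgue_measure R).
Local Notation L2 := (@circle_L2 R).

Definition vqf u X : R := \sum_i qf X (coordf u i).

Lemma H12_L2 (u : H12 R k) i : L2 (coordf u i).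
Proof. by have [_ /(_ i)[]] := H12P u. Qed.

Lemma H12_energy (u : H12 R k) i : finite_energy (coordf u i).
Proof. by have /in_H12P[_] := H12P u. Qed.

Lemma vqf_linear (u : H12 R k) a X Y : vqf u (a *: X + Y : test_function R) = a * vqf u X + vqf u Y.
Proof.
rewrite /vqf mulr_sumr -big_split; apply: eq_bigr => i _ /=.
by apply: qf_add; solve [exact: H12_L2|exact: (test_L2 _ 0)|exact: test_decaying].
Qed.

Lemma vqf_le (u : H12 R k) X : `|vqf u X| <=
  16 * pi * (pi *+ 2) * (\sum_i ip (coordf u i) (coordf u i)) * Cnorm 5 X.
Proof.
rewrite mulrAC mulr_sumr; apply: le_trans (ler_norm_sum _ _ _) _.
apply: ler_sum => i _.
apply: le_trans (qf_le (test_fast_decay X) (H12_L2 u i)) _.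
by rewrite le_eqVlt; apply/orP; left; apply/eqP; ring.
Qed.

Lemma vqf_bounded (u : H12 R k) : exists N C, forall X, `|vqf u X| <= C * Cnorm N X.
Proof. by exists 5, (16 * pi * (pi *+ 2) * (\sum_i ip (coordf u i) (coordf u i))) => X; exact: vqf_le. Qed.

Definition variation (u : H12 R k) : circle_distr R :=
  Distribution (vqf_linear u) (vqf_bounded u).

(** The half-Laplacian of a smooth coordinate lies in L^2, so [fracLap] is not its default value
    here and can serve as [g] in [qf_pairing]. *)
Lemma inner_variation_smoothE (u : H12 R k) : smooth_map u ->
  inner_variation_smooth u = variation u.
Proof.
move=> su; apply: circle_distr_eq => X.
pose U i : test_function R := Test (su i).
have dU i x : is_derive x (1 : R) (coordf u i) (derive1n 1 (U i) x) := test_is_derive (U i) 0 x.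
have cU i : continuous (derive1n 1 (U i)) := @test_derive_continuous _ (U i) 1.
have pU i : periodic (coordf u i) (pi *+ 2) := @test_periodic _ (U i).
pose G i := fracLap 2^-1 (coordf u i).
have HG i : has_fracLap 2^-1 (coordf u i) (G i).
  apply: fracLap_has; have [g [Lg gc gs _]] := qf_C1 (dU i) (cU i) (pU i).
  exists g; split=> //; apply/(is_fracLapP _ (H12_L2 u i) Lg) => n.
  by rewrite powR_half.
have LG i : L2 (G i) by case: (HG i).
have Gc i n : cf (G i) n = n%:R * cf (coordf u i) n /\ sf (G i) n = n%:R * sf (coordf u i) n.
  by have [_ /(is_fracLapP _ (H12_L2 u i) (LG i))/(_ n)] := HG i; rewrite powR_half.
have Ld i : L2 (derive1n 1 (U i)) := test_L2 (U i) 1.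
have E x : dotv (fracLapv 2^-1 u x) (derivv u x) = \sum_i G i x * derive1n 1 (U i) x.
  by apply: eq_bigr => i _; rewrite !mxE.
have [I1 _] := @circle_int_sum R _ (index_enum _) (fun i x => G i x * derive1n 1 (U i) x)
  (fun i => L2_mul (LG i) (Ld i)).
rewrite /inner_variation_smooth fun_distrE; last first.
  by apply: eq_circle_integrable I1 => x _; rewrite E.
have LX i : L2 (fun x => derive1n 1 (U i) x * X x).
  by apply: continuous_L2 => x; apply: cvgM; [exact: cU|exact: test_continuous].
have [_ I2] := @circle_int_sum R _ (index_enum _) (fun i x => G i x * (derive1n 1 (U i) x * X x))
  (fun i => L2_mul (LG i) (LX i)).
transitivity (\sum_i \int[mu]_(x in circle) (G i x * (derive1n 1 (U i) x * X x))).
  rewrite -I2; apply: eq_Rintegral => x _; rewrite E mulr_suml.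
  by apply: eq_bigr => i _; rewrite mulrA.
apply: eq_bigr => i _; apply/esym.
exact: (qf_pairing (dU i) (cU i) (pU i) (LG i) (fun n => (Gc i n).1) (fun n => (Gc i n).2)
  (test_fast_decay X) (@test_continuous _ X)).
Qed.

Lemma in_H12B (u v : H12 R k) : in_H12 (fun x => v x - u x).
Proof.
have /in_H12P[pu fu] := H12P u; have /in_H12P[pv fv] := H12P v.
apply/in_H12P; split; first by move=> x; rewrite pu pv.
move=> i; have -> : coordf (fun x => v x - u x) i = coordf v i - coordf u i.
  by apply/funext => x; rewrite /coordf !fctE !mxE.
exact: finite_energyB.
Qed.

Lemma normH12E w : in_H12 w ->
  normH12 w = Num.sqrt (\sum_i (ip (coordf w i) (coordf w i) + En (coordf w i))).
Proof.
move=> /in_H12P[_ fw]; rewrite /normH12 half_energyE// big_split /=; congr (Num.sqrt (_ + _)).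
rewrite -(circle_int_sum _ _).2; last by move=> i; apply: L2_mul; case: (fw i).
by apply: eq_Rintegral => x _; apply: eq_bigr => i _.
Qed.

Lemma En_ge0 (f : R -> R) : finite_energy f -> 0 <= En f.
Proof. by move=> /(enp_le_En 0%N); rewrite /enp big_ord0. Qed.

Lemma nrm_le_normH12 w i : in_H12 w -> nrm (coordf w i) <= normH12 w.
Proof.
move=> Hw; rewrite normH12E//; apply: ler_wsqrtr.
have /in_H12P[_ fw] := Hw.
have H j : 0 <= ip (coordf w j) (coordf w j) + En (coordf w j) by rewrite addr_ge0 ?ip_ge0 ?En_ge0.
rewrite (bigD1 i)//= -[leLHS]addr0 lerD ?sumr_ge0//.
by rewrite lerDl En_ge0.
Qed.

Lemma variation_dist (u v : H12 R k) X : `|variation v X - variation u X| <=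
  \sum_i 16 * pi * (Cnorm 5 X * (pi *+ 2)) * (normH12 (fun x => v x - u x) *
    (normH12 (fun x => v x - u x) + 2 * nrm (coordf u i))).
Proof.
rewrite /= /vqf -sumrB; apply: le_trans (ler_norm_sum _ _ _) _.
apply: ler_sum => i _; have Lu := H12_L2 u i; have Lv := H12_L2 v i.
apply: le_trans (qf_dist (test_fast_decay X) Lv Lu) _.
have p0 := @twopi_gt0 R.
have E : coordf v i - coordf u i = coordf (fun x => v x - u x) i.
  by apply/funext => x; rewrite /coordf !fctE !mxE.
have D : nrm (coordf v i - coordf u i) <= normH12 (fun x => v x - u x).
  by rewrite E; apply: nrm_le_normH12; exact: in_H12B.
rewrite ler_wpM2l//; first by rewrite !mulr_ge0 ?Cnorm_ge0 ?pi_ge0// ltW.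
apply: ler_pM; rewrite ?nrm_ge0//.
have -> : coordf v i + coordf u i = (coordf v i - coordf u i) + 2 *: coordf u i.
  by apply/funext => x; rewrite !fctE /GRing.scale /=; ring.
have LB := L2B Lv Lu.
apply: le_trans (nrmD LB (L2Z 2 Lu)) _.
by rewrite nrmZ// ger0_norm// lerD.
Qed.

Lemma H12_nbhs_filter (u : H12 R k) : Filter (nbhs u).
Proof.
apply: filter_from_filter; first by exists 1 => /=.
move=> e e' /= e0 e'0; exists (Num.min e e'); first by rewrite /= lt_min e0.
by move=> v; rewrite /H12_ball /= lt_min => /andP[].
Qed.

Lemma normH12_cvg (u : H12 R k) : (fun v : H12 R k => normH12 (fun x => v x - u x)) @ u --> 0.
Proof.
have ? := H12_nbhs_filter u.
apply/cvgrPdist_lt => e e0; exists e => // v /=; rewrite /H12_ball /= sub0r normrN.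
by rewrite ger0_norm// sqrtr_ge0.
Qed.

Lemma variation_continuous : continuous (variation : H12 R k -> circle_distr R).
Proof.
move=> u; have FF := H12_nbhs_filter u; apply: circle_distr_cvg => X.
pose B (z : R) := \sum_i 16 * pi * (Cnorm 5 X * (pi *+ 2)) * (z * (z + 2 * nrm (coordf u i))).
have B0 : (fun v : H12 R k => B (normH12 (fun x => v x - u x))) @ u --> 0.
  have Bc : {for 0, continuous B}.
    apply: cvg_big => [|i _ ]; first exact: add_continuous.
    apply: cvgM; first exact: cvg_cst.
    by apply: cvgM; [exact: cvg_id|apply: cvgD; [exact: cvg_id|exact: cvg_cst]].
  have B00 : B 0 = 0 by rewrite /B big1// => i _; rewrite mul0r mulr0.
  rewrite -B00; exact: cvg_comp (normH12_cvg u) Bc.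
apply/cvgrPdist_lt => e e0; have /cvgrPdist_lt/(_ e e0) := B0.
apply: filterS => v /=; rewrite sub0r normrN => h.
rewrite distrC; apply: le_lt_trans h; apply: le_trans (variation_dist u v X) _; exact: ler_norm.
Qed.

Lemma in_H12_S (u : H12 R k) N : in_H12 (fun x => \row_i S (coordf u i) N x).
Proof.
apply/in_H12P; split => [x|i].
  by apply/rowP => i; rewrite !mxE S_periodic.
have -> : coordf (fun x => \row_i S (coordf u i) N x) i = S (coordf u i) N.
  by apply/funext => x; rewrite /coordf mxE.
exact/finite_energy_S/H12_L2.
Qed.

Lemma EnN (f : R -> R) : L2 f -> En (- f) = En f.
Proof.
move=> Lf; rewrite /En (_ : (fun N => enp N (- f)) = (fun N => enp N f))//.
apply/funext => N; apply: eq_bigr => n _.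
by rewrite /cf /sf !ipNl ?sqrrN//; [exact: L2_sn|exact: L2_cs].
Qed.

(** The Fourier partial sums of the coordinates converge both in L^2 and in energy. *)
Lemma smooth_approx_exists (u : H12 R k) : exists un, smooth_approx u un.
Proof.
exists (fun N => MkH12 (in_H12_S u N)); split.
  move=> N i; have [t tE] := S_test (coordf u i) N.
  have -> : coordf (MkH12 (in_H12_S u N)) i = t.
    by rewrite tE; apply/funext => x; rewrite /coordf mxE.
  exact: testP.
have K : normH12 (fun x => MkH12 (in_H12_S u N) x - u x) @[N --> \oo] --> 0.
  have E N : normH12 (fun x => MkH12 (in_H12_S u N) x - u x) =
     Num.sqrt (\sum_i (nrm (coordf u i - S (coordf u i) N) ^+ 2 +
        En (coordf u i - S (coordf u i) N))).
    rewrite normH12E; last exact: in_H12B.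
    congr (Num.sqrt _); apply: eq_bigr => i _.
    have Lu := H12_L2 u i; have LS := L2_S (coordf u i) N; have LB := L2B Lu LS.
    have -> : coordf (fun x => MkH12 (in_H12_S u N) x - u x) i =
        - (coordf u i - S (coordf u i) N).
      by apply/funext => x; rewrite /coordf !fctE !mxE opprB.
    have LN := L2N LB.
    by rewrite EnN// sqr_nrm ipNl// ipC ipNl// opprK.
  pose F N := \sum_i (nrm (coordf u i - S (coordf u i) N) ^+ 2 +
    En (coordf u i - S (coordf u i) N)).
  suff K : F @ \oo --> (0 : R).
    have Ks : (fun N => Num.sqrt (F N)) @ \oo --> Num.sqrt (0 : R).
      by apply: continuous_cvg K; exact: sqrt_continuous.
    rewrite sqrtr0 in Ks; apply: cvg_trans Ks.
    by apply: near_eq_cvg; apply: nearW => N; rewrite E.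
  rewrite /F.
  have E0 : \sum_(i < k) ((0 : R) * 0 + 0) = 0.
    by rewrite big1// => i _; rewrite mulr0 addr0.
  rewrite -[X in _ --> X]E0.
  apply: cvg_big => [|i _]; first exact: add_continuous.
  apply: cvgD; last exact/En_S_cvg/H12_energy.
  by apply: cvgM; apply/S_cvg/H12_L2.
move=> A [e /= e0 eA]; have /cvgrPdist_lt/(_ e e0) := K.
apply: filterS => N; rewrite sub0r normrN => h; apply: eA.
by apply: le_lt_trans h; exact: ler_norm.
Qed.

Lemma variation_is_inner (u : H12 R k) : is_inner_variation u (variation u).
Proof.
split; first exact: smooth_approx_exists.
move=> un [sun ucvg].
under eq_fun do rewrite inner_variation_smoothE//.
exact: cvg_comp ucvg (@variation_continuous u).
Qed.

Lemma inner_variationE (u : H12 R k) : inner_variation u = variation u.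
Proof.
apply: xget_unique; first exact: variation_is_inner.
move=> T [[un ua] H]; apply: circle_distr_eq => X.
have [_ H'] := variation_is_inner u.
have c1 : (fun n => inner_variation_smooth (un n) X) @ \oo --> T X.
  apply: (cvg_comp (fun n => inner_variation_smooth (un n)) (fun T : circle_distr R => T X) (H _ ua)).
  exact: pairing_continuous.
have c2 : (fun n => inner_variation_smooth (un n) X) @ \oo --> variation u X.
  apply: (cvg_comp (fun n => inner_variation_smooth (un n)) (fun T : circle_distr R => T X) (H' _ ua)).
  exact: pairing_continuous.
exact: (cvg_unique (@Rhausdorff R) c1 c2).
Qed.

Lemma half_energy_flow_derive (u : H12 R k) X phi : is_flow X phi ->
  is_derive (0 : R) (1 : R) (fun t => half_energy (u \o phi t)) (2 * inner_variation u X).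
Proof.
move=> Hphi; rewrite inner_variationE /= /vqf mulr_sumr.
have /in_H12P[pu fu] := H12P u.
have pc i : periodic (coordf u i) (pi *+ 2) by move=> x; rewrite /coordf pu.
have D := is_derive_sum (fun i => is_derive_En_flow Hphi (pc i) (fu i)).
(* The energy splits over the coordinates only once u o phi_t is known to have finite energy, which
   holds for |t| <= 1. *)
apply: near_eq_is_derive D; near=> t.
have t1 : `|t| <= 1.
  near: t; have := @near_dist R 0 1 ltr01.
  by apply: filterS => y; rewrite sub0r normrN => /ltW.
rewrite fct_sumE half_energyE// => i.
exact: (flow_finite_energy Hphi (pc i) (fu i) t1).
Unshelve. all: end_near. Qed.

End variation.

(** * Explicit flows of the trigonometric vector fields *)

Section trigonometric_flows.
Context {R : realType}.
Implicit Types (t x h : R) (n : nat).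

Lemma trig_flow_denom_gt0 (l h : R) : 0 < l -> 0 < cos h ^+ 2 + l * sin h ^+ 2.
Proof.
move=> l0; have E := cos2Dsin2 h; have s0 := sqr_ge0 (sin h); have c0 := sqr_ge0 (cos h).
have ls : 0 <= l * sin h ^+ 2 by apply: mulr_ge0 => //; exact: ltW.
rewrite lt_neqAle addr_ge0// andbT eq_sym; apply/negP => /eqP H.
have c00 : cos h ^+ 2 = 0 by lra.
have : l * sin h ^+ 2 = 0 by lra.
move=> /eqP; rewrite mulf_eq0 (gt_eqF l0) /= => /eqP s00.
by move: E; rewrite c00 s00 addr0 => /eqP; rewrite eq_sym oner_eq0.
Qed.

(* The flow of sin(theta) acts on e^(i theta) by the Moebius maps
   tan(theta/2) -> e^t tan(theta/2), and [trig_ratio] is the tangent of half the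
   angle by which theta moves. *)
Definition trig_ratio (l h : R) : R :=
  (l - 1) * (sin h * cos h) / (cos h ^+ 2 + l * sin h ^+ 2).

(** The moved half-angle has cosine and sine proportional to cos h and l sin h, so its tangent is l
    tan h. The factor 1 + y^2, with y the ratio, is the one that differentiating atan produces. *)
Lemma sin_trig_ratio (l h : R) : 0 < l ->
  sin ((h + atan (trig_ratio l h)) *+ 2) * (1 + trig_ratio l h ^+ 2) =
  2 * (l * (sin h * cos h) / (cos h ^+ 2 + l * sin h ^+ 2) ^+ 2).
Proof.
move=> l0; have B0 := trig_flow_denom_gt0 h l0.
have T := atanK (trig_ratio l h); have q2 := cos_atan (trig_ratio l h).
have y0 : 0 < 1 + trig_ratio l h ^+ 2 by rewrite ltr_pwDl ?sqr_ge0.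
have cc : cos (atan (trig_ratio l h)) ^+ 2 * (1 + trig_ratio l h ^+ 2) = 1.
  by rewrite q2 exprVn sqr_sqrtr ?ltW// mulVf// gt_eqF.
have c0 : cos (atan (trig_ratio l h)) != 0.
  by apply/eqP => c0; move: cc => /eqP; rewrite c0 expr0n mul0r eq_sym oner_eq0.
have sE : sin (atan (trig_ratio l h)) = trig_ratio l h * cos (atan (trig_ratio l h)).
  by rewrite -[LHS](divfK c0); congr (_ * _).
rewrite sin_mulr2n cosD sinD sE.
have e1 : cos h - sin h * trig_ratio l h = cos h / (cos h ^+ 2 + l * sin h ^+ 2).
  rewrite /trig_ratio; have := cos2Dsin2 h; move: (cos h) (sin h) B0 => c s B0 cs1.
  have -> : c - s * ((l - 1) * (s * c) / (c ^+ 2 + l * s ^+ 2)) =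
    c * (c ^+ 2 + s ^+ 2) / (c ^+ 2 + l * s ^+ 2) by field; rewrite gt_eqF.
  by rewrite cs1 mulr1.
have e2 : sin h + cos h * trig_ratio l h = l * sin h / (cos h ^+ 2 + l * sin h ^+ 2).
  rewrite /trig_ratio; have := cos2Dsin2 h; move: (cos h) (sin h) B0 => c s B0 cs1.
  have -> : s + c * ((l - 1) * (s * c) / (c ^+ 2 + l * s ^+ 2)) =
    l * s * (c ^+ 2 + s ^+ 2) / (c ^+ 2 + l * s ^+ 2) by field; rewrite gt_eqF.
  by rewrite cs1 mulr1.
move: e1 e2 cc; move: (trig_ratio l h) (cos (atan _)) => y q e1 e2 cc.
transitivity (2 * ((cos h - sin h * y) * (sin h + cos h * y)) * (q ^+ 2 * (1 + y ^+ 2))).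
  ring.
rewrite cc e1 e2 mulr1; move: (_ + l * _) B0 => B B0.
by field; rewrite gt_eqF.
Qed.

Lemma is_derive_trig_ratio (m h t : R) :
  is_derive t (1 : R) (fun s => trig_ratio (expR (m * s)) h)
    (m * expR (m * t) * (sin h * cos h) / (cos h ^+ 2 + expR (m * t) * sin h ^+ 2) ^+ 2).
Proof.
have dl : is_derive t (1 : R) (fun s => expR (m * s)) (m * expR (m * t)).
  by have := is_derive_expRM m (is_derive_id t 1); rewrite mulr1.
have B0 := trig_flow_denom_gt0 h (expR_gt0 (m * t)).
have dA : is_derive t (1 : R) (fun s => (expR (m * s) - 1) * (sin h * cos h))
    (m * expR (m * t) * (sin h * cos h)).
  have := is_derive_mul (is_deriveB dl (is_derive_cst (1 : R) t 1)) (is_derive_cst (sin h * cos h : R) t 1).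
  by rewrite mulr0 add0r subr0.
have dB : is_derive t (1 : R) (fun s => cos h ^+ 2 + expR (m * s) * sin h ^+ 2)
    (m * expR (m * t) * sin h ^+ 2).
  have := is_deriveD (is_derive_cst (cos h ^+ 2 : R) t 1)
    (is_derive_mul dl (is_derive_cst (sin h ^+ 2 : R) t 1)).
  by rewrite mulr0 !add0r.
have dV := @is_deriveV _ (fun s => cos h ^+ 2 + expR (m * s) * sin h ^+ 2) _ _ _ (lt0r_neq0 B0) dB.
apply: is_derive_eq (is_derive_mul dA dV) _.
rewrite /GRing.scale /=; have := cos2Dsin2 h; move: B0.
move: (cos h) (sin h) (expR _) => c s l B0 cs1.
transitivity (m * l * (s * c) * (c ^+ 2 + s ^+ 2) / (c ^+ 2 + l * s ^+ 2) ^+ 2).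
  by field; rewrite gt_eqF.
by rewrite cs1 mulr1.
Qed.

(** For n > 0 the angle theta = n x + c obeys theta' = n sin theta, hence the parameter l = e^(nt)
    and the half-angle [h]. For n = 0 the field is constant. The phase [c] covers the cosine as
    well. *)
Lemma sine_flow_exists n (c : R) : exists phi : R -> R -> R, (forall x, phi 0 x = x) /\
  forall x t, is_derive t (1 : R) (phi ^~ x) (sin (n%:R * phi t x + c)).
Proof.
case: n => [|n].
  exists (fun t x => x + t * sin c); split=> [x|x t]; first by rewrite mul0r addr0.
  rewrite mul0r add0r.
  have := is_deriveD (is_derive_cst x t 1) (is_derive_mul (is_derive_id t 1) (is_derive_cst (sin c : R) t 1)).
  by rewrite mulr0 !add0r mul1r.
have n0 : n.+1%:R != 0 :> R by rewrite pnatr_eq0.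
pose h x := (n.+1%:R * x + c) / 2.
exists (fun t x => x + 2 / n.+1%:R * atan (trig_ratio (expR (n.+1%:R * t)) (h x))).
split=> [x|x t].
  by rewrite mulr0 expR0 /trig_ratio subrr !mul0r atan0 mulr0 addr0.
have e0 := expR_gt0 (n.+1%:R * t).
have dy := is_derive_trig_ratio n.+1%:R (h x) t.
have da := @is_derive1_comp _ atan _ t _ _ (is_derive1_atan _) dy.
have db := is_derive_mul (is_derive_cst (2 / n.+1%:R : R) t 1) da.
have d1 := is_deriveD (is_derive_cst x t 1) db.
apply: is_derive_eq d1 _.
have -> : n.+1%:R * (x + 2 / n.+1%:R * atan (trig_ratio (expR (n.+1%:R * t)) (h x))) + c =
    (h x + atan (trig_ratio (expR (n.+1%:R * t)) (h x))) *+ 2.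
  by rewrite /h -mulr_natr; field.
have := sin_trig_ratio (h x) e0.
have y0 : 0 < 1 + trig_ratio (expR (n.+1%:R * t)) (h x) ^+ 2 by rewrite ltr_pwDl ?sqr_ge0.
have B0 := trig_flow_denom_gt0 (h x) e0.
rewrite mul0r addr0 add0r /=; move: n0 y0 B0.
move: (expR (n.+1%:R * t)) (n.+1%:R : R) => l N N0 y0 B0 E.
apply: (mulIf (lt0r_neq0 y0)); rewrite E.
move: (1 + _) (cos _ ^+ 2 + _) y0 B0 => a b a0 b0.
by field; rewrite N0 (gt_eqF a0) (gt_eqF b0).
Qed.

Lemma sinn_flow_exists n : exists phi, is_flow (@sinn R n) phi.
Proof.
have [phi [p0 dp]] := sine_flow_exists n 0; exists phi; split=> // x t.
by have := dp x t; rewrite addr0.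
Qed.

Lemma cosn_flow_exists n : exists phi, is_flow (@cosn R n) phi.
Proof.
have [phi [p0 dp]] := sine_flow_exists n (pi / 2); exists phi; split=> // x t.
by have := dp x t; rewrite sinDpihalf.
Qed.

End trigonometric_flows.

(** * Stationary points and the theorem *)

Section main.
Context {R : realType} {k : nat}.
Implicit Types (X Y : test_function R) (n : nat).
Local Notation L2 := (@circle_L2 R).

Lemma variation_trig_eq0 (u : H12 R k) :
  (forall n, variation u (cosn n) = 0) -> (forall n, variation u (sinn n) = 0) ->
  variation u = dist0.
Proof.
move=> uc us; apply: circle_distr_eq => X.
(* A single constant for the decay of orders 4 and 5 that [trig_eq0] asks for. *)
pose K := Cnorm 6 X * (pi *+ 2) + Cnorm 5 X * (pi *+ 2).
have p0 := ltW (@twopi_gt0 R).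
have K5 : Cnorm 5 X * (pi *+ 2) <= K by rewrite lerDr mulr_ge0 ?Cnorm_ge0.
have K6 : Cnorm 6 X * (pi *+ 2) <= K by rewrite lerDl mulr_ge0 ?Cnorm_ge0.
apply: (@trig_eq0 R (fun Y : R -> R => \sum_i qf Y (coordf u i))
  (\sum_i 16 * pi * ip (coordf u i) (coordf u i)) K X).
- move=> a Y Z LY LZ dY dZ; rewrite mulr_sumr -big_split; apply: eq_bigr => i _.
  by apply: qf_add => //; exact: H12_L2.
- move=> Y M LY dY; rewrite mulr_suml; apply: le_trans (ler_norm_sum _ _ _) _.
  apply: ler_sum => i _; apply: le_trans (qf_le dY (H12_L2 u i)) _.
  by rewrite mulrAC.
- exact: (test_L2 X 0).
- by move=> n; have [H1 H2] := test_coef_decay X 4 n; split; [exact: le_trans H1 K5|exact: le_trans H2 K5].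
- by move=> n; have [H1 H2] := test_coef_decay X 5 n; split; [exact: le_trans H1 K6|exact: le_trans H2 K6].
- exact: uc.
- exact: us.
Qed.

Lemma stationaryP (u : H12 R k) : stationary u <-> inner_variation u = dist0.
Proof.
split=> [su|u0 X phi Hphi]; last first.
  by have := half_energy_flow_derive u Hphi; rewrite u0 /= mulr0.
rewrite inner_variationE.
have V0 X phi : is_flow X phi -> variation u X = 0.
  move=> Hphi; have [_ D0] := su X phi Hphi.
  have [_] := half_energy_flow_derive u Hphi; rewrite D0 inner_variationE => /esym/eqP.
  by rewrite mulf_eq0 pnatr_eq0 => /eqP.
apply: variation_trig_eq0 => n.
- by have [phi /V0] := @cosn_flow_exists R n.
- by have [phi /V0] := @sinn_flow_exists R n.
Qed.

End main.

(* The factor 2 is the derivative of the square in the energy, which is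
   normalised without the factor 1/2. *)
Theorem proposition2p3 (R : realType) (k : nat) :
  (forall (u : H12 R k) (X : test_function R) (phi : R -> R -> R), is_flow X phi ->
    is_derive (0 : R) (1 : R) (fun t => half_energy (u \o phi t))
      (2 * inner_variation u X)) /\
  (forall u : H12 R k, stationary u <-> inner_variation u = dist0) /\
  continuous (inner_variation : H12 R k -> circle_distr R).
Proof.
split; first by move=> u X phi; exact: half_energy_flow_derive.
split; first exact: stationaryP.
have -> : (inner_variation : H12 R k -> circle_distr R) = variation.
  by apply/funext => u; exact: inner_variationE.
exact: variation_continuous.
Qed.
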